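(* Let $M$ be a JBW$^*$-triple with predual $M_*$ and let $A\subset M_*$ be a bounded set. Then $$\omega(A)=\mathrm{wk}_{M_*}(A)=\mathrm{wck}_{M_*}(A).$$
   Context: For a Banach space $X$ and nonempty sets $A,B\subset X$, put $\widehat{d}(A,B)=\sup\{\operatorname{dist}(a,B): a\in A\}$. For a bounded set $A\subset X$, define: - the De Blasi measure $\omega(A)=\inf\{\widehat{d}(A,K): K\subset X \text{ weakly compact}\}$; - $\mathrm{wk}_X(A)=\widehat{d}(\overline{A}^{w^*},X)$, where $\overline{A}^{w^*}$ is the weak$^*$ closure of $A$ in $X^{**}$ and $X$ is canonically embedded in $X^{**}$; - $\mathrm{wck}_X(A)=\sup\{\operatorname{dist}(\operatorname{clust}_{w^*}(x_n),X): (x_n) \text{ a sequence in } A\}$, where $\operatorname{clust}_{w^*}(x_n)\subset X^{**}$ is the set of weak$^*$ cluster points of $(x_n)$ and $\operatorname{dist}(S,X)=\inf_{s\in S}\operatorname{dist}(s,X)$. A JB$^*$-triple is a complex Banach space $E$ with a continuous triple product $\{\cdot,\cdot,\cdot\}:E^3\to E$ that is symmetric and bilinear in the outer variables and conjugate-linear in the middle one, satisfying the Jordan identity $L(x,y)L(a,b)=L(L(x,y)a,b)-L(a,L(y,x)b)+L(a,b)L(x,y)$, where $L(a,b)x=\{a,b,x\}$; each $L(a,a)$ is hermitian with nonnegative spectrum; and $\|\{a,a,a\}\|=\|a\|^3$. A JBW$^*$-triple is a JB$^*$-triple that is a dual Banach space. It has a unique isometric predual $M_*$, and its triple product is separately weak$^*$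 continuous. *)

(* Defs.v *)
From HB Require Import structures.
From mathcomp Require Import all_boot all_order all_algebra.
From mathcomp Require Import all_classical all_reals.
From mathcomp Require Import ereal.
From mathcomp Require Import complex.

Set Implicit Arguments.
Unset Strict Implicit.
Unset Printing Implicit Defensive.

Import Order.TTheory GRing.Theory Num.Theory.
Local Open Scope classical_set_scope.
Local Open Scope ring_scope.

Notation normc := ComplexField.Normc.normc.

Section Defs.
Variable R : realType.
Local Notation C := (R[i]).
Variable E : lmodType C.
Variable n : E -> R.   (* the norm of the complex Banach space E (the predual M_* ) *)

Record cbanach : Prop := {
  nrm_ge0 : forall x, 0 <= n x;
  nrm_eq0 : forall x, n x = 0 -> x = 0;
  nrm_triangle : forall x y, n (x + y) <= n x + n y;
  nrm_scale : forall (c : C) x, n (c *: x) = normc c * n x;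
  nrm_complete : forall u : nat -> E,
    (forall e : R, 0 < e -> exists N, forall p q, (N <= p)%N -> (N <= q)%N ->
        n (u p - u q) < e) ->
    exists l, forall e : R, 0 < e -> exists N, forall p, (N <= p)%N -> n (u p - l) < e }.

Definition bounded_set (A : set E) : Prop := exists K : R, forall a, A a -> n a <= K.

Definition is_dual (f : E -> C) : Prop :=
  (forall (a : C) x y, f (a *: x + y) = a * f x + f y) /\
  exists K : R, forall x, normc (f x) <= K * n x.

Definition Dset : set (E -> C) := [set f | is_dual f].

Definition dnorm (f : E -> C) : \bar R :=
  ereal_sup [set (normc (f x))%:E | x in [set x | n x <= 1]].

Definition fadd (f g : E -> C) : E -> C := fun x => f x + g x.
Definition fsub (f g : E -> C) : E -> C := fun x => f x - g x.
Definition fscale (a : C) (f : E -> C) : E -> C := fun x => a * f x.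

Definition is_bidual (P : (E -> C) -> C) : Prop :=
  (forall (a : C) f g, Dset f -> Dset g -> P (fadd (fscale a f) g) = a * P f + P g) /\
  exists K : R, forall f, Dset f -> ((normc (P f))%:E <= K%:E * dnorm f)%E.

Definition bdnorm (P : (E -> C) -> C) : \bar R :=
  ereal_sup [set (normc (P f))%:E | f in [set f | Dset f /\ (dnorm f <= 1%:E)%E]].

Definition dist_to_E (P : (E -> C) -> C) : \bar R :=
  ereal_inf [set bdnorm (fun f => P f - f x) | x in [set: E]].

(* ---- JB*-triple structure on M = E^* (so M is a JBW*-triple with predual E) ---- *)
Definition in_spectrum (T : (E -> C) -> (E -> C)) (l : C) : Prop :=
  ~ (forall g, Dset g -> exists! f, Dset f /\ fsub (T f) (fscale l f) = g).

(* hermitian operator on M: its numerical range is real *)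
Definition hermitian (T : (E -> C) -> (E -> C)) : Prop :=
  forall f P, Dset f -> dnorm f = 1%:E -> is_bidual P -> bdnorm P = 1%:E -> P f = 1 ->
    Im (P (T f)) = 0.

Record JBstar_triple_on_dual (tp : (E -> C) -> (E -> C) -> (E -> C) -> (E -> C)) : Prop := {
  tp_closed : forall a b c, Dset a -> Dset b -> Dset c -> Dset (tp a b c);
  tp_linear_l : forall (al : C) a a' b c, Dset a -> Dset a' -> Dset b -> Dset c ->
    tp (fadd (fscale al a) a') b c = fadd (fscale al (tp a b c)) (tp a' b c);
  tp_sym : forall a b c, Dset a -> Dset b -> Dset c -> tp a b c = tp c b a;
  tp_conjlinear_m : forall (al : C) a b b' c, Dset a -> Dset b -> Dset b' -> Dset c ->
    tp a (fadd (fscale al b) b') c = fadd (fscale (conjc al) (tp a b c)) (tp a b' c);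
  tp_continuous : forall a b c, Dset a -> Dset b -> Dset c ->
    forall e : R, 0 < e -> exists d : R, 0 < d /\
      forall a' b' c', Dset a' -> Dset b' -> Dset c' ->
        (dnorm (fsub a' a) < d%:E)%E -> (dnorm (fsub b' b) < d%:E)%E ->
        (dnorm (fsub c' c) < d%:E)%E ->
        (dnorm (fsub (tp a' b' c') (tp a b c)) < e%:E)%E;
  tp_jordan : forall x y a b c, Dset x -> Dset y -> Dset a -> Dset b -> Dset c ->
    tp x y (tp a b c) =
    fadd (fsub (tp (tp x y a) b c) (tp a (tp y x b) c)) (tp a b (tp x y c));
  tp_hermitian : forall a, Dset a -> hermitian (tp a a);
  tp_spectrum : forall a, Dset a -> forall l : C, in_spectrum (tp a a) l -> 0 <= l;
  tp_norm : forall a, Dset a -> dnorm (tp a a a) = (dnorm a * dnorm a * dnorm a)%E }.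

Definition weak_open (U : set E) : Prop :=
  forall x, U x -> exists (k : nat) (fs : nat -> E -> C) (e : R),
    0 < e /\ (forall i, (i < k)%N -> Dset (fs i)) /\
    forall y, (forall i, (i < k)%N -> normc (fs i y - fs i x) < e) -> U y.

Definition weakly_compact (K : set E) : Prop :=
  forall F : set (set E), (forall U, F U -> weak_open U) ->
    K `<=` (fun x => exists U, F U /\ U x) ->
    exists (k : nat) (g : nat -> set E), (forall i, (i < k)%N -> F (g i)) /\
      K `<=` (fun x => exists i, (i < k)%N /\ g i x).

Definition dist_pt (a : E) (B : set E) : \bar R :=
  ereal_inf [set (n (a - b))%:E | b in B].

Definition hdist (A B : set E) : \bar R := ereal_sup [set dist_pt a B | a in A].

Definition deBlasi (A : set E) : \bar R :=
  ereal_inf [set hdist A K | K in [set K | K !=set0 /\ weakly_compact K]].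

Definition wstar_closure (A : set E) : set ((E -> C) -> C) :=
  [set P | is_bidual P /\
    forall (k : nat) (fs : nat -> E -> C) (e : R), (forall i, (i < k)%N -> Dset (fs i)) ->
      0 < e -> exists a, A a /\ forall i, (i < k)%N -> normc (P (fs i) - fs i a) < e].

Definition wk (A : set E) : \bar R := ereal_sup [set dist_to_E P | P in wstar_closure A].

Definition wstar_clust (u : nat -> E) : set ((E -> C) -> C) :=
  [set P | is_bidual P /\
    forall (k : nat) (fs : nat -> E -> C) (e : R) (N : nat),
      (forall i, (i < k)%N -> Dset (fs i)) -> 0 < e ->
      exists m, (N <= m)%N /\ forall i, (i < k)%N -> normc (P (fs i) - fs i (u m)) < e].

Definition wck (A : set E) : \bar R :=
  ereal_sup [set ereal_inf [set dist_to_E P | P in wstar_clust u]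
            | u in [set u : nat -> E | forall m, A (u m)]].

End Defs.

(* Main.v *)
From HB Require Import structures.
From mathcomp Require Import all_boot all_order all_algebra.
From mathcomp Require Import all_classical all_reals.
From mathcomp Require Import ereal complex separable cyclotomic cyclic ring lra zify.

(* The inequalities wck <= wk <= omega follow from ultralimits.  For omega <= wck, suppose that
   every weakly compact set stays at distance more than [lam] from some point of [A].

   Geometry of the triple M = E^*: if a functional f attains its norm at z, |z| = 1, then
   f{z,z,c} = f(c) and f{z,c,z} is the conjugate of f(c), so c - {z,c,z} is tangent to the unit
   sphere at z; Euler steps along this field show that f{c,c,z} >= 0.  Hence 1 - t L(x,x) is a
   contraction up to O(t^2), and Cartan-type uniqueness arguments give the separate weak-star
   continuity of the triple product.

   For a_1, ..., a_m in E normed by z_1, ..., z_m in M, the elements of E representing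
   f |-> t sum_i {f,w,z_i}(a_i), |w| <= 1, form a convex weakly compact set.  A point a of [A] far
   from it is separated from it by some x in the unit ball of M, and then every {x,x,z_i}(a_i) is
   small.  It follows that B = (1 - tau L(x,x))^k barely moves the values at the a_i, while
   |theta r x + B y| <= 1 + eps on the unit ball: the path from B y to B y + r x is almost an
   integral curve of tangent fields.  Iterating yields a sequence (a_m) in [A] and f_k in the unit
   ball of M with f_k -> 0 weak-star and |f_k(a_m)| >= lam - eps for m >= k, so every weak-star
   cluster point of (a_m) is at distance at least lam - eps from E. *)

(** The axioms supply algebra, reality of the numerical range of L(a,a), an algebraic statement on
    its spectrum, and the cube identity. Contractivity of the product, functional calculus and
    weak-star continuity are not among them, so everything is extracted from functionals that attain
    their norm. The entry point is f{z,z,z} = 1 for f norming a unit vector z: a spectral radius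
    estimate gives |z + c(z - {z,z,z})| <= 1 for some c > 0, as the scalar picture predicts, t + c(t
    - t^3) being at most 1 on [0,1] for small c. First-order comparison near z then yields f{z,z,c}
    = f(c). Weak-star compactness enters through ultralimits, so a failure of continuity is itself a
    linear or bilinear map, to which Cartan's argument applies. The operator B makes the induction
    run: x and a unit vector y cannot be added inside the ball, but once B has removed from y almost
    everything that meets x, the two behave like disjoint elements. The resulting witnesses are
    modelled on c0, and the absolute summability of their coordinates is the reason for f_k -> 0. *)

Set Implicit Arguments.
Unset Strict Implicit.
Unset Printing Implicit Defensive.
Import Order.TTheory GRing.Theory Num.Theory.
Local Open Scope classical_set_scope.
Local Open Scope ring_scope.
Local Open Scope complex_scope.
Local Notation Re := complex.Re.
Local Notation Im := complex.Im.
Require Import Defs.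

(* Linear identities in a complex vector space, decided by comparing coefficients. *)
Section LmodTac.
Variables (R : rcfType) (V : lmodType R[i]).
Inductive lexp := LX of nat | L0 | LA of lexp & lexp | LO of lexp | LS of R[i] & lexp.
Fixpoint lev (env : seq V) (e : lexp) : V :=
  match e with
  | LX i => nth 0 env i | L0 => 0 | LA a b => lev env a + lev env b
  | LO a => - lev env a | LS c a => c *: lev env a end.
Fixpoint lco (e : lexp) (i : nat) : R[i] :=
  match e with
  | LX j => if Nat.eqb j i then 1 else 0 | L0 => 0 | LA a b => lco a i + lco b i
  | LO a => - lco a i | LS c a => c * lco a i end.
Lemma levE env e : lev env e = \sum_(i < size env) lco e i *: nth 0 env i.
Proof.
elim: e => [j| |a IHa b IHb|a IHa|c a IHa] /=; rewrite ?IHa ?IHb.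
- have [jn|nj] := ltnP j (size env).
    rewrite (bigD1 (Ordinal jn)) //= PeanoNat.Nat.eqb_refl scale1r big1 ?addr0 // => i ij.
    case: (PeanoNat.Nat.eqb_spec j i) => [e|]; rewrite ?scale0r //.
    by case/negP: ij; apply/eqP/val_inj.
  rewrite nth_default // big1 // => i _.
  case: (PeanoNat.Nat.eqb_spec j i) => [e|]; rewrite ?scale0r //.
  by move: nj; rewrite e leqNgt ltn_ord.
- by rewrite big1 // => i _; rewrite scale0r.
- by rewrite -big_split; apply: eq_bigr => i _; rewrite scalerDl.
- by rewrite -sumrN; apply: eq_bigr => i _; rewrite scaleNr.
- by rewrite scaler_sumr; apply: eq_bigr => i _; rewrite scalerA.
Qed.
Fixpoint lchk n (a b : lexp) : Prop :=
  if n is n'.+1 then lco a n' = lco b n' /\ lchk n' a b else True.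
Lemma lmodP env a b : lchk (size env) a b -> lev env a = lev env b.
Proof.
move=> h; rewrite !levE; apply: eq_bigr => i _; congr (_ *: _).
move: h; move: (nat_of_ord i) (ltn_ord i) => j; elim: (size env) => //= n IH.
by rewrite ltnS leq_eqVlt => /orP[/eqP -> []//|lt [_]]; exact: IH.
Qed.
End LmodTac.

Ltac lm_mem x l := lazymatch l with
  | nil => constr:(false)
  | ?y :: ?l' => match goal with
     | _ => let _ := match goal with _ => constr_eq x y end in constr:(true)
     | _ => lm_mem x l' end end.
Ltac lm_atoms V x l := lazymatch x with
  | @GRing.add _ ?a ?b => let l1 := lm_atoms V a l in lm_atoms V b l1
  | @GRing.opp _ ?a => lm_atoms V a l
  | @GRing.scale _ _ ?c ?a => lm_atoms V a l
  | @GRing.zero _ => l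
  | _ => let m := lm_mem x l in lazymatch m with true => l | false => constr:(x :: l) end end.
Ltac lm_idx x l := lazymatch l with
  | ?y :: ?l' => match goal with
     | _ => let _ := match goal with _ => constr_eq x y end in constr:(O)
     | _ => let n := lm_idx x l' in constr:(S n) end end.
Ltac lm_reify R x l := lazymatch x with
  | @GRing.add _ ?a ?b => let u := lm_reify R a l in let v := lm_reify R b l in constr:(LA u v)
  | @GRing.opp _ ?a => let u := lm_reify R a l in constr:(LO u)
  | @GRing.scale _ _ ?c ?a => let u := lm_reify R a l in constr:(LS c u)
  | @GRing.zero _ => constr:(@L0 R)
  | _ => let n := lm_idx x l in constr:(@LX R n) end.
Ltac lmod R V :=
  lazymatch goal with |- ?x = ?y =>
    let l0 := constr:(@nil V) in
    let l1 := lm_atoms V x l0 in let l := lm_atoms V y l1 in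
    let u := lm_reify R x l in let v := lm_reify R y l in
    change (lev l u = lev l v); apply: lmodP;
    cbn [size lchk lco Nat.eqb];
    repeat split; ring end.

(* The contexts below are large, and almost every linear step uses only recent hypotheses. *)
Ltac revert_recent := match goal with
  | R : realType, H : ?P |- _ => lazymatch P with
    | is_true (@Order.le _ _ _ _) => revert H
    | is_true (@Order.lt _ _ _ _) => revert H
    | @eq ?T _ _ => unify T (Real.sort R); revert H
    end
  end.
Ltac clear_context := repeat match goal with H : _ |- _ => move=> {H} end; intros;
  repeat match goal with
  | |- ?x = true => change (is_true x)
  | H : ?x = true |- _ => change (is_true x) in H
  end.
Tactic Notation "recent" integer(n) := do n (try revert_recent); clear_context.
Ltac rlra := first [solve [recent 5; lra] | solve [recent 12; lra] | solve [recent 22; lra] | lra].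
Ltac rnra := first [solve [recent 4; nra] | solve [recent 8; nra] | nra].

(** * Complex numbers and ultralimits *)

Section ComplexNumbers.
Variable R : realType.
Implicit Types z w : R[i].

Lemma ReD z w : Re (z + w) = Re z + Re w. Proof. by case: z; case: w. Qed.
Lemma ReN z : Re (- z) = - Re z. Proof. by case: z. Qed.
Lemma ReB z w : Re (z - w) = Re z - Re w. Proof. by rewrite ReD ReN. Qed.
Lemma ImD z w : Im (z + w) = Im z + Im w. Proof. by case: z; case: w. Qed.
Lemma ImN z : Im (- z) = - Im z. Proof. by case: z. Qed.
Lemma ReM z w : Re (z * w) = Re z * Re w - Im z * Im w.
Proof. by case: z; case: w. Qed.
Lemma ImM z w : Im (z * w) = Re z * Im w + Im z * Re w.
Proof. by case: z => a b; case: w => c d /=; ring. Qed.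
Lemma ReMr (t : R) z : Re (t%:C * z) = t * Re z.
Proof. by case: z => a b /=; ring. Qed.
Lemma ImMr (t : R) z : Im (t%:C * z) = t * Im z.
Proof. by case: z => a b /=; ring. Qed.
Lemma ReR (t : R) : Re t%:C = t. Proof. by []. Qed.
Lemma Re_conj z : Re (conjc z) = Re z. Proof. by case: z. Qed.
Lemma Im_conj z : Im (conjc z) = - Im z. Proof. by case: z. Qed.
Lemma complex_ext z w : Re z = Re w -> Im z = Im w -> z = w.
Proof. by case: z => a b; case: w => c d /= -> ->. Qed.
Lemma conjcD z w : conjc (z + w) = conjc z + conjc w.
Proof. by apply: complex_ext; rewrite ?(ReD, ImD, Re_conj, Im_conj) //; ring. Qed.
Lemma conjcM z w : conjc (z * w) = conjc z * conjc w.
Proof. by apply: complex_ext; rewrite ?(ReM, ImM, Re_conj, Im_conj) //; ring. Qed.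

Lemma normcE2 z : normc z = Num.sqrt (Re z ^+ 2 + Im z ^+ 2).
Proof. by case: z. Qed.
Lemma normc_ge0 z : 0 <= normc z.
Proof. by rewrite normcE2 sqrtr_ge0. Qed.
Lemma normc_sq z : normc z ^+ 2 = Re z ^+ 2 + Im z ^+ 2.
Proof. by rewrite normcE2 sqr_sqrtr // addr_ge0 // sqr_ge0. Qed.
Lemma normcR (t : R) : normc t%:C = `|t|.
Proof. by rewrite normcE2 /= expr0n addr0 sqrtr_sqr. Qed.
Lemma normcD z w : normc (z + w) <= normc z + normc w.
Proof. exact: le_normcD. Qed.
Lemma normcB z w : normc (z - w) <= normc z + normc w.
Proof. by rewrite -(normcN w) normcD. Qed.
Lemma normc_dist z w : normc (z - w) = normc (w - z).
Proof. by rewrite -normcN opprB. Qed.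
Lemma normcM z w : normc (z * w) = normc z * normc w.
Proof. exact: Normc.normcM. Qed.
Lemma normc_conj z : normc (conjc z) = normc z.
Proof. by rewrite !normcE2 Re_conj Im_conj sqrrN. Qed.
Lemma normc_i : normc ('i : R[i]) = 1.
Proof. by rewrite normcE2 /= expr0n expr1n add0r sqrtr1. Qed.
Lemma normcX z k : normc (z ^+ k) = normc z ^+ k.
Proof. by elim: k => [|k IH]; rewrite ?(expr0, Normc.normc1) // !exprS normcM IH. Qed.
Lemma Re_le_normc z : Re z <= normc z.
Proof.
rewrite normcE2; apply: le_trans (ler_norm _) _; rewrite -sqrtr_sqr ler_wsqrtr //.
by rewrite lerDl sqr_ge0.
Qed.
Lemma abs_Re_le z : `|Re z| <= normc z.
Proof. by rewrite normcE2 -sqrtr_sqr ler_wsqrtr // lerDl sqr_ge0. Qed.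
Lemma abs_Im_le z : `|Im z| <= normc z.
Proof. by rewrite normcE2 -sqrtr_sqr ler_wsqrtr // lerDr sqr_ge0. Qed.
Lemma normc_le_ReIm z : normc z <= `|Re z| + `|Im z|.
Proof.
rewrite normcE2 -(ger0_norm (addr_ge0 (normr_ge0 (Re z)) (normr_ge0 (Im z)))) -sqrtr_sqr.
rewrite ler_wsqrtr // sqrrD !real_normK ?num_real //.
by have := mulr_ge0 (normr_ge0 (Re z)) (normr_ge0 (Im z)); rlra.
Qed.
Lemma Re_norm_eq z (r : R) : Re z = r -> normc z <= r -> z = r%:C.
Proof.
move=> e1 le1; apply: complex_ext => //=.
have r0 : 0 <= r := le_trans (normc_ge0 _) le1.
have := normc_sq z; have : normc z ^+ 2 <= r ^+ 2 by rewrite lerXn2r ?nnegrE ?normc_ge0.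
rewrite e1 => l2 e2; apply/eqP; rewrite -sqrf_eq0 eq_le sqr_ge0 andbT; rlra.
Qed.
Lemma phase z : exists th : R[i], normc th = 1 /\ th * z = (normc z)%:C.
Proof.
have [->|z0] := eqVneq z 0; first by exists 1; rewrite Normc.normc1 mulr0 Normc.normc0.
have n0 : normc z != 0 by apply: contra z0 => /eqP/Normc.eq0_normc ->.
exists (((normc z)%:C) / z); rewrite mulfVK // normcM Normc.normcV normcR.
by rewrite ger0_norm ?normc_ge0 // mulfV.
Qed.
Lemma normc_rotP z (r : R) : (forall th, normc th = 1 -> Re (th * z) <= r) -> normc z <= r.
Proof. by move=> h; have [th [t1 e]] := phase z; have := h _ t1; rewrite e. Qed.
Lemma normc_le0 z : normc z <= 0 -> z = 0.
Proof. by move=> h; apply: Normc.eq0_normc; apply/eqP; rewrite eq_le h normc_ge0. Qed.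
End ComplexNumbers.

Section Ultralimits.
Variables (R : realType) (I : Type) (U : set_system I).
Hypothesis UF : UltraFilter U.
Implicit Types g : I -> R[i].

Definition ucv (g : I -> R[i]) (l : R[i]) :=
  forall e : R, 0 < e -> U [set i | normc (g i - l) < e].

Lemma ultra_ex (A : set I) : U A -> exists i, A i.
Proof. by move=> UA; apply: filter_ex UA. Qed.
Lemma ultraI (A B : set I) : U A -> U B -> U (A `&` B).
Proof. exact: filterI. Qed.
Lemma ultraS (A B : set I) : A `<=` B -> U A -> U B.
Proof. exact: filterS. Qed.

(** The limit is the supremum of the levels that [g] reaches on a set of [U]; a level above it is
    missed, and the ultrafilter property turns this into an upper bound on a set of [U]. *)
Lemma ucvR_ex (g : I -> R) (K : R) : (forall i, `|g i| <= K) ->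
  exists l, forall e : R, 0 < e -> U [set i | `|g i - l| < e].
Proof.
move=> bg; pose S := [set r | U [set i | r <= g i]].
have S0 : S (- K).
  rewrite /S /=; apply: (ultraS _ (@filterT _ U _)) => i _ /=.
  by have := bg i; rewrite ler_norml => /andP[].
have ubS : ubound S K.
  move=> r /ultra_ex [i /= ri]; apply: le_trans ri _.
  by have := bg i; rewrite ler_norml => /andP[].
have hS : has_sup S by split; [exists (- K) | exists K].
exists (sup S) => e e0.
have e2 : 0 < e / 2 by rlra.
have [r Sr rl] := @sup_adherent _ S (e/2) e2 hS.
have nS : ~ S (sup S + e / 2).
  by move=> /(ub_le_sup hS.2); rewrite gerDl leNgt e2.
have := in_ultra_setVsetC [set i | sup S + e / 2 <= g i] UF; case => // UC.
apply: ultraS (ultraI Sr UC) => i /= [ri /negP]; rewrite -ltNge => gi.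
by rewrite ltr_distl; apply/andP; split; rlra.
Qed.

Lemma ucv_ex g (K : R) : (forall i, normc (g i) <= K) -> exists l, ucv g l.
Proof.
move=> bg.
have [a ha] := @ucvR_ex (fun i => Re (g i)) K (fun i => le_trans (abs_Re_le _) (bg i)).
have [b hb] := @ucvR_ex (fun i => Im (g i)) K (fun i => le_trans (abs_Im_le _) (bg i)).
exists (a +i* b) => e e0; have e2 : 0 < e / 2 by rlra.
apply: ultraS (ultraI (ha _ e2) (hb _ e2)) => i /= [h1 h2].
apply: le_lt_trans (normc_le_ReIm _) _.
by rewrite ReD ImD ReN ImN /=; rlra.
Qed.

Lemma ucv_uniq g l l' : ucv g l -> ucv g l' -> l = l'.
Proof.
move=> h h'; apply/eqP; rewrite -subr_eq0; apply/eqP/normc_le0.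
rewrite leNgt; apply/negP => d0.
have d2 : 0 < normc (l - l') / 2 by rlra.
have [i [/= h1 h2]] := ultra_ex (ultraI (h _ d2) (h' _ d2)).
have : normc (l - l') <= normc (l - g i) + normc (g i - l').
  by rewrite -[l - l'](subrKA (g i)) normcD.
by rewrite (normc_dist l (g i)); rlra.
Qed.

Lemma ucv_cst l : ucv (fun=> l) l.
Proof.
move=> e e0; apply: (ultraS _ (@filterT _ U _)) => i _ /=.
by rewrite subrr Normc.normc0.
Qed.
Lemma ucvD g g' l l' : ucv g l -> ucv g' l' -> ucv (fun i => g i + g' i) (l + l').
Proof.
move=> h h' e e0; have e2 : 0 < e / 2 by rlra.
apply: ultraS (ultraI (h _ e2) (h' _ e2)) => i /= [h1 h2].
by rewrite opprD addrACA; apply: le_lt_trans (normcD _ _) _; rlra.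
Qed.
Lemma ucvZ g l a : ucv g l -> ucv (fun i => a * g i) (a * l).
Proof.
move=> h e e0; have a0 := normc_ge0 a.
have e2 : 0 < e / (normc a + 1) by apply: divr_gt0 => //; rlra.
apply: ultraS (h _ e2) => i /= h1.
rewrite -mulrBr normcM; move: h1; rewrite ltr_pdivlMr; last by rlra.
by have := normc_ge0 (g i - l); rnra.
Qed.
Lemma ucvN g l : ucv g l -> ucv (fun i => - g i) (- l).
Proof. by move=> h e e0; apply: ultraS (h e e0) => i /=; rewrite -opprD normcN. Qed.
Lemma ucvB g g' l l' : ucv g l -> ucv g' l' -> ucv (fun i => g i - g' i) (l - l').
Proof. by move=> h h'; apply: ucvD => //; exact: ucvN. Qed.
Lemma ucv_le_near g l (K : R) (A : set I) :
  U A -> (forall i, A i -> normc (g i) <= K) -> ucv g l -> normc l <= K.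
Proof.
move=> UA bg h; rewrite leNgt; apply/negP => lK.
have e0 : 0 < normc l - K by rlra.
have [i [/= h1 /bg h2]] := ultra_ex (ultraI (h _ e0) UA).
have : normc l <= normc (l - g i) + normc (g i) by rewrite -{1}[l](subrK (g i)) normcD.
by rewrite normc_dist; rlra.
Qed.
Lemma ucv_le g l (K : R) : (forall i, normc (g i) <= K) -> ucv g l -> normc l <= K.
Proof. by move=> bg; apply: ucv_le_near (@filterT _ U _) _ => i _. Qed.
Lemma ucv_ge_near g l (K : R) (A : set I) :
  U A -> (forall i, A i -> K <= normc (g i)) -> ucv g l -> K <= normc l.
Proof.
move=> UA bg h; rewrite leNgt; apply/negP => lK.
have e0 : 0 < K - normc l by rlra.
have [i [/= h1 /bg h2]] := ultra_ex (ultraI (h _ e0) UA).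
have : normc (g i) <= normc (g i - l) + normc l by rewrite -{1}[g i](subrK l) normcD.
rlra.
Qed.
End Ultralimits.

(** * Norms and Hahn-Banach extension *)

Section Norms.
Variables (R : realType) (V : lmodType R[i]) (N : V -> R).
Hypothesis HN : cbanach N.
Implicit Types x y z : V.

Lemma N_ge0 x : 0 <= N x. Proof. exact: nrm_ge0. Qed.
Lemma NZ c x : N (c *: x) = normc c * N x. Proof. exact: nrm_scale. Qed.
Lemma NZr (t : R) x : N (t%:C *: x) = `|t| * N x. Proof. by rewrite NZ normcR. Qed.
Lemma NZp (t : R) x : 0 <= t -> N (t%:C *: x) = t * N x.
Proof. by move=> t0; rewrite NZr ger0_norm. Qed.
Lemma N0 : N 0 = 0. Proof. by rewrite -(scale0r 0) NZ Normc.normc0 mul0r. Qed.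
Lemma NN x : N (- x) = N x.
Proof. by rewrite -scaleN1r NZ normcN Normc.normc1 mul1r. Qed.
Lemma ND x y : N (x + y) <= N x + N y. Proof. exact: nrm_triangle. Qed.
Lemma NB x y : N (x - y) <= N x + N y. Proof. by rewrite -(NN y) ND. Qed.
Lemma NBC x y : N (x - y) = N (y - x). Proof. by rewrite -NN opprB. Qed.
Lemma N_sub_ge x y : N x - N y <= N (x - y).
Proof. by have := ND (x - y) y; rewrite subrK; rlra. Qed.
Lemma N_eq0 x : N x <= 0 -> x = 0.
Proof. by move=> h; apply: (nrm_eq0 HN); apply/eqP; rewrite eq_le h N_ge0. Qed.
Lemma N_sum n (F : nat -> V) : N (\sum_(i < n) F i) <= \sum_(i < n) N (F i).
Proof.
elim: n => [|n IH]; first by rewrite !big_ord0 N0.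
by rewrite !big_ord_recr /=; apply: le_trans (ND _ _) _; rewrite lerD2r.
Qed.

Definition lfun (f : V -> R[i]) := forall a x y, f (a *: x + y) = a * f x + f y.
(** Norming functionals at [x], for [x] of any norm; at [x = 0] every linear contraction
    qualifies. *)
Definition supp (f : V -> R[i]) x :=
  [/\ lfun f, (forall v, normc (f v) <= N v) & f x = (N x)%:C].

Section Lfun.
Variable f : V -> R[i].
Hypothesis lf : lfun f.
Lemma lfun0 : f 0 = 0.
Proof. by have := lf (-1) 0 0; rewrite scaler0 addr0 mulN1r addNr. Qed.
Lemma lfunD x y : f (x + y) = f x + f y.
Proof. by rewrite -{1}(scale1r x) lf mul1r. Qed.
Lemma lfunZ a x : f (a *: x) = a * f x.
Proof. by rewrite -{1}(addr0 (a *: x)) lf lfun0 addr0. Qed.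
Lemma lfunN x : f (- x) = - f x.
Proof. by rewrite -scaleN1r lfunZ mulN1r. Qed.
Lemma lfunB x y : f (x - y) = f x - f y.
Proof. by rewrite lfunD lfunN. Qed.
Lemma lfun_Re_bound (c : R) : (forall v, Re (f v) <= c * N v) ->
  forall v, normc (f v) <= c * N v.
Proof.
move=> h v; apply: normc_rotP => th t1; rewrite -lfunZ.
by apply: le_trans (h _) _; rewrite NZ t1 mul1r.
Qed.
End Lfun.

Lemma supp_scale f x (t : R) : 0 <= t -> supp f x -> supp f (t%:C *: x).
Proof.
by move=> t0 [lf cf fx]; split=> //; rewrite lfunZ // fx NZp // rmorphM.
Qed.
Lemma supp_Re f x v : supp f x -> Re (f v) <= N v.
Proof. by move=> [_ cf _]; exact: le_trans (Re_le_normc _) (cf v). Qed.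

(** Partial real-linear functionals below [p], encoded by their graphs so that extension is
    inclusion and Zorn's lemma applies to sets. Single-valuedness follows from domination, see
    [hb_uniq]. *)
Definition hb_graph (p : V -> R) (G : set (V * R)) :=
  [/\ G (0, 0),
      (forall a b, G a -> G b -> G (a.1 + b.1, a.2 + b.2)),
      (forall a (t : R), G a -> G (t%:C *: a.1, t * a.2)) &
      (forall a, G a -> a.2 <= p a.1)].

Section HB.
Variable p : V -> R.
Hypothesis pD : forall x y, p (x + y) <= p x + p y.
Hypothesis pZ : forall (t : R) x, 0 < t -> p (t%:C *: x) = t * p x.

Lemma hb_uniq G x r s : hb_graph p G -> G (x, r) -> G (x, s) -> r = s.
Proof.
move=> [g0 gD gZ gp].
suff main r' s' : G (x, r') -> G (x, s') -> r' <= s'.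
  by move=> h1 h2; apply/eqP; rewrite eq_le !main.
move=> h1 h2; have h3 : G (0, r' - s').
  have := gD _ _ h1 (gZ _ (-1) h2) => /=.
  by rewrite rmorphN1 scaleN1r subrr mulN1r.
rewrite -subr_le0.
have p0 : p 0 <= 0.
  by have := @pZ 2 0 (ltr0Sn _ _); rewrite scaler0; rlra.
by have /= := gp _ h3; rlra.
Qed.

Lemma hb_extend G v0 : hb_graph p G -> (forall r, ~ G (v0, r)) ->
  exists G', [/\ hb_graph p G', G `<=` G' & exists r, G' (v0, r)].
Proof.
move=> [g0 gD gZ gp] nv.
pose S := [set s : R | exists a, G a /\ s = a.2 - p (a.1 - v0)].
have gsub a b : G a -> G b -> a.2 - p (a.1 - v0) <= p (b.1 + v0) - b.2.
  move=> Ga Gb; have /= h := gp _ (gD _ _ Ga Gb).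
  have := pD (a.1 - v0) (b.1 + v0); rewrite addrA.
  have -> : a.1 - v0 + b.1 + v0 = a.1 + b.1 by rewrite (addrAC a.1) subrK.
  rlra.
have hS : has_sup S.
  split; first by exists (0 - p (0 - v0)); exists (0, 0).
  by exists (p (0 + v0) - 0) => s [a [Ga ->]]; exact: (gsub a (0, 0)).
(* Value at [v0] of the extension: the smallest one compatible with domination on the side of
   [- v0]; [gsub] says that it also respects the other side. *)
pose al := sup S.
have al1 a : G a -> a.2 - p (a.1 - v0) <= al.
  by move=> Ga; apply: ub_le_sup; [exact: hS.2 | exists a].
have al2 b : G b -> al <= p (b.1 + v0) - b.2.
  move=> Gb; apply: ge_sup; first exact: hS.1.
  by move=> s [a [Ga ->]]; exact: gsub.
pose G' := [set c : V * R | exists a (t : R), G a /\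
  c = (a.1 + t%:C *: v0, a.2 + t * al)].
exists G'; split.
- split.
  + by exists (0, 0), 0; split=> //=; rewrite scale0r mul0r !addr0.
  + move=> _ _ [a [t [Ga ->]]] [b [s [Gb ->]]].
    exists (a.1 + b.1, a.2 + b.2), (t + s); split; first exact: gD.
    by congr (_, _) => /=; [rewrite rmorphD; lmod R V | ring].
  + move=> _ s [a [t [Ga ->]]]; exists (s%:C *: a.1, s * a.2), (s * t); split.
      exact: gZ.
    by congr (_, _) => /=; [rewrite rmorphM; lmod R V | ring].
  + move=> _ [a [t [Ga ->]]] /=.
    have [t0|t0|->] := ltgtP t 0.
    * have s0 : 0 < - t by rlra.
      have := al1 _ (gZ _ (- t)^-1 Ga) => /=.
      have -> : (- t)^-1%:C *: a.1 - v0 = (- t)^-1%:C *: (a.1 + t%:C *: v0).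
        rewrite scalerDr scalerA -rmorphM; congr (_ + _).
        by rewrite invrN mulNr mulVf ?lt_eqF // rmorphN1 scaleN1r.
      rewrite pZ ?invr_gt0 // -mulrBr mulrC ler_pdivrMr //; rlra.
    * have := al2 _ (gZ _ t^-1 Ga) => /=.
      have -> : t^-1%:C *: a.1 + v0 = t^-1%:C *: (a.1 + t%:C *: v0).
        by rewrite scalerDr scalerA -rmorphM mulVf ?gt_eqF // scale1r.
      rewrite pZ ?invr_gt0 // -mulrBr mulrC ler_pdivlMr //; rlra.
    * by rewrite scale0r mul0r !addr0; exact: gp.
- move=> a Ga; exists a, 0; split=> //; rewrite scale0r mul0r !addr0.
  by case: a {Ga}.
- by exists (0 + 1 * al), (0, 0), 1; split=> //=; rewrite rmorph1 scale1r !add0r.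
Qed.

Lemma hahn_banach (G0 : set (V * R)) : hb_graph p G0 ->
  exists g : V -> R, [/\ (forall x y, g (x + y) = g x + g y),
    (forall (t : R) x, g (t%:C *: x) = t * g x),
    (forall x, g x <= p x) & (forall a, G0 a -> g a.1 = a.2)].
Proof.
move=> hG0.
pose P (G : set (V * R)) := G = set0 \/ (hb_graph p G /\ G0 `<=` G).
have [F FP totF|A [PA Amax]] := @Zorn_bigcup (V * R)%type P.
  have [[G FG Gn]|none] := pselect (exists2 G, F G & G <> set0); last first.
    left; rewrite -subset0 => a [G FG Ga]; apply: none; exists G => // G0'.
    by rewrite G0' in Ga.
  have good H : F H -> H <> set0 -> hb_graph p H /\ G0 `<=` H.
    by move=> /FP[].
  right; split; last first.
    by move=> a G0a; exists G => //; have [_] := good _ FG Gn; exact.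
  split.
  - by exists G => //; have [[]] := good _ FG Gn.
  - move=> a b [H FH Ha] [H' FH' Hb].
    have Hn : H <> set0 by move=> h; rewrite h in Ha.
    have Hn' : H' <> set0 by move=> h; rewrite h in Hb.
    have [sub|sub] := totF _ _ FH FH'.
      by exists H' => //; have [[_ hD _ _] _] := good _ FH' Hn'; apply: hD => //; exact: sub.
    by exists H => //; have [[_ hD _ _] _] := good _ FH Hn; apply: hD => //; exact: sub.
  - move=> a t [H FH Ha]; exists H => //.
    have Hn : H <> set0 by move=> h; rewrite h in Ha.
    by have [[_ _ hZ _] _] := good _ FH Hn; exact: hZ.
  - move=> a [H FH Ha].
    have Hn : H <> set0 by move=> h; rewrite h in Ha.
    by have [[_ _ _ hp] _] := good _ FH Hn; exact: hp.
have [A0|[gA sA]] := PA.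
  exfalso; apply: (Amax G0); last by right; split.
  rewrite A0; split; first exact: sub0set.
  by move=> /(_ (0, 0)); apply; case: hG0.
have tot v : exists r, A (v, r).
  apply: contrapT => nv.
  have [r Ar|G' [gG' AG' [r G'r]]] := hb_extend (v0 := v) gA.
    by apply: nv; exists r.
  apply: (Amax G'); last by right; split=> //; exact: subset_trans AG'.
  by split=> // /(_ _ G'r) Ar; apply: nv; exists r.
have [g gP] := choice tot.
have [a0 aD aZ ap] := gA.
exists g; split.
- move=> x y; apply: (hb_uniq gA (gP _)).
  exact: (aD _ _ (gP x) (gP y)).
- move=> t x; apply: (hb_uniq gA (gP _)); exact: (aZ _ t (gP x)).
- by move=> x; exact: (ap _ (gP x)).
- by move=> a /sA Aa; apply: (hb_uniq gA (gP _)); case: a Aa.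
Qed.
End HB.

(** A complex-linear functional is determined by its real part [g]: its imaginary part must be v |->
    - g(i v). *)
Lemma complexify (g : V -> R) : (forall x y, g (x + y) = g x + g y) ->
  (forall (t : R) x, g (t%:C *: x) = t * g x) ->
  lfun (fun v => Complex (g v) (- g ('i *: v))).
Proof.
move=> gD gZ a x y; case: a => a b.
have gN v : g (- v) = - g v.
  by rewrite -scaleN1r -(rmorphN1 (real_complex R)) gZ mulN1r.
have e1 : (a +i* b) *: x + y = a%:C *: x + b%:C *: ('i *: x) + y.
  by congr (_ + _); rewrite scalerA -scalerDl; congr (_ *: _); apply: complex_ext; rewrite !(ReD, ImD, ReM, ImM) /=; ring.
have e2 : 'i *: ((a +i* b) *: x + y) = a%:C *: ('i *: x) + b%:C *: (- x) + 'i *: y.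
  rewrite scalerDr; congr (_ + _).
  rewrite scalerN -scaleNr !scalerA -scalerDl; congr (_ *: _); apply: complex_ext; rewrite !(ReD, ImD, ReM, ImM, ReN, ImN) /=; ring.
by apply: complex_ext; rewrite ?(ReD, ImD, ReM, ImM) /= ?e2 ?e1 ?gD ?gZ ?gN; ring.
Qed.

Lemma exists_supp u : exists f, supp f u.
Proof.
have pZ (t : R) x : 0 < t -> N (t%:C *: x) = t * N x by move=> t0; rewrite NZp // ltW.
pose G0 := [set a : V * R | exists t : R, a = (t%:C *: u, t * N u)].
have hG0 : hb_graph N G0.
  split.
  - by exists 0; rewrite scale0r mul0r.
  - move=> _ _ [t ->] [s ->]; exists (t + s) => /=.
    by rewrite rmorphD scalerDl mulrDl.
  - by move=> _ s [t ->]; exists (s * t) => /=; rewrite rmorphM scalerA mulrA.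
  - by move=> _ [t ->] /=; rewrite NZr ler_wpM2r ?N_ge0 ?ler_norm.
have [g [gD gZ gp gG]] := hahn_banach ND pZ hG0.
have lg := complexify gD gZ.
have cg v : normc (Complex (g v) (- g ('i *: v))) <= N v.
  rewrite -[N v]mul1r; apply: (lfun_Re_bound lg) => w /=; rewrite mul1r; exact: gp.
exists (fun v => Complex (g v) (- g ('i *: v))); split=> //.
apply: Re_norm_eq; last exact: cg.
by have /= := gG (u, N u); apply; exists 1; rewrite rmorph1 scale1r mul1r.
Qed.

(** The real theorem for Re F and the sublinear functional [c * N]; a bound on real parts becomes a
    bound on moduli by rotating the argument. *)
Lemma hahn_banach_subspace (W : set V) (F : V -> R[i]) (c : R) :
  0 <= c -> W 0 -> (forall a x y, W x -> W y -> W (a *: x + y)) ->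
  (forall a x y, W x -> W y -> F (a *: x + y) = a * F x + F y) ->
  (forall x, W x -> normc (F x) <= c * N x) ->
  exists f, [/\ lfun f, (forall v, normc (f v) <= c * N v) & forall x, W x -> f x = F x].
Proof.
move=> c0 W0 WL FL Fc.
have WD x y : W x -> W y -> W (x + y).
  by move=> wx wy; rewrite -(scale1r x); exact: WL.
have WZ a x : W x -> W (a *: x).
  by move=> wx; rewrite -(addr0 (a *: x)); exact: WL.
have F0 : F 0 = 0.
  by have := FL (-1) 0 0 W0 W0; rewrite scaler0 addr0 mulN1r addNr.
have FZ a x : W x -> F (a *: x) = a * F x.
  by move=> wx; rewrite -(addr0 (a *: x)) FL // F0 addr0.
pose G0 := [set a : V * R | W a.1 /\ a.2 = Re (F a.1)].
have pD x y : c * N (x + y) <= c * N x + c * N y.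
  by rewrite -mulrDr ler_wpM2l // ND.
have pZ (t : R) x : 0 < t -> c * N (t%:C *: x) = t * (c * N x).
  by move=> t0; rewrite NZp ?ltW //; ring.
have hG0 : hb_graph (fun x => c * N x) G0.
  split.
  - by split=> //=; rewrite F0.
  - move=> [x r] [y s] [wx ex] [wy ey]; move: wx wy ex ey => /= wx wy -> ->; split=> /=; first exact: WD.
    by rewrite -ReD; congr Re; have := FL 1 x y wx wy; rewrite scale1r mul1r.
  - by move=> [x r] t [wx ex]; move: wx ex => /= wx ->; split=> /=; [exact: WZ | rewrite FZ // ReMr].
  - by move=> [x r] [wx ex]; move: wx ex => /= wx ->; exact: le_trans (Re_le_normc _) (Fc _ wx).
have [g [gD gZ gp gG]] := hahn_banach pD pZ hG0.
have lg := complexify gD gZ.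
exists (fun v => Complex (g v) (- g ('i *: v))); split=> //.
  by move=> v; apply: (lfun_Re_bound lg) => w /=.
move=> x wx; apply: complex_ext => /=.
  by have /= := gG (x, Re (F x)); apply.
have /= -> := gG ('i *: x, Re (F ('i *: x))); last by split=> //; exact: WZ.
by rewrite FZ // ReM /=; ring.
Qed.

End Norms.

(** * Real estimates and averages over roots of unity *)

Section RealSequences.
Variable R : realType.

Lemma bernoulli (d : R) n : 0 <= d -> 1 + d *+ n <= (1 + d) ^+ n.
Proof.
move=> d0; elim: n => [|n IH]; first by rewrite mulr0n addr0 expr0.
rewrite exprS mulrS; have : 0 <= d *+ n by rewrite mulrn_wge0.
rnra.
Qed.
Lemma archi (x : R) : exists n : nat, x < n%:R.
Proof.
have [x0|x0] := leP 0 x; last by exists 0%N.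
by exists (Num.Def.archi_bound x); exact: archi_boundP.
Qed.
Lemma expr_small (q e : R) : 0 <= q -> q < 1 -> 0 < e ->
  exists n0 : nat, forall n, (n0 <= n)%N -> q ^+ n <= e.
Proof.
move=> q0 q1 e0; have [->|qn] := eqVneq q 0.
  by exists 1%N => -[|n] // _; rewrite expr0n ltW.
have qp : 0 < q by rewrite lt_neqAle eq_sym qn.
pose d := q^-1 - 1.
have d0 : 0 < d by rewrite /d subr_gt0 -invr1 ltf_pV2 ?posrE.
have [n0 hn0] := archi ((e * d)^-1).
exists n0 => n nn.
have h : (e * d)^-1 < n%:R by apply: lt_le_trans hn0 _; rewrite ler_nat.
have ed : 0 < e * d by rnra.
have h2 : 1 < e * (d *+ n).
  rewrite -mulr_natr mulrA; move: h; rewrite -ltr_pdivrMl //.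
  by rewrite mulr1.
have h3 := bernoulli n (ltW d0).
have e3 : 1 + d = q^-1 by rewrite /d; ring.
rewrite e3 exprVn in h3.
have qn0 : 0 < q ^+ n by rewrite exprn_gt0.
have : q ^+ n * (1 + d *+ n) <= 1.
  by have := ler_wpM2l (ltW qn0) h3; rewrite mulfV ?gt_eqF.
move=> h4; rnra.
Qed.
Lemma le_eps (x y c : R) : 0 <= c -> (forall e, 0 < e -> x <= y + c * e) -> x <= y.
Proof.
move=> c0 h; rewrite leNgt; apply/negP => yx.
have d0 : 0 < (x - y) / (c + 1) / 2 by rewrite !divr_gt0 //; rlra.
have := h _ d0.
have -> : c * ((x - y) / (c + 1) / 2) = (x - y) / 2 * (c / (c + 1)) by ring.
have c1 : c / (c + 1) <= 1 by rewrite ler_pdivrMr; rlra.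
have c2 : 0 <= c / (c + 1) by rewrite divr_ge0 //; rlra.
rnra.
Qed.
Lemma le_eps_near (x y c d : R) : 0 <= c -> 0 < d ->
  (forall e, 0 < e -> e <= d -> x <= y + c * e) -> x <= y.
Proof.
move=> c0 d0 h; apply: (le_eps c0) => e e0.
have [ed|de] := leP e d; first exact: h.
by apply: le_trans (h d d0 (lexx d)) _; rewrite lerD2l ler_wpM2l // ltW.
Qed.

(** Averages over these roots replace contour integrals below: they extract Taylor coefficients.
    Existence comes from X^n - 1 being split and separable. *)
Lemma prim_root_ex n : (0 < n)%N -> exists w : R[i], n.-primitive_root w.
Proof.
move=> n0.
pose p : {poly R[i]} := 'X^n - 1%:P.
have [rs ers] := closed_field_poly_normal p.
have mp : lead_coef p = 1 by apply/monicP; rewrite monicXnsubC.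
rewrite mp scale1r in ers.
have urs : uniq rs.
  rewrite -separable_prod_XsubC -ers /p polyC1; apply: separable_Xn_sub_1.
  by rewrite pnatr_eq0 -lt0n.
have srs : (n <= size rs)%N.
  have : size p = n.+1 by rewrite size_XnsubC.
  by rewrite ers size_prod_XsubC => -[->].
have ars : all n.-unity_root rs.
  apply/allP => z zrs; rewrite unity_rootE -subr_eq0.
  have : root p z by rewrite ers root_prod_XsubC.
  by rewrite /root !hornerE.
have /hasP[w _ wp] := has_prim_root n0 ars urs srs.
by exists w.
Qed.
Lemma prim_normc n (w : R[i]) : (0 < n)%N -> n.-primitive_root w -> normc w = 1.
Proof.
move=> n0 pw; have := prim_expr_order pw => /(congr1 (@normc R)).
rewrite normcX Normc.normc1 => /eqP; by rewrite pexpr_eq1 ?normc_ge0 // => /eqP.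
Qed.
Lemma root_sum n (w : R[i]) i : n.-primitive_root w ->
  \sum_(j < n) (w ^+ j) ^+ i = (if (n %| i)%N then n%:R else 0).
Proof.
move=> pw; have -> : \sum_(j < n) (w ^+ j) ^+ i = \sum_(j < n) (w ^+ i) ^+ j.
  by apply: eq_bigr => j _; rewrite -!exprM mulnC.
case: ifP => [di|di].
  have -> : w ^+ i = 1 by apply/eqP; rewrite -(prim_order_dvd pw).
  under eq_bigr => j _ do rewrite expr1n.
  by rewrite sumr_const card_ord.
have ni : w ^+ i - 1 != 0 by rewrite subr_eq0 -(prim_order_dvd pw) di.
apply: (mulfI ni); rewrite mulr0 -subrX1 -exprM mulnC exprM (prim_expr_order pw) expr1n.
by rewrite subrr.
Qed.
End RealSequences.

(** * Bounded operators and resolvents *)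

Section Operators.
Variables (R : realType) (V : lmodType R[i]) (N : V -> R).
Hypothesis HN : cbanach N.
Local Notation N_ge0 := (N_ge0 HN).
Local Notation NZ := (NZ HN).
Local Notation ND := (ND HN).
Local Notation NB := (NB HN).
Local Notation NN := (NN HN).

Definition lop (T : V -> V) := forall a x y, T (a *: x + y) = a *: T x + T y.
Definition bop (T : V -> V) (c : R) := forall v, N (T v) <= c * N v.

Section Lop.
Variable T : V -> V.
Hypothesis lT : lop T.
Lemma lop0 : T 0 = 0.
Proof. by have := lT (-1) 0 0; rewrite scaler0 addr0 scaleN1r addNr. Qed.
Lemma lopD x y : T (x + y) = T x + T y.
Proof. by rewrite -{1}(scale1r x) lT scale1r. Qed.
Lemma lopZ a x : T (a *: x) = a *: T x.
Proof. by rewrite -{1}(addr0 (a *: x)) lT lop0 addr0. Qed.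
Lemma lopN x : T (- x) = - T x.
Proof. by rewrite -scaleN1r lopZ scaleN1r. Qed.
Lemma lopB x y : T (x - y) = T x - T y.
Proof. by rewrite lopD lopN. Qed.
Lemma lop_sum n (F : nat -> V) : T (\sum_(i < n) F i) = \sum_(i < n) T (F i).
Proof. by elim: n => [|n IH]; rewrite ?big_ord0 ?lop0 // !big_ord_recr /= lopD IH. Qed.
Lemma lop_iter k : lop (iter k T).
Proof. by elim: k => // k IH a x y /=; rewrite IH lT. Qed.
Lemma bop_iter c k : 0 <= c -> bop T c -> bop (iter k T) (c ^+ k).
Proof.
move=> c0 bT; elim: k => [|k IH] v /=; first by rewrite mul1r.
by apply: le_trans (bT _) _; rewrite exprS -mulrA ler_wpM2l.
Qed.
End Lop.

Lemma neumann (A : V -> V) (a : R) : lop A -> 0 <= a -> a < 1 -> bop A a ->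
  forall y, exists x, x - A x = y.
Proof.
move=> lA a0 a1 bA y.
pose u n := iter n (fun x => y + A x) 0.
have d n : N (u n.+1 - u n) <= a ^+ n * N y.
  elim: n => [|n IH]; first by rewrite /u /= lop0 // addr0 subr0 mul1r.
  have -> : u n.+2 - u n.+1 = A (u n.+1 - u n) by rewrite lopB //= ; lmod R V.
  by apply: le_trans (bA _) _; rewrite exprS -mulrA ler_wpM2l.
have b1 : 0 < 1 - a by rlra.
have dk n k : N (u (n + k)%N - u n) <= a ^+ n * N y / (1 - a).
  elim: k n => [|k IH] n.
    rewrite addn0 subrr (N0 HN) divr_ge0 // ?mulr_ge0 ?exprn_ge0 ?N_ge0 //; rlra.
  rewrite addnS -addSn -[_ - u n](subrKA (u n.+1)); apply: le_trans (ND _ _) _.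
  apply: le_trans (lerD (IH _) (d n)) _.
  rewrite exprS; set q := a ^+ n * N y.
  have -> : a * a ^+ n * N y = a * q by rewrite /q; ring.
  by have -> : a * q / (1 - a) + q = q / (1 - a) by field; rewrite gt_eqF.
have bound e : 0 < e -> exists n0 : nat, forall n k, (n0 <= n)%N -> N (u (n + k)%N - u n) < e.
  move=> e0; have y0 := N_ge0 y.
  have e1 : 0 < e * (1 - a) / (N y + 1) / 2 by rewrite !divr_gt0 ?mulr_gt0 //; rlra.
  have [n0 h] := expr_small a0 a1 e1; exists n0 => n k nn.
  apply: le_lt_trans (dk n k) _; rewrite ltr_pdivrMr //.
  have := h _ nn; set z := e * (1 - a) => h1.
  have z0 : 0 < z by rewrite /z mulr_gt0.
  have h2 : a ^+ n * (N y + 1) <= z / 2.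
    move: h1; rewrite mulrAC ler_pdivlMr //; rlra.
  have := exprn_ge0 n a0; rnra.
have [|l lim] := nrm_complete HN (u := u).
  move=> e e0; have e2 : 0 < e / 2 by rlra.
  have [n0 h] := bound _ e2; exists n0 => p q np nq.
  rewrite -[u p - u q](subrKA (u n0)); apply: le_lt_trans (ND _ _) _.
  rewrite (NBC HN (u n0)).
  have := h n0 (p - n0)%N (leqnn _); have := h n0 (q - n0)%N (leqnn _).
  by rewrite !subnKC //; rlra.
exists l; apply/eqP; rewrite -subr_eq0; apply/eqP/(N_eq0 HN).
apply: (@le_eps _ _ _ 2) => // e e0; rewrite add0r.
have [n0 h] := lim e e0.
have h1 := h n0 (leqnn _); have h2 := h n0.+1 (leqnSn _).
have -> : l - A l - y = (l - u n0.+1) + A (u n0 - l).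
  by rewrite lopB //=; lmod R V.
apply: le_trans (ND _ _) _; rewrite (NBC HN l).
have := bA (u n0 - l); have := N_ge0 (u n0 - l); rnra.
Qed.

Lemma opnorm_ex (T : V -> V) (c : R) : lop T -> bop T c ->
  exists a : R, [/\ 0 <= a, bop T a & forall a', a' < a -> exists2 v, N v <= 1 & a' < N (T v)].
Proof.
move=> lT bT; pose S := [set r | exists2 v, N v <= 1 & r = N (T v)].
have S0 : S 0 by exists 0; rewrite ?(N0 HN) // lop0 // (N0 HN).
have hS : has_sup S.
  split; first by exists 0.
  exists (`|c|) => _ [v v1 ->]; apply: le_trans (bT _) _.
  apply: le_trans (ler_wpM2r (N_ge0 v) (ler_norm c)) _.
  by rewrite -[leRHS]mulr1 ler_wpM2l.
exists (sup S); split.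
- by apply: ub_le_sup => //; exact: hS.2.
- move=> v; have [v0|v0] := eqVneq (N v) 0.
    have -> : v = 0 by apply: (N_eq0 HN); rewrite v0.
    by rewrite lop0 // (N0 HN) mulr0.
  have vp : 0 < N v by rewrite lt_neqAle eq_sym v0 N_ge0.
  have : N (T ((N v)^-1%:C *: v)) <= sup S.
    apply: ub_le_sup; first exact: hS.2.
    by exists ((N v)^-1%:C *: v) => //; rewrite (NZp HN) ?invr_ge0 ?N_ge0 // mulVf.
  by rewrite lopZ // (NZp HN) ?invr_ge0 ?N_ge0 // mulrC ler_pdivrMr.
- move=> a' a'S; have e0 : 0 < sup S - a' by rlra.
  by have [_ [v v1 ->] h] := sup_adherent e0 hS; exists v => //; rlra.
Qed.

(** Gliding hump: stage [n] adds a correction of size at most 3^-n, signed so that [T (j n)] becomes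
    large, where [T (j n)] has norm at least 4^n. All later corrections add up to at most half of
    3^-n, so the limit keeps a sixth of 3^-n times the norm of [T (j n)], which is unbounded. *)
Lemma uniform_boundedness (T : nat -> V -> V) (c : nat -> R) :
  (forall j, lop (T j)) -> (forall j, bop (T j) (c j)) ->
  (forall v, exists b, forall j, N (T j v) <= b) ->
  exists C : R, 0 <= C /\ forall j, bop (T j) C.
Proof.
move=> lT bT pb; apply: contrapT => nC.
have /choice[j hj] : forall n : nat, exists j, exists a : R, [/\ 4 ^+ n <= a, bop (T j) a &
    forall a', a' < a -> exists2 v, N v <= 1 & a' < N (T j v)].
  move=> n; apply: contrapT => h; apply: nC; exists (4 ^+ n); split; first by rewrite exprn_ge0.
  move=> k v; have [a [a0 ba ha]] := opnorm_ex (lT k) (bT k).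
  apply: le_trans (ba _) _; rewrite ler_wpM2r ?N_ge0 // leNgt; apply/negP => h4.
  by apply: h; exists k, a; split=> //; exact: ltW.
have /choice[a ha] := hj.
pose d n : R := 3^-1 ^+ n.
have d0 n : 0 < d n by rewrite exprn_gt0 // invr_gt0.
have a0 n : 0 < a n by have [h _ _] := ha n; apply: lt_le_trans h; rewrite exprn_gt0.
have step n x : exists x', N (x' - x) <= d n /\ 2 / 3 * d n * a n <= N (T (j n) x').
  have [_ _ hv] := ha n; have [|v v1 vT] := hv (2 / 3 * a n); first by have := a0 n; rlra.
  pose xi := (d n)%:C *: v.
  have NZd u : N ((d n)%:C *: u) = d n * N u by apply: NZp => //; exact: ltW.
  have Nxi : N xi <= d n by rewrite NZd; have := d0 n; rnra.
  (* The two candidates differ by twice the correction, so one of them has an image at least as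
     large as that of the correction. *)
  have hT : 2 * (2 / 3 * d n * a n) <= N (T (j n) (x + xi)) + N (T (j n) (x - xi)).
    apply: le_trans _ (NB _ _); rewrite -(lopB (lT _)).
    have -> : x + xi - (x - xi) = 2%:R *: xi by lmod R V.
    rewrite (lopZ (lT _)) NZ /xi (lopZ (lT _)) NZd.
    have -> : normc (2%:R : R[i]) = 2 by rewrite -(rmorph_nat (real_complex R)) normcR ger0_norm.
    by have := d0 n; rnra.
  have [h|h] := leP (2 / 3 * d n * a n) (N (T (j n) (x + xi))).
    by exists (x + xi); split=> //; rewrite addrC addKr.
  by exists (x - xi); split; [rewrite addrC addKr NN | rlra].
have /choice[st hst] : forall nx : nat * V, exists x', N (x' - nx.2) <= d nx.1 /\
    2 / 3 * d nx.1 * a nx.1 <= N (T (j nx.1) x') by move=> [n x]; exact: step.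
pose x := fix x n := if n is n'.+1 then st (n', x n') else 0 : V.
have x1 n : N (x n.+1 - x n) <= d n by have [] := hst (n, x n).
have x2 n : 2 / 3 * d n * a n <= N (T (j n) (x n.+1)) by have [] := hst (n, x n).
have dS n : d n.+1 = d n / 3 by rewrite /d exprS mulrC.
have xk n k : N (x (n + k)%N - x n) <= 3 / 2 * d n.
  elim: k n => [|k IH] n; first by rewrite addn0 subrr (N0 HN) mulr_ge0 ?ltW.
  rewrite addnS -addSn -[_ - x n](subrKA (x n.+1)); apply: le_trans (ND _ _) _.
  by have := IH n.+1; have := x1 n; rewrite dS; rlra.
have [|l lim] := nrm_complete HN (u := x).
  move=> e e0; have e2 : 0 < e / 6 by rlra.
  have [||n0 h] := @expr_small R 3^-1 _ _ _ e2; [rlra|rlra|].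
  exists n0 => p q np nq; rewrite -[x p - x q](subrKA (x n0)); apply: le_lt_trans (ND _ _) _.
  rewrite (NBC HN (x n0)).
  have := xk n0 (p - n0)%N; have := xk n0 (q - n0)%N; rewrite !subnKC //.
  have := h n0 (leqnn _); rewrite -/(d n0); rlra.
have ln n : N (l - x n) <= 3 / 2 * d n.
  apply: (@le_eps _ _ _ 1) => // e e0; rewrite mul1r.
  have [n1 h] := lim e e0; have h1 := h (n + n1)%N (leq_addl _ _).
  rewrite -[l - _](subrKA (x (n + n1)%N)); apply: le_trans (ND _ _) _.
  by rewrite (NBC HN l); have := xk n n1; rlra.
have [b hb] := pb l.
have [n hn] := archi (18 * b).
have := hb (j n); have := x2 n; have [h4 ba _] := ha n.
have h1 := ba (x n.+1 - l); rewrite (lopB (lT _)) in h1.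
have h2 := N_sub_ge HN (T (j n) (x n.+1)) (T (j n) l).
have h3 := ln n.+1; rewrite (NBC HN) dS in h3.
have h5 : a n * N (x n.+1 - l) <= a n * (3 / 2 * (d n / 3)).
  by apply: ler_wpM2l h3; exact: ltW.
have h6 : 1 + 3^-1 *+ n <= d n * a n.
  have h7 : (1 + 3^-1) ^+ n = d n * 4 ^+ n :> R.
    by rewrite /d -exprMn; congr (_ ^+ _); rlra.
  have h8 : (0 : R) <= 3^-1 by rlra.
  apply: le_trans (bernoulli n h8) _; rewrite h7 ler_wpM2l // ltW //.
move: h6; rewrite -mulr_natr; rnra.
Qed.

Definition bij (S : V -> V) := forall y, exists! x, S x = y.

(** The spectral axiom gives bijectivity only. The inverses of S - i e have norm at most 1/e, and at
    y = S v they are bounded by 2 |v| for every e; uniform boundedness makes them bounded together,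
    and e -> 0 gives the lower bound for [S] itself. *)
Lemma bounded_inverse (S : V -> V) (c : R) : lop S -> bop S c -> bij S ->
  (forall e : R, 0 < e -> bij (fun v => S v - (e *i) *: v)) ->
  (forall (e : R) v, 0 < e -> e * N v <= N (S v - (e *i) *: v)) ->
  exists C : R, 0 <= C /\ forall v, N v <= C * N (S v).
Proof.
move=> lS bS bijS bije low.
pose ep (k : nat) : R := k.+1%:R^-1.
have ep0 k : 0 < ep k by rewrite invr_gt0 ltr0n.
pose Se k v := S v - ((ep k) *i) *: v.
have lSe k : lop (Se k) by move=> a x y; rewrite /Se lS; lmod R V.
have /choice[J hJ] : forall ky : nat * V, exists x, Se ky.1 x = ky.2.
  by move=> [k y]; have [x [e _]] := bije _ (ep0 k) y; exists x.
have inj k u v : Se k u = Se k v -> u = v.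
  by move=> e; have [x [_ ux]] := bije _ (ep0 k) (Se k v); rewrite -(ux v) // -(ux u).
have JK k v : J (k, Se k v) = v by apply: (inj k); rewrite (hJ (k, _)).
have lJ k : lop (fun y => J (k, y)).
  by move=> a x y; apply: (inj k); rewrite lSe !(hJ (k, _)).
have bJ k : bop (fun y => J (k, y)) (ep k)^-1.
  move=> y; have := low (ep k) (J (k, y)) (ep0 k).
  rewrite -/(Se k _) (hJ (k, y)) /= => h.
  by rewrite mulrC ler_pdivlMr // mulrC.
have [|C [C0 hC]] := uniform_boundedness lJ bJ.
  move=> y; have [v [Sv _]] := bijS y; exists (2 * N v) => k.
  have -> : J (k, y) = v + J (k, ((ep k) *i) *: v).
    by apply: (inj k); rewrite (lopD (lSe k)) !(hJ (k, _)) /= /Se -Sv subrK.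
  apply: le_trans (ND _ _) _.
  have := bJ k (((ep k) *i) *: v); rewrite NZ.
  have -> : normc ((ep k) *i) = ep k.
    by rewrite normcE2 /= expr0n add0r sqrtr_sqr ger0_norm // ltW.
  by rewrite mulrA mulVf ?gt_eqF // mul1r; rlra.
exists C; split=> // v.
apply: (@le_eps _ _ _ (C * N v)); first by rewrite mulr_ge0 ?N_ge0.
move=> e e0; have [k hk] := archi e^-1.
have epe : ep k <= e.
  rewrite /ep -[leRHS]invrK lef_pV2 ?posrE ?invr_gt0 ?ltr0n //.
  by apply: le_trans (ltW hk) _; rewrite ler_nat.
have := hC k (Se k v); rewrite JK => h; apply: le_trans h _.
have : N (Se k v) <= N (S v) + ep k * N v.
  apply: le_trans (NB _ _) _; rewrite lerD2l NZ.
  by rewrite normcE2 /= expr0n add0r sqrtr_sqr ger0_norm // ltW.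
have v0 := N_ge0 v => h.
have h2 : N (Se k v) <= N (S v) + e * N v by rnra.
by have := ler_wpM2l C0 h2; rlra.
Qed.

(** Invertibility with bounded inverse, split into a lower bound and surjectivity so that it passes
    to products of linear factors. *)
Definition good (S : V -> V) :=
  (exists C : R, 0 <= C /\ forall v, N v <= C * N (S v)) /\ (forall y, exists x, S x = y).

Lemma good_comp S S' : good S -> good S' -> good (fun v => S (S' v)).
Proof.
move=> [[C [C0 hC]] sS] [[C' [C0' hC']] sS']; split.
  exists (C' * C); split; first exact: mulr_ge0.
  by move=> v; apply: le_trans (hC' _) _; rewrite -mulrA ler_wpM2l.
by move=> y; have [x <-] := sS y; have [z <-] := sS' x; exists z.
Qed.
Lemma good_scale (c : R[i]) : c != 0 -> good (fun v => c *: v).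
Proof.
move=> c0; have nc : normc c != 0 by apply: contra c0 => /eqP/Normc.eq0_normc ->.
split; last by move=> y; exists (c^-1 *: y); rewrite scalerA mulfV // scale1r.
exists (normc c)^-1; split; first by rewrite invr_ge0 normc_ge0.
by move=> v; rewrite NZ mulrA mulVf // mul1r.
Qed.

(** * Spectral radius estimate by averaging resolvents over roots of unity *)

Section Rickart.
Variables (A : V -> V) (a r : R).
Hypothesis lA : lop A.
Hypothesis a0 : 0 <= a.
Hypothesis bA : bop A a.
Hypothesis r0 : 0 < r.
Hypothesis resA : forall mu, normc mu <= r -> good (fun v => v - mu *: A v).

(** Compactness of the disc: parameters violating worse and worse bounds have an ultralimit, and the
    lower bound at the limit parameter persists nearby. *)
Lemma resolvent_uniform : exists M : R, 0 < M /\
  forall mu, normc mu <= r -> forall v, N v <= M * N (v - mu *: A v).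
Proof.
apply: contrapT => nM.
have /choice[f hf] : forall k : nat, exists mv : R[i] * V,
    normc mv.1 <= r /\ k%:R * N (mv.2 - mv.1 *: A mv.2) < N mv.2.
  move=> k; apply: contrapT => h; apply: nM; exists (k.+1%:R); split; first by rewrite ltr0n.
  move=> mu mur v; rewrite leNgt; apply/negP => hv; apply: h; exists (mu, v); split=> //=.
  by apply: le_lt_trans hv; rewrite ler_wpM2r ?N_ge0 // ler_nat.
have [U [UF sU]] := ultraFilterLemma eventually_filter.
have [m0 cvm] := ucv_ex UF (fun k => (hf k).1).
have m0r := ucv_le UF (fun k => (hf k).1) cvm.
have [[C [C0 hC]] _] := resA m0r.
have Ca := mulr_ge0 C0 a0.
have e0 : 0 < (2 * (C * a + 1))^-1 by rewrite invr_gt0; rlra.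
have [n0 hn0] := archi (2 * C).
have Un0 : U [set k | (n0 <= k)%N] by apply: sU; exists n0.
have [k [/= h1 h2]] := ultra_ex UF (ultraI UF (cvm _ e0) Un0).
have [_ h3] := hf k; set mu := (f k).1 in h1 h3; set v := (f k).2 in h3.
have h4 := hC v.
have h5 : N (v - m0 *: A v) <= N (v - mu *: A v) + normc (mu - m0) * (a * N v).
  have -> : v - m0 *: A v = (v - mu *: A v) + (mu - m0) *: A v by lmod R V.
  by apply: le_trans (ND _ _) _; rewrite lerD2l NZ ler_wpM2l ?normc_ge0.
have h6 : 2 * C <= k%:R by apply: le_trans (ltW hn0) _; rewrite ler_nat.
have h7 : normc (mu - m0) * (2 * (C * a + 1)) <= 1.
  by rewrite -ler_pdivlMr ?mul1r ?ltW //; rlra.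
have v0 := N_ge0 v; have w0 := N_ge0 (v - mu *: A v); have m1 := normc_ge0 (mu - m0).
have h8 : 2 * C * N (v - mu *: A v) <= k%:R * N (v - mu *: A v) by rewrite ler_wpM2r.
have h9 : normc (mu - m0) * (2 * (C * a)) * N v <= N v.
  by rewrite -[leRHS]mul1r ler_wpM2r //; apply: le_trans h7; rewrite ler_wpM2l //; rlra.
have h10 := ler_wpM2l C0 h5.
rnra.
Qed.

Lemma resolvent_family : exists (M : R) (B : R[i] -> V -> V), [/\ 0 < M,
  (forall mu, normc mu <= r -> lop (B mu)),
  (forall mu v, normc mu <= r -> B mu (v - mu *: A v) = v),
  (forall mu, normc mu <= r -> bop (B mu) M) &
  (forall mu nu v, normc mu <= r -> normc nu <= r ->
     N (B mu v - B nu v) <= M * a * M * normc (mu - nu) * N v)].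
Proof.
have [M [M0 hM]] := resolvent_uniform.
have /choice[B' hB'] : forall my : R[i] * V, exists x,
    normc my.1 <= r -> x - my.1 *: A x = my.2.
  move=> [mu y]; have [h|h] := pselect (normc mu <= r); last by exists 0.
  by have [_ s] := resA h; have [x e] := s y; exists x.
pose B mu y := B' (mu, y).
have hB mu y : normc mu <= r -> B mu y - mu *: A (B mu y) = y by exact: (hB' (mu, y)).
have inj mu u v : normc mu <= r -> u - mu *: A u = v - mu *: A v -> u = v.
  move=> h e; apply/eqP; rewrite -subr_eq0; apply/eqP/(N_eq0 HN).
  apply: le_trans (hM _ h _) _; rewrite lopB //.
  have -> : u - v - mu *: (A u - A v) = (u - mu *: A u) - (v - mu *: A v) by lmod R V.
  by rewrite e subrr (N0 HN) mulr0.
exists M, B; split=> //.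
- move=> mu h c x y; apply: (inj mu) => //; rewrite hB // lA.
  rewrite -{1}(hB mu x h) -{1}(hB mu y h); lmod R V.
- by move=> mu v h; apply: (inj mu) => //; rewrite hB.
- by move=> mu h v; rewrite -{2}(hB mu v h); exact: hM.
- move=> mu nu v h h'.
  apply: le_trans (hM _ h _) _.
  have -> : B mu v - B nu v - mu *: A (B mu v - B nu v) = (mu - nu) *: A (B nu v).
    rewrite lopB //.
    have e : v + (nu - mu) *: A (B nu v) = B nu v - mu *: A (B nu v).
      by rewrite -{1}(hB nu v h'); lmod R V.
    transitivity ((B mu v - mu *: A (B mu v)) - (B nu v - mu *: A (B nu v))); first by lmod R V.
    by rewrite hB // -e; lmod R V.
  rewrite NZ; have h1 := bA (B nu v); have h2 := hM _ h' (B nu v); rewrite hB // in h2.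
  have h3 : N (A (B nu v)) <= a * (M * N v) by apply: le_trans h1 _; rewrite ler_wpM2l.
  have h4 := ler_wpM2l (normc_ge0 (mu - nu)) h3.
  have h5 := ler_wpM2l (ltW M0) h4; apply: le_trans h5 _.
  by rewrite le_eqVlt; apply/orP; left; apply/eqP; ring.
Qed.

(** For w a primitive n-th root of unity, the mean over j of the inverses of 1 - w^j s A is a left
    inverse of 1 - s^n A^n, by geometric sums and orthogonality of the roots. The constants [M] and
    [L] are chosen before [n], which is what [rickart] exploits. *)
Lemma resolvent_average : exists M L : R, [/\ 0 < M, 0 <= L &
  forall n, (0 < n)%N -> exists Un : R -> V -> V,
  [/\ (forall (s : R) v, 0 <= s <= r -> Un s v - v = Un s ((s ^+ n)%:C *: iter n A v)),
      (forall (s : R) v, 0 <= s <= r -> Un s (v - (s ^+ n)%:C *: iter n A v) = v),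
      (forall (s : R) v, 0 <= s <= r -> N (Un s v) <= M * N v) &
      (forall (s s' : R) v, 0 <= s <= r -> 0 <= s' <= r ->
         N (Un s v - Un s' v) <= L * `|s - s'| * N v)]].
Proof.
have [M [B [M0 lB BK bB LB]]] := resolvent_family.
exists M, (M * a * M); split=> //; first by rewrite !mulr_ge0 // ltW.
move=> n n0; have [w pw] := @prim_root_ex R n n0.
have nw j : normc (w ^+ j) = 1 by rewrite normcX (prim_normc n0 pw) expr1n.
pose m (s : R) j := w ^+ j * s%:C.
have nm (s : R) j : 0 <= s <= r -> normc (m s j) <= r.
  by move=> /andP[s0 s1]; rewrite normcM nw mul1r normcR ger0_norm.
have n1 : n%:R != 0 :> R by rewrite pnatr_eq0 -lt0n.
pose Un s v := (n%:R^-1)%:C *: \sum_(j < n) B (m s j) v.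
have lUn (s : R) : 0 <= s <= r -> lop (Un s).
  move=> hs c x y; rewrite /Un scalerA mulrC -scalerA -scalerDr; congr (_ *: _).
  by rewrite scaler_sumr -big_split; apply: eq_bigr => j _ /=; rewrite lB // nm.
have n1C : n%:R != 0 :> R[i] by rewrite pnatr_eq0 -lt0n.
have key (s : R) v : 0 <= s <= r -> Un s (v - (s ^+ n)%:C *: iter n A v) = v.
  move=> hs; rewrite /Un.
  have tel (mu : R[i]) k : normc mu <= r ->
      B mu (v - (mu ^+ k) *: iter k A v) = \sum_(i < k) mu ^+ i *: iter i A v.
    move=> hmu; elim: k => [|k IH].
      by rewrite big_ord0 expr0 scale1r subrr (lop0 (lB _ hmu)).
    rewrite big_ord_recr /= -IH -{2}(BK mu (mu ^+ k *: iter k A v) hmu) -(lopD (lB _ hmu)).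
    by congr (B _ _); rewrite (lopZ lA) exprS; lmod R V.
  have e j : B (m s j) (v - (s ^+ n)%:C *: iter n A v) =
      \sum_(i < n) (m s j) ^+ i *: iter i A v.
    rewrite -tel ?nm //; congr (B _ (_ - _ *: _)).
    by rewrite /m exprMn -exprM mulnC exprM (prim_expr_order pw) expr1n mul1r -rmorphXn.
  under eq_bigr => j _ do rewrite e.
  rewrite exchange_big /=.
  have -> : \sum_(i < n) \sum_(j < n) m s j ^+ i *: iter i A v = n%:R *: v.
    case: n n0 pw {nw nm n1 Un lUn n1C e} @m => // n _ pw m.
    rewrite big_ord_recl /= [X in _ + X]big1 ?addr0.
      under eq_bigr => j _ do rewrite expr0 scale1r.
      by rewrite sumr_const card_ord scaler_nat.
    move=> i _; rewrite -scaler_suml.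
    have -> : \sum_(j < n.+1) m s j ^+ (bump 0 i) = s%:C ^+ (bump 0 i) * \sum_(j < n.+1) (w ^+ j) ^+ (bump 0 i).
      by rewrite mulr_sumr; apply: eq_bigr => j _; rewrite /m exprMn mulrC.
    rewrite (root_sum _ pw) gtnNdvd ?mulr0 ?scale0r //.
    by rewrite /bump /= add1n ltnS ltn_ord.
  by rewrite scalerA fmorphV rmorph_nat mulVf // scale1r.
exists Un; split=> //.
- move=> s v hs; rewrite -{2}(key s v hs) (lopB (lUn _ hs)); lmod R V.
- move=> s v hs; rewrite (NZp HN) ?invr_ge0 ?ler0n //.
  rewrite ler_pdivrMl ?ltr0n //; apply: le_trans (N_sum HN n (fun j => B (m s j) v)) _.
  apply: le_trans (_ : \sum_(j < n) M * N v <= _); last by rewrite sumr_const card_ord mulr_natl.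
  by apply: ler_sum => j _; exact: bB (nm _ _ hs) _.
- move=> s s' v hs hs'; rewrite /Un -scalerBr -sumrB (NZp HN) ?invr_ge0 ?ler0n //.
  rewrite ler_pdivrMl ?ltr0n //.
  apply: le_trans (N_sum HN n (fun j => B (m s j) v - B (m s' j) v)) _.
  apply: le_trans (_ : \sum_(j < n) M * a * M * `|s - s'| * N v <= _); last by rewrite sumr_const card_ord mulr_natl.
  apply: ler_sum => j _.
  apply: le_trans (LB _ _ _ (nm _ j hs) (nm _ j hs')) _.
  by rewrite /m -mulrBr normcM nw mul1r -rmorphB normcR.
Qed.

Definition vanishing (s : R) := forall e : R, 0 < e -> exists n0 : nat,
  forall n, (n0 <= n)%N -> forall v, s ^+ n * N (iter n A v) <= e * N v.

(** If s^n A^n tends to zero at one radius, the averages there tend to the identity. Being Lipschitz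
    in the radius uniformly in n, they stay within 1/2 of the identity slightly further out, which
    bounds s^n A^n there. Finitely many such steps reach every radius below [r]. *)
Lemma rickart (s : R) : 0 <= s -> s < r -> exists n0 : nat,
  forall n, (n0 <= n)%N -> forall v, s ^+ n * N (iter n A v) <= N v.
Proof.
have [M [L [M0 L0 hU]]] := resolvent_average.
have step (s1 s2 : R) : 0 <= s1 <= r -> 0 <= s2 <= r -> L * `|s2 - s1| <= 4^-1 ->
    vanishing s1 -> exists n0 : nat,
    forall n, (n0 <= n)%N -> forall v, s2 ^+ n * N (iter n A v) <= N v.
  move=> h1 h2 hL van; have [n0 hn0] := van (4 * M)^-1 (ltac:(rewrite invr_gt0; rlra)).
  exists n0.+1 => n nn v; have [|Un [U1 U2 U3 U4]] := hU n; first exact: leq_trans nn.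
  have i1 := hn0 n (ltnW nn).
  have half y : N (Un s2 y - y) <= 2^-1 * N y.
    rewrite -[Un s2 y - y](subrKA (Un s1 y)); apply: le_trans (ND _ _) _.
    have := U4 s2 s1 y h2 h1; rewrite U1 //.
    have := U3 s1 ((s1 ^+ n)%:C *: iter n A y) h1.
    case/andP: (h1) => s10 _.
    rewrite (NZp HN) ?exprn_ge0 //; have := i1 y; have y0 := N_ge0 y => j1 j2 j3.
    have j4 : M * (s1 ^+ n * N (iter n A y)) <= 4^-1 * N y.
      apply: le_trans (ler_wpM2l (ltW M0) j1) _.
      have -> // : M * ((4 * M)^-1 * N y) = 4^-1 * N y by field; rewrite gt_eqF.
    have j5 := ler_wpM2r y0 hL; rlra.
  have := half (v - (s2 ^+ n)%:C *: iter n A v); rewrite U2 //.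
  set b := (s2 ^+ n)%:C *: iter n A v.
  have -> : v - (v - b) = b by lmod R V.
  case/andP: (h2) => s20 _.
  have -> : s2 ^+ n * N (iter n A v) = N b by rewrite (NZp HN) ?exprn_ge0.
  have := NB v b; rlra.
have van_lt (s1 s2 : R) : 0 <= s1 -> s1 < s2 -> (exists n0 : nat,
    forall n, (n0 <= n)%N -> forall v, s2 ^+ n * N (iter n A v) <= N v) -> vanishing s1.
  move=> s10 s12 [n0 h] e e0; have s2p : 0 < s2 by rlra.
  have [||n1 h1] := @expr_small R (s1 / s2) e _ _ e0.
  - by rewrite divr_ge0 // ltW.
  - by rewrite ltr_pdivrMr // mul1r.
  exists (n0 + n1)%N => n nn v.
  have := h n (leq_trans (leq_addr _ _) nn) v; have := h1 n (leq_trans (leq_addl _ _) nn).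
  have -> : s1 ^+ n * N (iter n A v) = (s1 / s2) ^+ n * (s2 ^+ n * N (iter n A v)).
    by rewrite mulrA -exprMn mulfVK ?gt_eqF.
  move=> j1 j2; apply: ler_pM => //.
    by rewrite exprn_ge0 // divr_ge0 // ltW.
  by rewrite mulr_ge0 ?N_ge0 // exprn_ge0 // ltW.
move=> s0 sr.
(* Chosen so that s + 2d <= r and so that a move by 2d changes the averages by at most 1/4 in
   operator norm. *)
pose d := Num.min ((r - s) / 2) (8 * (L + 1))^-1.
have d0 : 0 < d by rewrite lt_min invr_gt0; apply/andP; split; rlra.
have d1 : 2 * d <= r - s.
  have : d <= (r - s) / 2 by rewrite ge_min lexx.
  rlra.
have d2 : L * (2 * d) <= 4^-1.
  have h : d <= (8 * (L + 1))^-1 by rewrite ge_min lexx orbT.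
  have : (L + 1) * d <= 8^-1.
    have p0 : 0 < 8 * (L + 1) by rlra.
    by have := ler_wpM2l (ltW p0) h; rewrite mulfV ?gt_eqF //; rlra.
  rlra.
(* Decay at kd gives boundedness at (k + 2)d, hence decay at the smaller radius (k + 1)d. *)
have chain k : k%:R * d <= s + d -> vanishing (k%:R * d).
  elim: k => [_|k IH hk].
    move=> e e0; exists 1%N => -[|n] // _ v; rewrite mul0r expr0n /= mul0r.
    by rewrite mulr_ge0 ?N_ge0 // ltW.
  have k0 : (0 : R) <= k%:R by rewrite ler0n.
  have kS : k.+1%:R = k%:R + 1 :> R by rewrite -natr1.
  rewrite kS in hk *.
  have IH' : vanishing (k%:R * d) by apply: IH; rlra.
  apply: (@van_lt _ (k%:R * d + 2 * d)); [rnra|rlra|].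
  apply: (step (k%:R * d)) => //; try (apply/andP; split; rnra).
  have -> : k%:R * d + 2 * d - k%:R * d = 2 * d by ring.
  by rewrite ger0_norm //; rlra.
have [k hk] := archi (s / d); move: hk; rewrite ltr_pdivrMr // => hk.
have [k' /andP[hk1 hk2]] : exists k' : nat, s <= k'%:R * d <= s + d.
  elim: k hk => [|k IH] hk; first by exists 0%N; rewrite mul0r in hk *; apply/andP; split; rlra.
  have [h|h] := ltP s (k%:R * d); first exact: IH.
  by exists k.+1; rewrite -natr1 in hk *; apply/andP; split; rlra.
have [n0 hn0] := chain k' hk2 1 ltr01.
exists n0 => n nn v; apply: le_trans _ (_ : 1 * N v <= _); last by rewrite mul1r.
apply: le_trans (hn0 n nn v); rewrite ler_wpM2r ?N_ge0 // lerXn2r ?nnegrE //.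
exact: le_trans s0 hk1.
Qed.
End Rickart.

Section PolyEval.
Variable T : V -> V.
Hypothesis lT : lop T.
Definition peval (p : {poly R[i]}) v := \sum_(i < size p) p`_i *: iter i T v.
Lemma peval_wide (p : {poly R[i]}) n v : (size p <= n)%N -> peval p v = \sum_(i < n) p`_i *: iter i T v.
Proof.
move=> h; rewrite /peval (big_ord_widen n (fun i => p`_i *: iter i T v) h) big_mkcond /=.
apply: eq_bigr => i _; case: ltnP => // hi; by rewrite nth_default ?scale0r.
Qed.
Lemma pevalD p q v : peval (p + q) v = peval p v + peval q v.
Proof.
pose n := maxn (size p) (size q).
rewrite !(@peval_wide _ n) ?leq_maxl ?leq_maxr ?size_polyD // -big_split /=.
by apply: eq_bigr => i _; rewrite coefD scalerDl.
Qed.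
Lemma pevalZ c p v : peval (c *: p) v = c *: peval p v.
Proof.
rewrite (@peval_wide _ (size p)) ?size_scale_leq // scaler_sumr.
by apply: eq_bigr => i _; rewrite coefZ scalerA.
Qed.
Lemma pevalX p v : peval ('X * p) v = T (peval p v).
Proof.
rewrite (@peval_wide _ (size p).+1); last first.
  by apply: leq_trans (size_polyMleq _ _) _; rewrite size_polyX.
rewrite big_ord_recl coefXM /= scale0r add0r (lop_sum lT (size p) (fun i => p`_i *: iter i T v)).
by apply: eq_bigr => i _; rewrite coefXM /= (lopZ lT).
Qed.
Lemma peval1 v : peval 1 v = v.
Proof. by rewrite /peval size_poly1 big_ord_recl big_ord0 coef1 /= scale1r addr0. Qed.
Lemma peval_XsubC z p v : peval (('X - z%:P) * p) v = T (peval p v) - z *: peval p v.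
Proof.
rewrite mulrBl pevalD pevalX; congr (_ + _); rewrite -scaleNr -pevalZ; congr peval.
by rewrite -mul_polyC polyCN mulNr.
Qed.
Lemma peval_good (rs : seq R[i]) : (forall z, z \in rs -> good (fun v => T v - z *: v)) ->
  good (peval (\prod_(z <- rs) ('X - z%:P))).
Proof.
elim: rs => [|z rs IH] h.
  rewrite big_nil; split; last by move=> y; exists y; rewrite peval1.
  by exists 1; split=> // v; rewrite peval1 mul1r.
rewrite big_cons; have h1 : good (fun v => T v - z *: v) by apply: h; rewrite mem_head.
have h2 : good (peval (\prod_(z <- rs) ('X - z%:P))).
  by apply: IH => y yrs; apply: h; rewrite inE yrs orbT.
have := good_comp h1 h2; rewrite /good => -[[C [C0 hC]] s]; split.
  by exists C; split=> // v; rewrite peval_XsubC.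
by move=> y; have [x e] := s y; exists x; rewrite peval_XsubC.
Qed.
End PolyEval.

End Operators.

Section RealGrowth.
Variable R : realType.
Lemma growth_le1 (x C : R) : 0 <= x ->
  (forall n0 : nat, exists2 n : nat, (n0 <= n)%N & x ^+ n <= C) -> x <= 1.
Proof.
move=> x0 h; rewrite leNgt; apply/negP => x1.
have d0 : 0 < x - 1 by rlra.
have [n0 hn0] := archi (C / (x - 1)).
have [n nn hn] := h n0.
have e1 : 1 + (x - 1) = x by ring.
have := bernoulli n (ltW d0); rewrite e1 -mulr_natr => hb.
move: hn0; rewrite ltr_pdivrMr // => hn0.
have : (n0%:R : R) <= n%:R by rewrite ler_nat.
rnra.
Qed.
(** With y = 1 + (1 - x)/M the left side is x (1 + (1 - x)/M)^M, whose maximum is attained at x = 1: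
    the scalar estimate behind [G_norm]. *)
Lemma power_bound (y : R) M : 0 <= y -> (1 + M%:R * (1 - y)) * y ^+ M <= 1.
Proof.
move=> y0; elim: M => [|M IH]; first by rewrite mul0r addr0 expr0 mul1r.
apply: le_trans IH; rewrite exprS -natr1.
have -> : (1 + (M%:R + 1) * (1 - y)) * (y * y ^+ M) =
  (1 + M%:R * (1 - y)) * y ^+ M - y ^+ M * ((1 - y) ^+ 2 * (M%:R + 1)) by ring.
by rewrite gerBl mulr_ge0 ?exprn_ge0 // mulr_ge0 ?sqr_ge0 // addr_ge0 // ler0n.
Qed.
Lemma exp3_ge (b : nat) : (b <= 3 ^ b)%N.
Proof. by apply: ltnW; exact: ltn_expl. Qed.
End RealGrowth.

Lemma iter_comm (A : Type) (f g : A -> A) i j x : (forall x, f (g x) = g (f x)) ->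
  iter i f (iter j g x) = iter j g (iter i f x).
Proof.
move=> c; have c1 k y : f (iter k g y) = iter k g (f y).
  by elim: k => //= k IH; rewrite c IH.
by elim: i => //= i ->; rewrite c1.
Qed.

(** * Power associativity and norming functionals in JB*-triples *)

Section JB.
Variables (R : realType) (V : lmodType R[i]) (N : V -> R).
Variables (tp : V -> V -> V -> V) (K : R).

(** The triple over an abstract Banach space. [K] is a bound for the product that comes from
    continuity; hermiticity is read on norming functionals and the spectral axiom as plain
    bijectivity. *)
Record jb_axioms : Prop := {
  jb_banach : cbanach N;
  jb_linl : forall al a a' b c, tp (al *: a + a') b c = al *: tp a b c + tp a' b c;
  jb_sym : forall a b c, tp a b c = tp c b a;
  jb_linm : forall al a b b' c, tp a (al *: b + b') c = conjc al *: tp a b c + tp a b' c;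
  jb_K : 1 <= K;
  jb_bound : forall a b c, N (tp a b c) <= K * (N a * N b * N c);
  jb_jordan : forall x y a b c,
    tp x y (tp a b c) = tp (tp x y a) b c - tp a (tp y x b) c + tp a b (tp x y c);
  jb_herm : forall a u f, supp N f u -> Im (f (tp a a u)) = 0;
  jb_spec : forall a l, ~ (0 <= l) -> bij (fun v => tp a a v - l *: v);
  jb_cube : forall a, N (tp a a a) = N a ^+ 3 }.

Hypothesis J : jb_axioms.
Let HN := jb_banach J.
Local Notation N_ge0 := (N_ge0 HN).
Local Notation NZ := (NZ HN).
Local Notation NZp := (NZp HN).
Local Notation ND := (ND HN).
Local Notation NB := (NB HN).
Local Notation NN := (NN HN).

Lemma K_ge1 : 1 <= K. Proof. exact: jb_K J. Qed.
Lemma K_ge0 : 0 <= K. Proof. have := K_ge1; rlra. Qed.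

Lemma tpDl a a' b c : tp (a + a') b c = tp a b c + tp a' b c.
Proof. by have := jb_linl J 1 a a' b c; rewrite !scale1r. Qed.
Lemma tp0l b c : tp 0 b c = 0.
Proof. by apply: (addrI (tp 0 b c)); rewrite -tpDl !addr0. Qed.
Lemma tpZl al a b c : tp (al *: a) b c = al *: tp a b c.
Proof. by have := jb_linl J al a 0 b c; rewrite tp0l !addr0. Qed.
Lemma tpNl a b c : tp (- a) b c = - tp a b c.
Proof. by rewrite -scaleN1r tpZl scaleN1r. Qed.
Lemma tpDr a b c c' : tp a b (c + c') = tp a b c + tp a b c'.
Proof. by rewrite (jb_sym J) tpDl !(jb_sym J _ b a). Qed.
Lemma tpZr al a b c : tp a b (al *: c) = al *: tp a b c.
Proof. by rewrite (jb_sym J) tpZl (jb_sym J c). Qed.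
Lemma tpNr a b c : tp a b (- c) = - tp a b c.
Proof. by rewrite -scaleN1r tpZr scaleN1r. Qed.
Lemma tp0r a b : tp a b 0 = 0.
Proof. by rewrite (jb_sym J) tp0l. Qed.
Lemma tpDm a b b' c : tp a (b + b') c = tp a b c + tp a b' c.
Proof. by have := jb_linm J 1 a b b' c; rewrite conjc1 !scale1r. Qed.
Lemma tp0m a c : tp a 0 c = 0.
Proof. by apply: (addrI (tp a 0 c)); rewrite -tpDm !addr0. Qed.
Lemma tpZm al a b c : tp a (al *: b) c = conjc al *: tp a b c.
Proof. by have := jb_linm J al a b 0 c; rewrite tp0m !addr0. Qed.
Lemma tpZmr (t : R) a b c : tp a (t%:C *: b) c = t%:C *: tp a b c.
Proof. by rewrite tpZm conjc_real. Qed.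
Lemma tpNm a b c : tp a (- b) c = - tp a b c.
Proof. by rewrite -scaleN1r -(rmorphN1 (real_complex R)) tpZmr rmorphN1 scaleN1r. Qed.
Definition tpE := (tpDl, tpDm, tpDr, tpNl, tpNm, tpNr, tpZl, tpZr, tpZmr).
Lemma lop_tp a b : lop (tp a b).
Proof. by move=> al x y; rewrite tpDr tpZr. Qed.
Lemma tp_bound a b c (A B D : R) : N a <= A -> N b <= B -> N c <= D ->
  N (tp a b c) <= K * (A * B * D).
Proof.
move=> hA hB hD; apply: le_trans (jb_bound J _ _ _) _; rewrite ler_wpM2l ?K_ge0 //.
by apply: ler_pM => //; rewrite ?mulr_ge0 ?N_ge0 //; apply: ler_pM; rewrite ?N_ge0.
Qed.
Lemma bop_tp a b : bop N (tp a b) (K * (N a * N b)).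
Proof. by move=> v; rewrite -mulrA; exact: jb_bound. Qed.

(** The odd power z^(2k+1). *)
Definition pw z k := iter k (tp z z) z.
Lemma pwS z k : pw z k.+1 = tp z z (pw z k). Proof. by []. Qed.

(** Induction on the total index. The Jordan identity expresses a product through terms that depend
    on p + q only ([star]); comparing p = 0 with q = 0 ([indep]) makes these terms cancel as soon as
    the last index is at least two, and symmetry brings most other cases there. *)
Lemma tp_pw z i j k : tp (pw z i) (pw z j) (pw z k) = pw z (i + j + k).+1.
Proof.
pose S i j k := tp (pw z i) (pw z j) (pw z k).
suff main m : forall i j k, (i + j + k <= m)%N -> S i j k = pw z (i + j + k).+1 by exact: (main (i + j + k)%N).
have Ssym a b c : S a b c = S c b a by rewrite /S (jb_sym J).
have S00 c : S 0%N 0%N c = pw z c.+1 by [].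
elim: m => [|m IH] {}i {}j {}k.
  by rewrite leqn0 !addn_eq0 => /andP[/andP[/eqP -> /eqP ->] /eqP ->].
rewrite leq_eqVlt => /orP[/eqP tot|]; last by rewrite ltnS; exact: IH.
rewrite tot; set Z := pw z m.+2.
have JJ p q a b c : (p + q + (a + b + c) = m)%N ->
    S p q (a + b + c).+1 = S (p + q + a).+1 b c - S a (p + q + b).+1 c + S a b (p + q + c).+1.
  move=> e; have e1 : (a + b + c <= m)%N by rewrite -e leq_addl.
  have e2 : (p + q + a <= m)%N by rewrite -e leq_add2l -addnA leq_addr.
  have e3 : (q + p + b <= m)%N by rewrite -e (addnC q) leq_add2l addnAC leq_addl.
  have e4 : (p + q + c <= m)%N by rewrite -e leq_add2l leq_addl.
  have h1 := IH _ _ _ e1; have h2 := IH _ _ _ e2; have h3 := IH _ _ _ e3; have h4 := IH _ _ _ e4.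
  by rewrite /S in h1 h2 h3 h4 *; rewrite -h1 (jb_jordan J) h2 h3 h4 (addnC q).
have star p q : (p + q <= m)%N ->
    S p q (m - (p + q)).+1%N = S (p + q).+1%N 0%N (m - (p + q))%N - S 0%N (p + q).+1%N (m - (p + q))%N + Z.
  move=> le; have := JJ p q 0%N 0%N (m - (p + q))%N; rewrite !add0n !addn0 subnKC // => -> //.
have indep d : (d <= m)%N -> S d 0%N (m - d).+1%N = S 0%N d (m - d).+1%N.
  move=> le; have := star d 0%N; have := star 0%N d; rewrite !addn0 !add0n => -> // -> //.
have SA p q c : (p + q + c.+2 = m.+1)%N -> S p q c.+2 = Z.
  move=> e; have le : (p + q <= m)%N by rewrite -ltnS -e -addSnnS leq_addr.
  have ec : (m - (p + q) = c.+1)%N.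
    by apply/eqP; rewrite -(eqn_add2l (p + q)) subnKC // -eqSS -e addnS.
  have := star p q le; rewrite ec => ->.
  have le2 : ((p + q).+1 <= m)%N by rewrite -ltnS -e !addnS !ltnS leq_addr.
  have ec2 : (m - (p + q).+1 = c)%N by rewrite subnS ec.
  by have := indep _ le2; rewrite ec2 => ->; rewrite subrr add0r.
have S1 p q : (p + q = m)%N -> S p q 1%N = Z - S 0%N m.+1 0%N + Z.
  move=> e; have := star p q; rewrite e leqnn subnn => -> //.
  by rewrite Ssym S00.
have SZ : S 0%N m.+1 0%N = Z.
  have [m0|[m1|m2]] : (m = 0 \/ m = 1 \/ 2 <= m)%N.
  - by case: (m) => [|[|m']]; [left|right; left|right; right].
  - have e : Z = Z - S 0%N m.+1 0%N + Z by rewrite -(S1 0%N 0%N) ?m0 // S00 /Z m0.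
    have -> : S 0%N m.+1 0%N = Z + Z - (Z - S 0%N m.+1 0%N + Z) by lmod R V.
    by rewrite -e addrK.
  (* Total index two escapes the cancellation; one further Jordan identity gives three times the
     claim. *)
  - have e1 := S1 0%N 1%N; rewrite m1 in e1; have {}e1 := e1 erefl.
    have e2 := JJ 0%N 0%N 0%N 1%N 0%N; rewrite m1 /= in e2; have {}e2 := e2 erefl.
    rewrite S00 (Ssym 1%N 1%N 0%N) e1 in e2.
    rewrite m1; have e3 : Z = pw z 3 by rewrite /Z m1.
    rewrite -e3 in e2; set X := S 0%N 2%N 0%N in e2 *.
    have e4 : 3%:R *: X = 3%:R *: Z.
      transitivity (4%:R *: Z - ((Z - X + Z) - X + (Z - X + Z))); first by lmod R V.
      by rewrite -e2; lmod R V.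
    have n3 : (3%:R : R[i]) != 0 by rewrite pnatr_eq0.
    by rewrite -[X](scalerK n3) e4 scalerK.
  - have e : Z = Z - S 0%N m.+1 0%N + Z.
      rewrite -(S1 2%N (m - 2)%N) ?subnKC // Ssym; apply/esym/SA.
      by lia.
    have -> : S 0%N m.+1 0%N = Z + Z - (Z - S 0%N m.+1 0%N + Z) by lmod R V.
    by rewrite -e addrK.
have S1Z p q : (p + q = m)%N -> S p q 1%N = Z by move=> e; rewrite S1 // SZ subrr add0r.
case: k tot => [|[|k]] tot; last exact: SA.
  case: i tot => [|[|i]] tot.
  - by rewrite addn0 add0n in tot; rewrite tot.
  - by rewrite Ssym; apply: S1Z; move: tot; rewrite addn0 add1n => -[].
  - by rewrite Ssym; apply: SA; rewrite addn0 in tot; rewrite -tot add0n addnC.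
by apply: S1Z; move: tot; rewrite addn1 => -[].
Qed.

Definition cub a u := iter a (fun x => tp x x x) u.
(** (3^a - 1)/2, the index for which [pw u (e3 a)] is the a-fold iterated cube of [u]. *)
Fixpoint e3 a := if a is a'.+1 then (e3 a' + e3 a' + e3 a').+1 else 0%N.
Lemma e3E a : ((e3 a).*2.+1 = 3 ^ a)%N.
Proof. elim: a => //= a IH; rewrite expnS -IH -!addnn; lia. Qed.
Lemma N_cub a u : N (cub a u) = N u ^+ (3 ^ a).
Proof. by elim: a => [|a IH] /=; rewrite ?expr1 // (jb_cube J) IH -exprM expnSr. Qed.
Lemma cub_pw a u : cub a u = pw u (e3 a).
Proof. by elim: a => //= a ->; rewrite tp_pw. Qed.
Lemma pw_pw z e k : pw (pw z e) k = pw z (e + k * e.*2.+1).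
Proof.
elim: k => [|k IH]; first by rewrite mul0n addn0.
by rewrite pwS IH tp_pw; congr (pw z _); rewrite mulSn -addnn; lia.
Qed.
Lemma pwZ (t : R) z k : pw (t%:C *: z) k = (t ^+ k.*2.+1)%:C *: pw z k.
Proof.
elim: k => [|k IH]; first by rewrite expr1.
rewrite !pwS IH !tpE !scalerA -!rmorphM; congr (_ *: _).
Qed.
Lemma N_pw_le (y : V) k : N y = 1 -> N (pw y k) <= K ^+ k.
Proof.
move=> y1; elim: k => [|k IH]; first by rewrite y1.
rewrite pwS; apply: le_trans (bop_tp _ _ _) _.
by rewrite y1 !mulr1 exprS ler_wpM2l ?K_ge0.
Qed.
(** Iterated cubes raise norms exactly to the power 3^n, so the 3^n-th power of |z^(2k+1)| is the
    norm of a (2k+1)-st power of a unit vector, and the crude bound K^k holds for all n. *)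
Lemma N_pw1 z k : N z = 1 -> N (pw z k) <= 1.
Proof.
move=> z1; apply: (growth_le1 (C := K ^+ k)); first exact: N_ge0.
move=> n0; exists (3 ^ n0)%N; first exact: exp3_ge.
rewrite -N_cub cub_pw pw_pw -[X in pw z X]/(_)%N.
have -> : (k + e3 n0 * k.*2.+1 = e3 n0 + k * (e3 n0).*2.+1)%N by rewrite -!addnn; lia.
by rewrite -pw_pw -cub_pw; apply: N_pw_le; rewrite N_cub z1 expr1n.
Qed.
Lemma N_pw z k : N (pw z k) <= N z ^+ k.*2.+1.
Proof.
have [z0|z0] := eqVneq (N z) 0.
  have -> : z = 0 by apply: (N_eq0 HN); rewrite z0.
  by case: k => [|k]; rewrite ?expr1 // pwS tp0l (N0 HN) exprn_ge0 ?N_ge0.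
have zp : 0 < N z by rewrite lt_neqAle eq_sym z0 N_ge0.
have -> : z = (N z)%:C *: ((N z)^-1%:C *: z).
  by rewrite scalerA -rmorphM mulfV // scale1r.
set u := (N z)^-1%:C *: z.
have u1 : N u = 1 by rewrite NZp ?invr_ge0 ?N_ge0 // mulVf.
rewrite pwZ NZp ?exprn_ge0 ?N_ge0 // NZp ?N_ge0 // u1 mulr1.
by rewrite -[leRHS]mulr1 ler_wpM2l ?exprn_ge0 ?N_ge0 // N_pw1.
Qed.

(** Polarization of [jb_herm]: (a, c) |-> f{a,c,u} is a hermitian form. *)
Lemma supp_form f u a c : supp N f u -> f (tp a c u) = conjc (f (tp c a u)).
Proof.
move=> sf; have [lf _ _] := sf.
have aux x y : Re (f (tp x y u)) = Re (f (tp y x u)).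
  have h1 := jb_herm J (x + 'i *: y) sf; have h2 := jb_herm J x sf; have h3 := jb_herm J y sf.
  move: h1; rewrite !tpDl !tpDm !tpZl !tpZm !(lfunD lf) !(lfunZ lf) !(ImD, ImM, ReM) /= h2 h3; rlra.
apply: complex_ext; first by rewrite Re_conj.
have := aux a ('i *: c); rewrite tpZm tpZl !(lfunZ lf) !ReM /= => h; rewrite Im_conj; rlra.
Qed.

Lemma herm_low a v (l : R[i]) : `|Im l| * N v <= N (tp a a v - l *: v).
Proof.
have [f sf] := exists_supp HN v; have [lf cf fv] := sf.
apply: le_trans (cf _); apply: le_trans (abs_Im_le _).
rewrite (lfunB lf) (lfunZ lf) fv ImD ImN (jb_herm J _ sf) ImM /=.
rewrite (_ : _ - _ = - (Im l * N v)); last by ring.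
by rewrite normrN normrM (ger0_norm (N_ge0 v)).
Qed.

(** * The value one at the cube of a normed unit vector *)

Section CubeSupport.
Variable z : V.
Hypothesis z1 : N z = 1.
Let T := tp z z.
Let lT : lop T := lop_tp z z.
Lemma bT : bop N T K.
Proof. by move=> v; have := bop_tp z z v; rewrite z1 !mulr1. Qed.

(** Three regimes outside [0,K]: the numerical range handles non-real [l], [bounded_inverse]
    upgrades bijectivity for negative [l], and a Neumann series covers l > K. *)
Lemma shift_good (l : R[i]) : ~ (0 <= l /\ Re l <= K) -> good N (fun v => T v - l *: v).
Proof.
move=> nl; have [l0|l0] := pselect (0 <= l); last first.
  have bj := jb_spec J z l0.
  split; last by move=> y; have [x [e _]] := bj y; exists x.
  have [li|li] := eqVneq (Im l) 0; last first.
    exists (`|Im l|^-1); split; first by rewrite invr_ge0.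
    by move=> v; rewrite ler_pdivlMl ?normr_gt0 //; exact: herm_low.
  apply: (@bounded_inverse _ _ _ HN _ (K + normc l)).
  - by move=> al x y; rewrite lT; lmod R V.
  - by move=> v; apply: le_trans (NB _ _) _; rewrite mulrDl NZ lerD2r bT.
  - exact: bj.
  - move=> e e0 y; have nle : ~ (0 <= l + e *i).
      by rewrite lecE /= => /andP[/eqP]; rewrite ImD li add0r /= => e0'; rewrite e0' ltxx in e0.
    have [x [ex ux]] := jb_spec J z nle y; exists x; split.
      by rewrite -ex /T; lmod R V.
    by move=> x' ex'; apply: ux; rewrite -ex' /T; lmod R V.
  - move=> e v e0; have := herm_low z v (l + e *i).
    rewrite ImD li add0r /= gtr0_norm // => h; apply: le_trans h _.
    by have -> : T v - l *: v - e*i *: v = tp z z v - (l + e *i) *: v by rewrite /T; lmod R V.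
have lK : K < Re l by rewrite ltNge; apply/negP => h; apply: nl.
have el : l = (Re l)%:C by apply: complex_ext => //=; exact: ger0_Im.
rewrite el; set x := Re l in lK *; have K1 := K_ge1.
split.
  exists (x - K)^-1; split; first by rewrite invr_ge0; rlra.
  move=> v; rewrite ler_pdivlMl; last by rlra.
  have := N_sub_ge HN (x%:C *: v) (T v); rewrite (NBC HN) NZp; last by rlra.
  by have := bT v; rlra.
move=> y.
have x0 : 0 < x by rlra.
have [||||u hu] := @neumann _ _ _ HN (fun v => x^-1%:C *: T v) (K / x) _ _ _ _ (- x^-1%:C *: y).
- by move=> al u v; rewrite lT; lmod R V.
- by rewrite divr_ge0 ?K_ge0 // ltW.
- by rewrite ltr_pdivrMr // mul1r.
- move=> v; rewrite NZp ?invr_ge0 ?(ltW x0) // (mulrC K) -mulrA.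
  by apply: ler_wpM2l; [rewrite invr_ge0 ltW | exact: bT].
exists u.
have -> : T u - x%:C *: u = - x%:C *: (u - x^-1%:C *: T u).
  rewrite scalerBr !scalerA mulNr -rmorphM mulfV ?gt_eqF //.
  by rewrite rmorph1; lmod R V.
by rewrite hu scalerA mulrNN -rmorphM mulfV ?gt_eqF // rmorph1 scale1r.
Qed.

Variable b : nat.
Let m := (3 ^ b)%N.
Let M := (m + m)%N.
Hypothesis KM : K <= M%:R.
Let c : R := M%:R^-1.
(** In the spectral variable x = t^2 of [z], [T] is multiplication by x, [G] by 1 + (1 - x)/M, and
    [A] by x (1 + (1 - x)/M)^M, which is at most 1 on [0,K] by [power_bound]. [M] is twice a power
    of three so that iterated cubes of [G z] are expressed through powers of [A]. *)
Let G v := v + c%:C *: (v - T v).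
Let A v := T (iter M G v).

Lemma M_gt0 : 0 < M%:R :> R. Proof. by apply: lt_le_trans KM; have := K_ge1; rlra. Qed.
Lemma lG : lop G. Proof. by move=> al x y; rewrite /G lT; lmod R V. Qed.
Lemma GT v : G (T v) = T (G v).
Proof. by rewrite /G (lopD lT) (lopZ lT) (lopB lT). Qed.

(** Factor 1 - mu X g^M over the complex numbers: at a root x in [0,K] the modulus of mu x g(x)^M
    would be one, although it is at most r < 1. All linear factors are therefore covered by
    [shift_good]. *)
Lemma resolvent_good (r : R) mu : r < 1 -> normc mu <= r -> good N (fun v => v - mu *: A v).
Proof.
move=> r1 mur.
pose g : {poly R[i]} := 1 + c%:C *: (1 - 'X).
have pg p v : peval T (g * p) v = G (peval T p v).
  rewrite /g mulrDl mul1r pevalD -scalerAl pevalZ mulrBl mul1r pevalD -scaleN1r pevalZ.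
  by rewrite pevalX // /G; lmod R V.
have pgk k p v : peval T (g ^+ k * p) v = iter k G (peval T p v).
  by elim: k => [|k IH] /=; rewrite ?expr0 ?mul1r // exprS -mulrA pg IH.
pose p : {poly R[i]} := 1 + (- mu) *: ('X * (g ^+ M * 1)).
have pp v : peval T p v = v - mu *: A v.
  by rewrite /p pevalD pevalZ pevalX // pgk peval1 scaleNr.
have pn0 : p != 0.
  apply/eqP => h; have := congr1 (horner^~ 0) h.
  rewrite /p /= hornerD hornerZ hornerM hornerX mul0r mulr0 addr0 horner0 hornerE => /eqP.
  by rewrite oner_eq0.
have [rs ers] := closed_field_poly_normal p.
have lc : lead_coef p != 0 by rewrite lead_coef_eq0.
suff h : good N (peval T (\prod_(z <- rs) ('X - z%:P))).
  have := good_comp (good_scale HN lc) h => -[[C [C0 hC]] s]; split.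
    by exists C; split=> // v; rewrite -pp ers pevalZ.
  by move=> y; have [x e] := s y; exists x; rewrite -pp ers pevalZ.
apply: peval_good => // l lrs; apply: shift_good => -[l0 lK].
have : root p l by rewrite ers rootZ // root_prod_XsubC.
have el : l = (Re l)%:C by apply: complex_ext => //=; exact: ger0_Im.
have x0 : 0 <= Re l by move: l0; rewrite el ler0c.
rewrite el; set x := Re l in lK x0 *.
rewrite /root /p /g !hornerE /= => /eqP e.
have e' : mu * (x * (1 + c * (1 - x)) ^+ M)%:C = 1.
  rewrite rmorphM rmorphXn rmorphD rmorphM rmorphB rmorph1.
  have := congr1 (fun y => 1 - y) e; rewrite subr0 => e1; rewrite -[RHS]e1; ring.
have M0 := M_gt0.
have y0 : 0 <= 1 + c * (1 - x).
  have : c * (1 - x + M%:R) = 1 + c * (1 - x) by rewrite /c mulrDr mulVf ?gt_eqF // addrC.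
  move=> <-; rewrite mulr_ge0 ?invr_ge0 ?(ltW M0) //.
  have aux (y : R) : x <= y -> 0 <= 1 - x + y by rlra.
  exact: aux (le_trans lK KM).
have hb := power_bound M y0.
have ex : 1 + M%:R * (1 - (1 + c * (1 - x))) = x.
  by rewrite /c; field; rewrite gt_eqF.
rewrite ex in hb.
have h0 : 0 <= x * (1 + c * (1 - x)) ^+ M by rewrite mulr_ge0 ?exprn_ge0.
have := congr1 (@normc R) e'; rewrite normcM normcR Normc.normc1 ger0_norm // => e2.
have := ler_pM (normc_ge0 mu) h0 mur hb; rlra.
Qed.

Lemma calc a1 a2 a3 i j k :
  tp (iter a1 G (pw z i)) (iter a2 G (pw z j)) (iter a3 G (pw z k)) =
  iter (a1 + a2 + a3) G (pw z (i + j + k).+1).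
Proof.
have Gs a l : iter a.+1 G (pw z l) =
    (1 + c)%:C *: iter a G (pw z l) - c%:C *: iter a G (pw z l.+1).
  have eG : G (pw z l) = (1 + c)%:C *: pw z l - c%:C *: pw z l.+1.
    by rewrite /G /T pwS rmorphD rmorph1; lmod R V.
  by rewrite iterSr eG (lopB (lop_iter lG a)) !(lopZ (lop_iter lG a)).
elim: a1 i => [|a1 IH1] i.
  elim: a2 j => [|a2 IH2] j.
    elim: a3 k => [|a3 IH3] k; first exact: tp_pw.
    rewrite Gs !tpE !IH3; have -> : (i + j + k.+1 = (i + j + k).+1)%N by lia.
    by rewrite -Gs; congr (iter _ _ _); lia.
  rewrite Gs !tpE !IH2; have -> : (i + j.+1 + k = (i + j + k).+1)%N by lia.
  by rewrite -Gs; congr (iter _ _ _); lia.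
rewrite Gs !tpE !IH1; have -> : (i.+1 + j + k = (i + j + k).+1)%N by lia.
by rewrite -Gs; congr (iter _ _ _); lia.
Qed.

Lemma pw_G k : pw (G z) k = iter k.*2.+1 G (pw z k).
Proof.
elim: k => [|k IH] //; rewrite pwS IH.
have := calc 1 1 k.*2.+1 0 0 k; rewrite /= => ->.
by rewrite !add0n.
Qed.

(** The iterated cube of w = [G z] of exponent 3^(a+b) is A^(e3 a) applied to a vector bounded
    independently of a. Were |w| > 1, the spectral radius estimate with s = 1/|w| would bound
    |w|^(3^(a+b) - e3 a) for arbitrarily large a. *)
Lemma G_norm : N (G z) <= 1.
Proof.
pose w := G z; suff : ~ 1 < N w by move/negP; rewrite -leNgt.
move=> w1.
have iterA e v : iter e A v = iter (M * e) G (iter e T v).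
  elim: e v => [|e IH] v; first by rewrite muln0.
  rewrite iterS IH /A mulnS iterD.
  have cm i j u : iter i T (iter j G u) = iter j G (iter i T u).
    by apply: iter_comm => x; rewrite GT.
  by rewrite -[LHS]/(iter 1 T (iter M G (iter (M * e) G (iter e T v)))) !cm.
pose g := 1 + c * (1 + K).
have c0 : 0 <= c by rewrite invr_ge0 ltW // M_gt0.
have g0 : 0 <= g by rewrite addr_ge0 // mulr_ge0 // addr_ge0 ?K_ge0.
have bG : bop N G g.
  move=> v; rewrite /g mulrDl mul1r; apply: le_trans (ND _ _) _; rewrite lerD2l NZp // -mulrA ler_wpM2l //.
  by apply: le_trans (NB _ _) _; rewrite mulrDl mul1r lerD2l bT.
pose D := g ^+ m * K ^+ e3 b.
have zb a : N (pw z (3 ^ a * e3 b)) <= K ^+ e3 b.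
  pose y := pw z (e3 a); have y1 : N y = 1 by rewrite /y -cub_pw N_cub z1 expr1n.
  have -> : pw z (3 ^ a * e3 b) = iter (e3 b) (tp y y) z.
    elim: (e3 b) => [|e IH]; first by rewrite muln0.
    rewrite iterS -IH; have := tp_pw z (e3 a) (e3 a) (3 ^ a * e); rewrite -/y => ->.
    by congr (pw z _); rewrite mulnS -e3E -addnn addSn.
  have := bop_iter (e3 b) _ (bop_tp y y) z; rewrite y1 !mulr1 z1 mulr1; apply.
  exact: K_ge0.
pose s : R := (N w)^-1.
have w0 : 0 < N w by rlra.
have s0 : 0 <= s by rewrite invr_ge0 ltW.
have s1 : s < 1 by rewrite invf_lt1.
pose r := (s + 1) / 2.
have bA : bop N A (K * g ^+ M).
  move=> v; apply: le_trans (bT _) _; rewrite -mulrA ler_wpM2l ?K_ge0 //.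
  exact: bop_iter.
have lA : lop A by move=> al x y; rewrite /A (lop_iter lG) lT.
have [n0 hn0] : exists n0 : nat, forall n, (n0 <= n)%N -> forall v, s ^+ n * N (iter n A v) <= N v.
  apply: (rickart HN lA (a := K * g ^+ M) (r := r)) => //.
  - by rewrite mulr_ge0 ?K_ge0 ?exprn_ge0.
  - by rewrite /r; rlra.
  - by move=> mu mur; apply: (@resolvent_good r) => //; rewrite /r; rlra.
  - by rewrite /r; rlra.
suff : N w <= 1 by rewrite leNgt w1.
apply: (growth_le1 (C := D)); first exact: N_ge0.
move=> k0; pose a := (n0 + k0)%N.
have ea : (a <= e3 a)%N.
  by elim: (a) => //= a' h; rewrite ltnS; apply: leq_trans h _; rewrite -addnA leq_addr.
exists (e3 a).+1; first by apply: leq_trans (leqW ea); rewrite leq_addl.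
pose u := iter m G (pw z (3 ^ a * e3 b)).
have eN : N w ^+ (3 ^ (a + b)) = N (iter (e3 a) A u).
  rewrite -N_cub cub_pw pw_G iterA /u; congr N.
  have cm i j x : iter i T (iter j G x) = iter j G (iter i T x).
    by apply: iter_comm => y; rewrite GT.
  have h1 := e3E (a + b); rewrite expnD -(e3E b) -(e3E a) in h1.
  have i1 : ((e3 (a + b)).*2.+1 = M * e3 a + m)%N.
    rewrite h1 /M /m -(e3E b) -!addnn; lia.
  have i2 : pw z (e3 (a + b)) = iter (e3 a) T (pw z (3 ^ a * e3 b)).
    rewrite /pw -iterD -(e3E a); congr iter; move: h1; rewrite -!addnn; lia.
  by rewrite cm -iterD i1 i2.
have := hn0 (e3 a) (leq_trans (leq_addr _ _) ea) u; rewrite -eN => h1.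
have h2 : N u <= D.
  rewrite /u /D; apply: le_trans (bop_iter m g0 bG _) _.
  by rewrite ler_wpM2l ?exprn_ge0.
apply: le_trans _ h2; apply: le_trans _ h1.
rewrite /s exprVn mulrC ler_pdivlMr ?exprn_gt0 //  -exprD.
apply: ler_weXn2l; first exact: ltW.
rewrite expnD -/m -(e3E a) -addnn.
have : (1 <= m)%N by rewrite /m expn_gt0.
nia.
Qed.
End CubeSupport.

(** [G_norm] gives Re f(z + c(z - {z,z,z})) <= 1 with c > 0 and f(z) = 1, hence Re f{z,z,z} >= 1. *)
Lemma supp_cube f z : supp N f z -> N z = 1 -> f (tp z z z) = 1.
Proof.
move=> sf z1; have [lf cf fz] := sf.
have [b hb] := archi K.
have KM : K <= (3 ^ b + 3 ^ b)%N%:R.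
  apply: le_trans (ltW hb) _; rewrite ler_nat; apply: leq_trans (exp3_ge b) _; exact: leq_addr.
have h := G_norm z1 KM; have c0 : 0 < (3 ^ b + 3 ^ b)%N%:R^-1 :> R.
  by rewrite invr_gt0; have := K_ge1; rlra.
have := supp_Re (z + ((3 ^ b + 3 ^ b)%N%:R^-1)%:C *: (z - tp z z z)) sf.
rewrite (lfunD lf) (lfunZ lf) (lfunB lf) ReD ReMr ReB fz z1 /= => h2.
apply: Re_norm_eq; last by have := cf (tp z z z); rewrite (jb_cube J) z1 expr1n.
apply/eqP; rewrite eq_le; apply/andP; split.
  by have := supp_Re (tp z z z) sf; rewrite (jb_cube J) z1 expr1n.
rnra.
Qed.
End JB.

(** * Norming functionals are invariant under [L(z,z)] *)

Section Support.
Variables (R : realType) (V : lmodType R[i]) (N : V -> R).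
Variables (tp : V -> V -> V -> V) (K : R).
Hypothesis J : jb_axioms N tp K.
Let HN := jb_banach J.
Local Notation N_ge0 := (N_ge0 HN).
Local Notation NZ := (NZ HN).
Local Notation NZp := (NZp HN).
Local Notation ND := (ND HN).
Local Notation NB := (NB HN).
Local Notation NN := (NN HN).
Local Notation pw := (pw tp).
Local Notation tpE := (tpE J).
Local Notation tpS := (jb_sym J).
Local Notation K_ge0 := (K_ge0 J).
Local Notation K_ge1 := (K_ge1 J).

(** Compare first-order terms in Re f{w,w,w} <= |w|^3 for w = z + t c: the left side contributes 3
    Re f{z,z,c}, because {z,c,z} and {z,z,c} have the same real part under f. *)
Lemma supp_T f z : supp N f z -> N z = 1 -> supp N (fun c => f (tp z z c)) z.
Proof.
move=> sf z1; have [lf cf fz] := sf; have f3 := supp_cube J sf z1.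
have lg : lfun (fun c => f (tp z z c)) by move=> a x y; rewrite (lop_tp J) lf.
split=> //; last by rewrite f3 z1.
move=> v0; rewrite -[N v0]mul1r; apply: (lfun_Re_bound HN lg) => c {v0}; rewrite mul1r.
set g := N c; have g0 : 0 <= g := N_ge0 c.
have g2 : 0 <= g ^+ 2 by rewrite exprn_ge0.
have g3 : 0 <= g ^+ 3 by rewrite exprn_ge0.
pose C0 := K * (3 * g ^+ 2 + g ^+ 3).
have C00 : 0 <= C0 by rewrite mulr_ge0 ?K_ge0 //; rlra.
apply: (@le_eps_near _ _ _ (C0 + 3 * g ^+ 2 + g ^+ 3) 1) => //; first by rlra.
move=> t t0 t1; pose w := z + t%:C *: c.
pose Rm := tp c c z + tp c z c + tp z c c + t%:C *: tp c c c.
have ew : tp w w w = tp z z z + t%:C *: (tp z z c + tp z z c + tp z c z) + (t ^+ 2)%:C *: Rm.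
  by rewrite /w !tpE (tpS c z z) rmorphXn /Rm; lmod R V.
have NR : N Rm <= C0.
  have h1 : N (tp c c z) <= K * (g * g * 1) by apply: (tp_bound J); rewrite // z1.
  have h2 : N (tp c z c) <= K * (g * 1 * g) by apply: (tp_bound J); rewrite // z1.
  have h3 : N (tp z c c) <= K * (1 * g * g) by apply: (tp_bound J); rewrite // z1.
  have h4 : N (tp c c c) <= K * (g * g * g) by apply: (tp_bound J).
  rewrite /Rm; apply: le_trans (ND _ _) _; apply: le_trans (lerD (ND _ _) (lexx _)) _.
  apply: le_trans (lerD (lerD (ND _ _) (lexx _)) (lexx _)) _; rewrite (NZp _ (ltW t0)).
  have h5 : t * N (tp c c c) <= K * (g * g * g) by have := N_ge0 (tp c c c); rnra.
  rewrite /C0; rlra.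
have hN : N w <= 1 + t * g by apply: le_trans (ND _ _) _; rewrite z1 (NZp _ (ltW t0)).
have hc : Re (f (tp w w w)) <= (1 + t * g) ^+ 3.
  apply: le_trans (supp_Re _ sf) _; rewrite (jb_cube J).
  by rewrite lerXn2r ?nnegrE ?N_ge0 // (le_trans (N_ge0 w) hN).
have e1 : Re (f (tp z c z)) = Re (f (tp z z c)).
  by rewrite (supp_form J _ _ sf) Re_conj (tpS c).
have h6 : - (t ^+ 2 * C0) <= Re (f ((t ^+ 2)%:C *: Rm)).
  rewrite (lfunZ lf) ReMr -mulrN ler_wpM2l ?sqr_ge0 //.
  have := supp_Re (- Rm) sf; rewrite (lfunN lf) ReN NN; rlra.
move: hc; rewrite ew !(lfunD lf) (lfunZ lf) !(lfunD lf) !(ReD, ReMr) f3 e1 /=.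
set X := Re (f (tp z z c)) => hc.
have h7 : t * (3 * X) <= t * (3 * g + t * (C0 + 3 * g ^+ 2 + g ^+ 3)).
  have : (1 + t * g) ^+ 3 = 1 + 3 * (t * g) + t ^+ 2 * (3 * g ^+ 2) + t ^+ 2 * (t * g ^+ 3) by ring.
  have : t * g ^+ 3 <= g ^+ 3 by rnra.
  have := sqr_ge0 t; rnra.
rewrite ler_pM2l // in h7.
have Cp : 0 <= C0 + 3 * g ^+ 2 + g ^+ 3 by rlra.
have := mulr_ge0 (ltW t0) Cp; rlra.
Qed.

Lemma supp_pw f z k : supp N f z -> N z = 1 -> f (pw z k) = 1.
Proof.
move=> sf z1; elim: k f sf => [|k IH] f sf; first by have [_ _ ->] := sf; rewrite z1.
exact: (IH _ (supp_T sf z1)).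
Qed.
Lemma supp_iter f z k c : supp N f z -> N z = 1 -> normc (f (iter k (tp z z) c)) <= N c.
Proof.
move=> sf z1; elim: k f sf => [|k IH] f sf; first by have [_ cf _] := sf.
exact: (IH _ (supp_T sf z1)).
Qed.
Lemma supp_at_pw f z k : supp N f z -> N z = 1 -> supp N f (pw z k).
Proof.
move=> sf z1; have [lf cf _] := sf; split=> //; rewrite (supp_pw k sf z1).
have -> // : N (pw z k) = 1.
apply/eqP; rewrite eq_le (N_pw1 J) //=.
by have := cf (pw z k); rewrite (supp_pw k sf z1) Normc.normc1.
Qed.

(** Two Jordan identities, one of them conjugated through the hermitian form, add up to twice the
    inductive step. *)
Lemma supp_L f z i c : supp N f z -> N z = 1 ->
  f (tp (pw z i) z c) = f (iter i.+1 (tp z z) c).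
Proof.
move=> sf z1; elim: i f c sf => [|i IH] f c sf //.
have sT := supp_T sf z1; have [lf _ _] := sf.
suff -> : f (tp (pw z i.+1) z c) = f (tp z z (tp (pw z i) z c)).
  by rewrite (IH _ c sT).
have form g x d : supp N g z -> g (tp x d (pw z i)) = conjc (g (tp (pw z i) x d)).
  by move=> sg; rewrite (tpS (pw z i)); apply: (supp_form J); exact: supp_at_pw.
have form1 x d : f (tp x d (pw z i.+1)) = conjc (f (tp (pw z i.+1) x d)).
  by rewrite (tpS (pw z i.+1)); apply: (supp_form J); exact: supp_at_pw.
have eB := congr1 f (jb_jordan J z z (pw z i) z c).
have eA := congr1 f (jb_jordan J z z z c (pw z i)).
rewrite -(pwS tp z i) -[tp z z z]/(pw z 1) (lfunD lf) (lfunB lf) in eA.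
rewrite -(pwS tp z i) -[tp z z z]/(pw z 1) (lfunD lf) (lfunB lf) in eB.
rewrite (form _ z c sT) (form f (pw z 1) c sf) (form f z (tp z z c) sf) (form1 z c) in eA.
have conjN (q : R[i]) : conjc (- q) = - conjc q by case: q.
have e2 := congr1 conjc eA; rewrite !conjcD conjN !conjcK in e2.
move: eB e2.
set a1 := f (tp z z (tp (pw z i) z c)).
set a2 := f (tp (pw z i.+1) z c).
set a3 := f (tp (pw z i) (pw z 1) c).
set a4 := f (tp (pw z i) z (tp z z c)).
move=> e1 e2.
have n2 : (2%:R : R[i]) != 0 by rewrite pnatr_eq0.
apply: (mulfI n2).
have -> : 2%:R * a2 = (a2 - a3 + a4) + (a3 - a4 + a2) by ring.
by rewrite -e1 -e2; ring.
Qed.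

(** The real derivative of z |-> z^(2k+1) in the direction [c]. *)
Fixpoint dpw z c k := if k is k'.+1 then
  tp c z (pw z k') + tp z c (pw z k') + tp z z (dpw z c k') else c.

Lemma supp_dpw f z c k : supp N f z -> N z = 1 ->
  Re (f (dpw z c k)) = k.*2.+1%:R * Re (f (iter k (tp z z) c)).
Proof.
move=> sf z1; elim: k f sf => [|k IH] f sf; first by rewrite mul1r.
have sT := supp_T sf z1; have [lf _ _] := sf.
rewrite /= !(lfunD lf) !ReD (IH _ sT) /=.
have -> : Re (f (tp c z (pw z k))) = Re (f (tp z z (iter k (tp z z) c))).
  by rewrite (tpS c) (supp_L k c sf z1).
have -> : Re (f (tp z c (pw z k))) = Re (f (tp z z (iter k (tp z z) c))).
  by rewrite (supp_form J _ _ (supp_at_pw k sf z1)) Re_conj (tpS c) (supp_L k c sf z1).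
by rewrite doubleS -[k.*2.+3%:R]/((k.*2.+1).+2%:R) -addn2 natrD; ring.
Qed.

(** Second-order Taylor remainder. The constant is uniform in the unit vector [w], since in the
    application [w] varies with [t]. *)
Lemma pw_expand k (b : R) : 1 <= b -> exists C : R, 0 <= C /\
  forall w c (t : R), N w = 1 -> N c <= b -> 0 <= t -> t <= 1 ->
  N (pw (w - t%:C *: c) k - pw w k + t%:C *: dpw w c k) <= C * t ^+ 2.
Proof.
move=> b1; have b0 : 0 <= b by rlra.
suff [C [D [C0 D0 h]]] : exists C D : R, [/\ 0 <= C, 0 <= D &
  forall w c (t : R), N w = 1 -> N c <= b -> 0 <= t -> t <= 1 ->
  N (pw (w - t%:C *: c) k - pw w k + t%:C *: dpw w c k) <= C * t ^+ 2 /\ N (dpw w c k) <= D].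
  by exists C; split=> // w c t w1 cb t0 t1; have [] := h w c t w1 cb t0 t1.
elim: k => [|k [C [D [C0 D0 IH]]]].
  exists 0, b; split=> // w c t w1 cb t0 t1; split=> //=.
  have -> : w - t%:C *: c - w + t%:C *: c = 0 by lmod R V.
  by rewrite (N0 HN) mul0r.
pose C' := K * ((1 + b) * (1 + b)) * C + K * (b * D + b * D + b * b + b * b * D).
pose D' := K * (b + b + D).
have C'0 : 0 <= C'.
  by rewrite addr_ge0 ?mulr_ge0 ?K_ge0 //; rnra.
exists C', D'; split=> //; first by rewrite mulr_ge0 ?K_ge0 //; rlra.
move=> w c t w1 cb t0 t1; have [h1 h2] := IH w c t w1 cb t0 t1.
have wk : N (pw w k) <= 1 by apply: (N_pw1 J).
have wl : N w <= 1 by rewrite w1.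
split; last first.
  have i1 : N (tp c w (pw w k)) <= K * (b * 1 * 1) by apply: (tp_bound J).
  have i2 : N (tp w c (pw w k)) <= K * (1 * b * 1) by apply: (tp_bound J).
  have i3 : N (tp w w (dpw w c k)) <= K * (1 * 1 * D) by apply: (tp_bound J).
  rewrite /= /D'; apply: le_trans (ND _ _) _; apply: le_trans (lerD (ND _ _) (lexx _)) _; rlra.
set e := pw (w - t%:C *: c) k - pw w k + t%:C *: dpw w c k in h1.
have ez : pw (w - t%:C *: c) k = pw w k - t%:C *: dpw w c k + e by rewrite /e; lmod R V.
pose Q := tp c w (dpw w c k) + tp w c (dpw w c k) + tp c c (pw w k) - t%:C *: tp c c (dpw w c k).
have -> : pw (w - t%:C *: c) k.+1 - pw w k.+1 + t%:C *: dpw w c k.+1 =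
    tp (w - t%:C *: c) (w - t%:C *: c) e + (t ^+ 2)%:C *: Q.
  rewrite !pwS ez /= /Q; move: (pw w k) (dpw w c k) e {ez h1 h2 wk Q} => y1 y2 y3.
  by rewrite !tpE rmorphXn; lmod R V.
apply: le_trans (ND _ _) _; rewrite /C' mulrDl; apply: lerD.
  rewrite -mulrA; apply: le_trans (_ : K * ((1 + b) * (1 + b) * (C * t ^+ 2)) <= _); last by rlra.
  have wz : N (w - t%:C *: c) <= 1 + b.
    by apply: le_trans (NB _ _) _; rewrite w1 NZp // lerD2l; have := N_ge0 c; rnra.
  exact: (tp_bound J).
rewrite NZp ?sqr_ge0 // mulrC ler_wpM2r ?sqr_ge0 //.
have i1 : N (tp c w (dpw w c k)) <= K * (b * 1 * D) by apply: (tp_bound J).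
have i2 : N (tp w c (dpw w c k)) <= K * (1 * b * D) by apply: (tp_bound J).
have i3 : N (tp c c (pw w k)) <= K * (b * b * 1) by apply: (tp_bound J).
have i4 : N (tp c c (dpw w c k)) <= K * (b * b * D) by apply: (tp_bound J).
have i5 : N (t%:C *: tp c c (dpw w c k)) <= K * (b * b * D).
  by rewrite NZp //; have := N_ge0 (tp c c (dpw w c k)); rnra.
rewrite /Q; apply: le_trans (NB _ _) _.
apply: le_trans (lerD (ND _ _) (lexx _)) _.
apply: le_trans (lerD (lerD (ND _ _) (lexx _)) (lexx _)) _; rlra.
Qed.

Lemma power_gap (x : R) m : 0 <= x -> x <= 1 -> m%:R * (1 - x) <= 1 ->
  m%:R * (1 - x) / 2 <= 1 - x ^+ m.
Proof.
move=> x0 x1 h; set d := 1 - x in h *.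
have d0 : 0 <= d by rewrite /d; rlra.
have hb := bernoulli m d0; rewrite -mulr_natl in hb.
have xm : x ^+ m * (1 + d) ^+ m <= 1.
  by rewrite -exprMn; apply: exprn_ile1; rewrite /d; rnra.
have xm0 : 0 <= x ^+ m by rewrite exprn_ge0.
have md0 : 0 <= m%:R * d by rewrite mulr_ge0 // ler0n.
have : x ^+ m * (1 + m%:R * d) <= 1 by apply: le_trans xm; rewrite ler_wpM2l.
rnra.
Qed.

(* Bounding the support functional of [z + t (c - {z,z,c})] on all odd powers and summing
   telescopes [c - {z,z,c}]: the one-sided derivative of the norm is at most [8 N c / n]. *)
Lemma supp_T_le g z c : supp N g z -> N z = 1 -> Re (g (c - tp z z c)) <= 0.
Proof.
move=> sg z1; have [lg cg gz] := sg.
set h0 := c - tp z z c; set X := Re (g h0); rewrite leNgt; apply/negP => X0.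
set gam := N c; have gam0 : 0 <= gam := N_ge0 c.
pose b := (1 + K) * gam + 1; have K0 := K_ge0.
have b1 : 1 <= b by rewrite /b lerDr mulr_ge0 //; rlra.
have h0b : N h0 <= b.
  have := NB c (tp z z c); have := bop_tp J z z c; rewrite z1 !mulr1 -/gam -/h0 /b; rlra.
suff main (n : nat) : n%:R * X <= 8 * gam.
  have [n hn] := archi (8 * gam / X); move: hn; rewrite ltr_pdivrMr // => hn.
  by have := main n; rlra.
have [->|n0] := eqVneq n 0%N; first by rewrite mul0r; rlra.
have np : 0 < n%:R :> R by rewrite ltr0n lt0n.
have /choice[C hC] := fun k => pw_expand k b1.
pose C1 := K * gam * (4 * b + b ^+ 2).
have C10 : 0 <= C1 by rewrite !mulr_ge0 //; rnra.
pose CS := \sum_(k < n) C k.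
have CS0 : 0 <= CS by apply: sumr_ge0 => k _; have [] := hC k.
pose C' := n%:R * C1 + CS.
have C'0 : 0 <= C' by rewrite addr_ge0 // mulr_ge0 // ltW.
have b0 : 0 < b by rlra.
have d0 : 0 < (2 * n%:R * b)^-1 by rewrite invr_gt0 !mulr_gt0.
apply: (@le_eps_near _ _ _ (4 * C') _ _ d0); first by rlra.
move=> t t0 td.
have tb : t * (2 * n%:R * b) <= 1.
  by move: td; rewrite -ler_pdivlMr ?mul1r // !mulr_gt0.
have n1 : 1 <= n%:R :> R by rewrite (ler_nat _ 1) lt0n.
have tb1 : 2 * (t * b) <= 1 by have : 0 <= t * b by [rnra]; rnra.
have t1 : t <= 1 by rnra.
pose w0 := z + t%:C *: h0; pose rho := N w0.
have rho1 : 1 + t * X <= rho.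
  have := supp_Re w0 sg; rewrite /w0 (lfunD lg) (lfunZ lg) ReD ReMr gz z1 /=; exact.
have rho2 : rho <= 1 + t * b.
  apply: le_trans (ND _ _) _; rewrite z1 (NZp _ (ltW t0)) lerD2l; apply: ler_wpM2l => //; exact: ltW.
have tX : 0 < t * X by rewrite mulr_gt0.
have rho0 : 0 < rho by rlra.
pose x := rho^-1.
have x0 : 0 < x by rewrite invr_gt0.
have xr : x * rho = 1 by rewrite /x mulVf ?gt_eqF.
have x1 : x <= 1 by rewrite invf_le1 //; rlra.
have dx : 1 - x <= t * b by rnra.
pose w := x%:C *: w0; have w1 : N w = 1 by rewrite (NZp _ (ltW x0)).
pose h' := x%:C *: h0; pose c' := x%:C *: c.
have h'b : N h' <= b by rewrite (NZp _ (ltW x0)); have := N_ge0 h0; rnra.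
have c'b : N c' <= gam by rewrite (NZp _ (ltW x0)) -/gam; rnra.
(* The expansion is made at the displaced unit vector [w], where [f] norms; seen from there, x z = w
   - t h' has odd powers of norm at most x^(2k+1). *)
have ez : x%:C *: z = w - t%:C *: h' by rewrite /w /h' /w0; lmod R V.
have [f sf] := exists_supp HN w; have [lf cf fw] := sf.
have TT : N (tp w w c' - tp z z c') <= C1 * t.
  pose Y := tp h0 z c' + tp z h0 c' + t%:C *: tp h0 h0 c'.
  have -> : tp w w c' - tp z z c' = (x ^+ 2 - 1)%:C *: tp z z c' + (x ^+ 2 * t)%:C *: Y.
    rewrite /w /w0 /Y; move: (h0) (c') => p q.
    by rewrite !tpE !(rmorphB, rmorphM, rmorphXn, rmorph1); lmod R V.
  have zl : N z <= 1 by rewrite z1.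
  have i1 : N (tp z z c') <= K * (1 * 1 * gam) by apply: (tp_bound J).
  have i2 : N (tp h0 z c') <= K * (b * 1 * gam) by apply: (tp_bound J).
  have i3 : N (tp z h0 c') <= K * (1 * b * gam) by apply: (tp_bound J).
  have i4 : N (tp h0 h0 c') <= K * (b * b * gam) by apply: (tp_bound J).
  have NY : N Y <= K * gam * (2 * b + b ^+ 2).
    rewrite /Y; apply: le_trans (ND _ _) _; apply: le_trans (lerD (ND _ _) (lexx _)) _.
    rewrite (NZp _ (ltW t0)); have : t * N (tp h0 h0 c') <= K * (b * b * gam).
      by have := N_ge0 (tp h0 h0 c'); rnra.
    rlra.
  have x21 : `|x ^+ 2 - 1| <= 2 * (t * b).
    rewrite ler_norml; apply/andP; split; rnra.
  have x2t : 0 <= x ^+ 2 * t by rewrite mulr_ge0 ?sqr_ge0 // ltW.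
  have x2t' : x ^+ 2 * t <= t by have : x ^+ 2 <= 1 by [rewrite expr_le1 // ltW]; rnra.
  apply: le_trans (ND _ _) _; rewrite (NZr HN) NZp //.
  have j1 : `|x ^+ 2 - 1| * N (tp z z c') <= 2 * (t * b) * (K * gam).
    by apply: ler_pM => //; rewrite ?N_ge0 //; rlra.
  have j2 : x ^+ 2 * t * N Y <= t * (K * gam * (2 * b + b ^+ 2)).
    by apply: ler_pM => //; rewrite ?N_ge0.
  rewrite /C1; rlra.
have step k : (k < n)%N -> (1 - x) / 2 <=
    t * (Re (f (iter k (tp w w) c')) - Re (f (iter k.+1 (tp w w) c'))) + t ^+ 2 * (C1 + C k).
  move=> kn; have [Ck0 hk] := hC k.
  have := hk w h' t w1 h'b (ltW t0) t1; rewrite -ez; set e := _ - _ + _ => he.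
  have e1 : pw (x%:C *: z) k = pw w k - t%:C *: dpw w h' k + e by rewrite /e; lmod R V.
  have h1 : Re (f (pw (x%:C *: z) k)) <= x ^+ k.*2.+1.
    apply: le_trans (supp_Re _ sf) _; apply: le_trans (N_pw J _ _) _.
    by rewrite (NZp _ (ltW x0)) z1 mulr1.
  have h2 := supp_Re (- e) sf.
  rewrite e1 (lfunD lf) (lfunB lf) (lfunZ lf) ReD ReB ReMr (supp_pw k sf w1) (supp_dpw h' k sf w1) in h1.
  rewrite (lfunN lf) ReN NN in h2.
  have h3 : k.*2.+1%:R * (1 - x) <= 1.
    have : k.*2.+1%:R <= 2 * n%:R :> R by rewrite -natrM ler_nat mul2n ltn_double.
    have : 0 <= 1 - x by rlra.
    have : 0 <= n%:R * (t * b) by rewrite !mulr_ge0 // ltW.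
    rnra.
  have h4 := power_gap (ltW x0) x1 h3.
  have eh : h' = (c' - tp w w c') + (tp w w c' - tp z z c').
    by rewrite /h' /h0 /c' !tpE; lmod R V.
  have h5 : Re (f (iter k (tp w w) h')) <= Re (f (iter k (tp w w) c')) - Re (f (iter k.+1 (tp w w) c')) + C1 * t.
    have lI := lop_iter (lop_tp J w w) k.
    rewrite {1}eh (lopD lI) (lfunD lf) ReD (lopB lI (c') (tp w w c')) (lfunB lf) ReB -iterSr lerD2l.
    apply: le_trans (Re_le_normc _) _; apply: le_trans (supp_iter _ _ sf w1) _; exact: TT.
  have m1 : 1 <= k.*2.+1%:R :> R by rewrite (ler_nat _ 1).
  rewrite /= in h1; set mm := k.*2.+1%:R in h1 h3 h4 m1.
  set Y := Re (f (iter k (tp w w) h')) in h1 h5.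
  have h6 : mm * ((1 - x) / 2) <= mm * (t * Y + C k * t ^+ 2).
    have : C k * t ^+ 2 <= mm * (C k * t ^+ 2).
      by rewrite ler_peMl // mulr_ge0 ?sqr_ge0.
    rlra.
  rewrite ler_pM2l in h6; last by rlra.
  have h7 := ler_wpM2l (ltW t0) h5; rlra.
have tel j : (j <= n)%N -> j%:R * ((1 - x) / 2) <=
    t * (Re (f c') - Re (f (iter j (tp w w) c'))) + t ^+ 2 * (j%:R * C1 + \sum_(k < j) C k).
  elim: j => [_|j IH jn]; first by rewrite big_ord0 /= subrr !mul0r addr0 !mulr0 addr0.
  have := IH (ltnW jn); have := step j jn; rewrite big_ord_recr -natr1 /=; rlra.
have := tel n (leqnn n); rewrite -/CS.
have f1 : Re (f c') <= gam by apply: le_trans (supp_Re _ sf) c'b.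
have f2 : - gam <= Re (f (iter n (tp w w) c')).
  have := le_trans (supp_iter n c' sf w1) c'b => /(le_trans (abs_Re_le _)).
  by rewrite ler_norml => /andP[].
have tX2 : t * X <= 2 * (1 - x).
  have : rho - 1 = rho * (1 - x) by rnra.
  have : rho <= 2 by rlra.
  have : 0 <= 1 - x by rlra.
  rnra.
have := ler_wpM2l (ltW np) tX2; rewrite -/C' => j1 j2.
have f3 : Re (f c') - Re (f (iter n (tp w w) c')) <= 2 * gam by rlra.
have j4 := ler_wpM2l (ltW t0) f3.
have j3 : t * (n%:R * X) <= t * (8 * gam + 4 * C' * t).
  clear -j1 j2 j4; rlra.
by rewrite ler_pM2l in j3.
Qed.

Lemma supp_T_id f z c : supp N f z -> N z = 1 -> f (tp z z c) = f c.
Proof.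
move=> sf z1; have [lf _ _] := sf.
have h d : Re (f (tp z z d)) = Re (f d).
  apply/eqP; rewrite eq_le; apply/andP; split.
    have := supp_T_le (- d) sf z1; rewrite (lfunB lf) (tpNr J) !(lfunN lf) ReB !ReN; rlra.
  have := supp_T_le d sf z1; rewrite (lfunB lf) ReB; rlra.
apply: complex_ext; first exact: h.
have := h ('i *: c); rewrite (tpZr J) !(lfunZ lf) !ReM /=; rlra.
Qed.

Lemma supp_Q f z c : supp N f z -> f (tp z c z) = ((N z) ^+ 2)%:C * conjc (f c).
Proof.
move=> sf; have [z0|z0] := eqVneq (N z) 0.
  have -> : z = 0 by apply: (N_eq0 HN); rewrite z0.
  by have [lf _ _] := sf; rewrite (tp0l J) (lfun0 lf) (N0 HN) expr0n mul0r.
have zp : 0 < N z by rewrite lt_neqAle eq_sym z0 N_ge0.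
pose u := (N z)^-1%:C *: z.
have u1 : N u = 1 by rewrite NZp ?invr_ge0 ?N_ge0 // mulVf.
have su : supp N f u by apply: (supp_scale HN) => //; rewrite invr_ge0 N_ge0.
have [lf _ _] := sf.
have -> : tp z c z = ((N z) ^+ 2)%:C *: tp u c u.
  rewrite /u !tpE !scalerA -!rmorphM.
  have -> : N z ^+ 2 * ((N z)^-1 / N z) = 1 by field.
  by rewrite rmorph1 scale1r.
rewrite (lfunZ lf); congr (_ * _).
by rewrite (supp_form J _ _ su) (tpS c) (supp_T_id c su u1).
Qed.

End Support.

(** * Tangent fields and positivity *)

Section Flow.
Variables (R : realType) (V : lmodType R[i]) (N : V -> R).
Variables (tp : V -> V -> V -> V) (K : R).
Hypothesis J : jb_axioms N tp K.
Let HN := jb_banach J.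
Local Notation N_ge0 := (N_ge0 HN).
Local Notation NZ := (NZ HN).
Local Notation NZp := (NZp HN).
Local Notation ND := (ND HN).
Local Notation NB := (NB HN).
Local Notation NN := (NN HN).
Local Notation tpE := (tpE J).
Local Notation tpS := (jb_sym J).
Local Notation K_ge0 := (K_ge0 J).
Local Notation K_ge1 := (K_ge1 J).

(** Eliminating {x,z,{x,y,x}} between two instances of the Jordan identity leaves three times the
    claim. *)
Lemma triple_commute x y z : tp x y (tp x z x) = tp x (tp y x z) x.
Proof.
have e1 := jb_jordan J x y x z x; have e2 := jb_jordan J x z x y x.
rewrite (tpS (tp x y x)) in e1; rewrite (tpS (tp x z x)) (tpS z x y) in e2.
set A := tp x y (tp x z x) in e1 e2 *; set B := tp x z (tp x y x) in e1 e2.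
set C := tp x (tp y x z) x in e1 e2 *.
have n3 : (3%:R : R[i]) != 0 by rewrite pnatr_eq0.
have e3 : 3%:R *: A = 3%:R *: C.
  transitivity (4%:R *: A - A); first by lmod R V.
  rewrite {2}e1 e2; lmod R V.
by rewrite -[A](scalerK n3) e3 scalerK.
Qed.

(* The vector field [z |-> c - {z,c,z}] is tangent to the unit sphere, so an Euler step
   leaves the unit ball by an amount of second order only. *)
Lemma flow_step : exists C : R, 1 <= C /\ forall z c (h e : R),
  N c <= 1 -> 0 <= h -> h <= 1 -> 0 <= e -> e <= 1 -> N z <= 1 + e ->
  N (z + h%:C *: (c - tp z c z)) <= 1 + e + C * (h * e + h ^+ 2).
Proof.
have K0 := K_ge0; have K1 := K_ge1.
pose kap := 1 + 4 * K; pose s := 4 + kap.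
pose C0 := 2 * K * ((3 + kap) * kap) + K * (kap * kap).
have kap0 : 1 <= kap by rewrite /kap; rlra.
have C00 : 0 <= C0 by rewrite /C0; rnra.
exists (s + s * kap + C0); split; first by rewrite /s; rnra.
move=> z c h e c1 h0 h1 e0 e1 ze.
pose k := c - tp z c z; rewrite -/k; pose w := z + h%:C *: k; rewrite -/w.
have kk : N k <= kap.
  have i1 : N (tp z c z) <= K * (2 * 1 * 2) by apply: (tp_bound J) => //; rlra.
  by apply: le_trans (NB _ _) _; rewrite /kap; rlra.
have [rho1|rho1] := leP (N w) 1.
  apply: le_trans rho1 _; have : 0 <= (s + s * kap + C0) * (h * e + h ^+ 2).
    by rewrite mulr_ge0 //; [rewrite /s; rnra | rnra].
  rlra.
have [f sf] := exists_supp HN w; have [lf cf fw] := sf.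
pose rho := N w; rewrite -/rho in rho1 fw *.
have rho2 : rho <= 1 + e + h * kap.
  apply: le_trans (ND _ _) _; rewrite (NZp _ h0); apply: lerD => //; exact: ler_wpM2l.
have ez : tp z c z = tp w c w - h%:C *: (tp w c k + tp w c k) + (h ^+ 2)%:C *: tp k c k.
  have -> : z = w - h%:C *: k by rewrite /w addrK.
  move: w {rho fw sf rho1 rho2 kk} (k) => w k'.
  by rewrite !tpE (tpS k' c w) rmorphXn; lmod R V.
have rk : rho <= 3 + kap by rnra.
have i2 : N (tp w c k) <= K * ((3 + kap) * 1 * kap) by apply: (tp_bound J).
have i3 : N (tp k c k) <= K * (kap * 1 * kap) by apply: (tp_bound J).
have r2 := supp_Re (tp w c k) sf; have r3 := supp_Re (- tp k c k) sf.
rewrite (lfunN lf) ReN NN in r3.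
have r4 : Re (f z) <= 1 + e by apply: le_trans (supp_Re _ sf) ze.
have r5 : Re (f c) <= 1 by apply: le_trans (supp_Re _ sf) c1.
have r6 : - 1 <= Re (f c).
  by have := supp_Re (- c) sf; rewrite (lfunN lf) ReN NN; rlra.
have ek : f k = f c - f (tp z c z) by rewrite /k (lfunB lf).
have := congr1 (@complex.Re R) fw; rewrite {1}/w (lfunD lf) (lfunZ lf) ek ez.
rewrite (lfunD lf) (lfunB lf) !(lfunZ lf) (lfunD lf) (supp_Q J _ sf) -/rho.
rewrite !(ReD, ReN, ReMr) Re_conj ReR.
set fc := Re (f c) in r5 r6 *; set fz := Re (f z) in r4 *.
set p := Re (f (tp w c k)) in r2 *; set q := Re (f (tp k c k)) in r3 *.
move=> er.
(* By [supp_Q] at [w] the first-order term is fc (1 - rho^2), which the excess rho - 1 alone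
   controls. *)
have hd : rho = fz + h * (fc * (1 - rho ^+ 2)) + h ^+ 2 * (2 * p) - h ^+ 3 * q by rewrite -[LHS]er; ring.
have d1 : fc * (1 - rho ^+ 2) <= rho ^+ 2 - 1.
  have : 0 <= rho ^+ 2 - 1 by rnra.
  rnra.
have h3 : h ^+ 3 <= h ^+ 2 by rewrite exprS; have := sqr_ge0 h; rnra.
have h30 : 0 <= h ^+ 3 by rewrite exprn_ge0.
have j1 : h * (fc * (1 - rho ^+ 2)) <= h * ((rho - 1) * s).
  apply: ler_wpM2l => //; apply: le_trans d1 _.
  have -> : rho ^+ 2 - 1 = (rho - 1) * (rho + 1) by ring.
  by apply: ler_wpM2l; rewrite /s; rlra.
have j2 : h * ((rho - 1) * s) <= h * ((e + h * kap) * s).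
  apply: ler_wpM2l => //; apply: ler_wpM2r; rewrite /s; rlra.
have j3 : h ^+ 2 * (2 * p) <= h ^+ 2 * (2 * K * ((3 + kap) * kap)).
  by apply: ler_wpM2l; [exact: sqr_ge0 | rlra].
have j4 : - (h ^+ 3 * q) <= h ^+ 2 * (K * (kap * kap)).
  have : h ^+ 3 * (- q) <= h ^+ 3 * (K * (kap * kap)) by apply: ler_wpM2l => //; rlra.
  have : 0 <= K * (kap * kap) by rewrite !mulr_ge0 //; rlra.
  rnra.
have j5 : 0 <= (s * kap + C0) * (h * e) by rewrite !mulr_ge0 //; rewrite /s; rnra.
have j6 : 0 <= s * h ^+ 2 by rewrite mulr_ge0 ?sqr_ge0 // /s; rlra.
rewrite [leLHS]hd; rewrite /C0 in j5 *; move: kap s j1 j2 j3 j4 j5 j6 {hd C00 C0 kap0 kk rho2 rk i2 i3} => kap s j1 j2 j3 j4 j5 j6.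
clear -r4 j1 j2 j3 j4 j5 j6; rlra.
Qed.

Lemma mul_pred_rec n : (n.+1 * n = n * n.-1 + 2 * n)%N.
Proof. by case: n => // n; rewrite /=; lia. Qed.

(** After n steps of length s the norm exceeds one by order n s^2 only, whereas the second-order
    displacement along {u,c,k} is n(n-1) s^2. This discrepancy decides a sign in [supp_pos]. *)
Lemma euler_steps u c : N u = 1 -> N c <= 1 -> exists C : R, 0 <= C /\
  forall n, exists D d : R, [/\ 0 <= D, 0 < d & forall s : R, 0 < s -> s <= d ->
    exists v r, [/\ N v <= 1 + (2 * n%:R) * C * s ^+ 2, N r <= D * s ^+ 3 &
      v = u + (n%:R * s)%:C *: (c - tp u c u)
        - ((n * n.-1)%N%:R * s ^+ 2)%:C *: tp u c (c - tp u c u) + r]].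
Proof.
move=> u1 c1; have [C [C1 flow]] := flow_step; exists C; have C0 : 0 <= C by rlra.
set k := c - tp u c u; set p := tp u c k.
have K0 := K_ge0.
have kk : N k <= 1 + K.
  have i1 : N (tp u c u) <= K * (1 * 1 * 1) by apply: (tp_bound J) => //; rewrite u1.
  by apply: le_trans (NB _ _) _; rlra.
have pp : N p <= K * (1 + K).
  have i1 : N p <= K * (1 * 1 * (1 + K)) by apply: (tp_bound J) => //; rewrite u1.
  rlra.
split=> //; elim=> [|n [D [d [D0 d0 IH]]]].
  exists 0, 1; split=> //; try rlra.
  move=> s s0 s1; exists u, 0; split.
  - by rewrite mulr0 !mul0r addr0 u1.
  - by rewrite (N0 HN) mul0r.
  - by rewrite !mul0r !scale0r addr0 subr0 addr0.
pose B := (n * n.-1)%N%:R * (K * (1 + K)) + D.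
have B0 : 0 <= B by rewrite addr_ge0 // !mulr_ge0 ?ler0n //; rlra.
pose kk' := 1 + K.
pose B' := n%:R ^+ 2 * (K * (kk' * 1 * kk')) + 2 * (K * (1 * 1 * B))
  + 2 * (n%:R * (K * (kk' * 1 * B))) + K * (B * 1 * B).
have kk'0 : 0 <= kk' by rewrite /kk'; rlra.
have n0 : 0 <= n%:R :> R by rewrite ler0n.
have B'0 : 0 <= B'.
  by rewrite /B' !addr_ge0 // !mulr_ge0 // ?sqr_ge0 //; rlra.
pose d' := Num.min (Num.min d 1) ((2 * n%:R * C + 1)^-1).
have nC0 : 0 < 2 * n%:R * C + 1 by have := mulr_ge0 n0 C0; rlra.
have d'0 : 0 < d' by rewrite !lt_min d0 ltr01 invr_gt0.
exists (D + B'), d'; split=> //; first exact: addr_ge0.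
move=> s s0; rewrite !le_min => /andP[/andP[sd s1] sC].
have snC : s * (2 * n%:R * C + 1) <= 1 by rewrite -ler_pdivlMr // mul1r.
have [v [r [Nv Nr ev]]] := IH s s0 sd.
have s2 : 0 <= s ^+ 2 by rewrite sqr_ge0.
have s3 : 0 <= s ^+ 3 by rewrite exprn_ge0 // ltW.
pose q := - ((n * n.-1)%N%:R * s ^+ 2)%:C *: p + r.
have Nq : N q <= B * s ^+ 2.
  apply: le_trans (ND _ _) _; rewrite -rmorphN (NZr HN) normrN ger0_norm; last by rewrite mulr_ge0 ?ler0n.
  rewrite /B mulrDl; apply: lerD.
    by rewrite mulrAC ler_wpM2r // ler_wpM2l ?ler0n.
  apply: le_trans Nr _; apply: ler_wpM2l => //; rewrite exprS; rnra.
have ev' : v = u + (n%:R * s)%:C *: k + q by rewrite ev /q -/k -/p; lmod R V.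
pose G := (n%:R ^+ 2 * s ^+ 2)%:C *: tp k c k + (tp u c q + tp u c q)
  + (n%:R * s)%:C *: (tp k c q + tp k c q) + tp q c q.
have NG : N G <= B' * s ^+ 2.
  have ul : N u <= 1 by rewrite u1.
  have i1 : N (tp k c k) <= K * (kk' * 1 * kk') by apply: (tp_bound J).
  have i2 : N (tp u c q) <= K * (1 * 1 * (B * s ^+ 2)) by apply: (tp_bound J).
  have i3 : N (tp k c q) <= K * (kk' * 1 * (B * s ^+ 2)) by apply: (tp_bound J).
  have i4 : N (tp q c q) <= K * ((B * s ^+ 2) * 1 * (B * s ^+ 2)) by apply: (tp_bound J).
  have a1 : N ((n%:R ^+ 2 * s ^+ 2)%:C *: tp k c k) <= n%:R ^+ 2 * s ^+ 2 * (K * (kk' * 1 * kk')).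
    have nn : 0 <= n%:R ^+ 2 * s ^+ 2 :> R by rewrite mulr_ge0 // sqr_ge0.
    by rewrite (NZp _ nn); exact: ler_wpM2l.
  have a2 := ND (tp u c q) (tp u c q).
  have a3 : N ((n%:R * s)%:C *: (tp k c q + tp k c q)) <= n%:R * (2 * (K * (kk' * 1 * (B * s ^+ 2)))).
    rewrite NZp; last by rewrite mulr_ge0 // ltW.
    apply: le_trans (_ : n%:R * N (tp k c q + tp k c q) <= _).
      by rewrite ler_wpM2r ?N_ge0 //; rnra.
    apply: ler_wpM2l => //; apply: le_trans (ND _ _) _; rlra.
  have a4 : s ^+ 2 * s ^+ 2 <= s ^+ 2.
    by rewrite -[leRHS]mul1r ler_wpM2r // expr_le1 // ltW.
  have a5 : K * ((B * s ^+ 2) * 1 * (B * s ^+ 2)) <= K * (B * 1 * B) * s ^+ 2.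
    have -> : K * ((B * s ^+ 2) * 1 * (B * s ^+ 2)) = K * (B * 1 * B) * (s ^+ 2 * s ^+ 2) by ring.
    by apply: ler_wpM2l => //; rewrite !mulr_ge0.
  rewrite /G; apply: le_trans (ND _ _) _; apply: le_trans (lerD (ND _ _) (lexx _)) _.
  apply: le_trans (lerD (lerD (ND _ _) (lexx _)) (lexx _)) _; rewrite /B'; rlra.
exists (v + s%:C *: (c - tp v c v)), (r - s%:C *: G); split.
- have e1 : 2 * n%:R * C * s ^+ 2 <= 1.
    have : 2 * n%:R * C * s <= 1 by rlra.
    have : 0 <= 2 * n%:R * C * s by rewrite !mulr_ge0 // ltW.
    by rewrite expr2; rnra.
  have e0 : 0 <= 2 * n%:R * C * s ^+ 2 by apply: mulr_ge0 => //; rewrite !mulr_ge0.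
  apply: le_trans (flow v c s _ c1 (ltW s0) s1 e0 e1 Nv) _.
  rewrite -addrA lerD2l -natr1.
  have : s * (2 * n%:R * C * s ^+ 2) <= s ^+ 2.
    have -> : s * (2 * n%:R * C * s ^+ 2) = (s * (2 * n%:R * C)) * s ^+ 2 by ring.
    by rewrite -[leRHS]mul1r ler_wpM2r //; rlra.
  rnra.
- apply: le_trans (NB _ _) _; rewrite (NZp _ (ltW s0)) mulrDl; apply: lerD => //.
  have -> : B' * s ^+ 3 = s * (B' * s ^+ 2) by ring.
  by apply: ler_wpM2l => //; exact: ltW.
- have -> : tp v c v = tp u c u + (2 * (n%:R * s))%:C *: p + G.
    rewrite ev' /G /p; move: (k) (q) => k' q'.
    by rewrite !tpE (tpS k' c u) (tpS q' c u) (tpS q' c k') !(rmorphM, rmorphXn, rmorph_nat); lmod R V.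
  rewrite ev -/k -/p /k -[n.+1%:R]natr1 /=; move: (tp u c u) (p) (G) => x1 x2 x3.
  have -> : (n.+1 * n)%N%:R = (n * n.-1)%N%:R + 2 * n%:R :> R.
    by rewrite -natrM -natrD mul_pred_rec.
  by rewrite !(rmorphM, rmorphD, rmorphXn, rmorph_nat, rmorph1); lmod R V.
Qed.

(** Along Euler steps from [v] the first-order term has no real part under [f], so the growth bound
    forces Re f{v,e,k} >= 0, that is, Re f{e,v,e} <= Re f{e,e,v}. Replacing e by ie changes the sign
    of the left side only, and the two inequalities add up. *)
Lemma supp_pos f u c : supp N f u -> 0 <= Re (f (tp c c u)).
Proof.
move=> sf0.
have [u0|u0] := eqVneq (N u) 0.
  have -> : u = 0 by apply: (N_eq0 HN); rewrite u0.
  by have [lf _ _] := sf0; rewrite (tp0r J) (lfun0 lf).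
have up : 0 < N u by rewrite lt_neqAle eq_sym u0 N_ge0.
suff main v d : supp N f v -> N v = 1 -> N d <= 1 -> 0 <= Re (f (tp d d v)).
  have [lf _ _] := sf0.
  pose a := (N c + 1)^-1; have c1 : 0 < N c + 1 by have := N_ge0 c; rlra.
  have a0 : 0 < a by rewrite invr_gt0.
  have := main ((N u)^-1%:C *: u) (a%:C *: c).
  have -> : tp (a%:C *: c) (a%:C *: c) ((N u)^-1%:C *: u) = (a * (a * (N u)^-1))%:C *: tp c c u.
    by rewrite !tpE !rmorphM; lmod R V.
  rewrite (lfunZ lf) ReMr => h.
  have : 0 <= (a * (a * (N u)^-1)) * Re (f (tp c c u)).
    apply: h.
    - by apply: (supp_scale HN) => //; rewrite invr_ge0 ltW.
    - by rewrite NZp ?mulVf // invr_ge0 N_ge0.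
    - by rewrite (NZp _ (ltW a0)) /a mulrC ler_pdivrMr //; rlra.
  by rewrite pmulr_rge0 // !mulr_gt0 ?invr_gt0.
move=> sf v1 d1; have [lf cf fv] := sf.
have key e : N e <= 1 -> 0 <= Re (f (tp v e (e - tp v e v))).
  move=> e1; set k := e - tp v e v; set X := Re (f (tp v e k)).
  have fk : Re (f k) = 0.
    by rewrite /k (lfunB lf) ReB (supp_Q J _ sf) v1 expr1n mul1r Re_conj subrr.
  rewrite leNgt; apply/negP => X0.
  have [C [C0 eul]] := euler_steps v1 e1.
  have bd n : n%:R * (- X) <= 2 * C.
    have [D [dd [D0 d0 st]]] := eul n.+1.
    have n0 : 0 < n.+1%:R :> R by rewrite ltr0n.
    suff : (n.+1 * n)%N%:R * (- X) <= 2 * n.+1%:R * C.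
      rewrite natrM -mulrA (_ : 2 * n.+1%:R * C = n.+1%:R * (2 * C)) ?ler_pM2l //; ring.
    apply: (@le_eps_near _ _ _ D dd) => // s s0 sd.
    have [w [r [Nw Nr ew]]] := st s s0 sd.
    have := le_trans (supp_Re w sf) Nw; rewrite ew -/k /=.
    rewrite (lfunD lf) (lfunB lf) (lfunD lf) !(lfunZ lf) !(ReD, ReN, ReMr) fv v1 fk ReR -/X.
    have := supp_Re (- r) sf; rewrite (lfunN lf) ReN NN => i1 i2.
    have s2 : 0 < s ^+ 2 by rewrite exprn_gt0.
    rewrite -(ler_pM2l s2).
    have i3 : s ^+ 2 * (2 * n.+1%:R * C + D * s) = 2 * n.+1%:R * C * s ^+ 2 + D * s ^+ 3 by ring.
    have i4 : s ^+ 2 * ((n.+1 * n)%N%:R * - X) = - ((n.+1 * n)%N%:R * s ^+ 2 * X) by ring.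
    rewrite i3 i4; rlra.
  have nX : 0 < - X by rlra.
  have [n hn] := archi (2 * C / - X).
  by move: hn; rewrite ltr_pdivrMr // => hn; have := bd n; rlra.
have key2 e : N e <= 1 -> Re (f (tp e v e)) <= Re (f (tp e e v)).
  move=> e1; have := key e e1; rewrite (tpDr J) (tpNr J) triple_commute.
  by rewrite (lfunB lf) ReB (supp_Q J _ sf) v1 expr1n mul1r Re_conj (tpS v e e); rlra.
have h1 := key2 d d1.
have := key2 ('i *: d); rewrite NZ normc_i mul1r => /(_ d1).
rewrite !(tpZl J) !(tpZr J) (tpZm J) !scalerA !(lfunZ lf).
have -> : ('i * 'i : R[i]) = -1 by rewrite -expr2 sqr_i.
have -> : ('i * conjc 'i : R[i]) = 1 by apply: complex_ext => /=; rlra.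
by rewrite mulN1r mul1r ReN; rlra.
Qed.

End Flow.

Section Powers.
Variable R : realType.

Lemma pow_lin_le (a : R) n : 0 <= a -> n%:R * a <= 1 / 2 -> (1 + a) ^+ n <= 1 + 2 * (n%:R * a).
Proof.
move=> a0; elim: n => [|n IH]; first by rewrite expr0 mul0r mulr0 addr0.
rewrite -natr1 mulrDl mul1r => h.
have na : 0 <= n%:R * a by rewrite mulr_ge0.
have {}IH := IH ltac:(rlra).
rewrite exprS; apply: le_trans (_ : (1 + a) * (1 + 2 * (n%:R * a)) <= _).
  by apply: ler_wpM2l => //; rlra.
have : a * (n%:R * a) <= a * (1 / 2) by apply: ler_wpM2l => //; rlra.
rlra.
Qed.

End Powers.

(** * Cartan uniqueness *)

Section Cartan.
Variables (R : realType) (V : lmodType R[i]) (N : V -> R).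
Hypothesis HN : cbanach N.
Local Notation N_ge0 := (N_ge0 HN).
Local Notation NZ := (NZ HN).
Local Notation ND := (ND HN).
Local Notation NB := (NB HN).

(** Let f norm w = u + T u and write T u = T w - T(T u). Dissipativity applies at [w], and the rest
    is of second order. *)
Lemma diss_step (T : V -> V) (k : R) u : 0 <= k -> lop T -> bop N T k ->
  (forall u f, supp N f u -> Re (f (T u)) <= 0) -> N (u + T u) <= (1 + k ^+ 2) * N u.
Proof.
move=> k0 lT bT dT; set w := u + T u.
have [f sf] := exists_supp HN w; have [lf cf fw] := sf.
have ew : T u = T w - T (T u) by rewrite /w (lopD lT) addrK.
have := congr1 (@complex.Re R) fw; rewrite {1}/w (lfunD lf) ew (lfunB lf) !(ReD, ReN) ReR => <-.
have i1 := supp_Re u sf; have i2 := dT _ _ sf.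
have i3 := supp_Re (- T (T u)) sf; rewrite (lfunN lf) ReN (NN HN) in i3.
have i4 : N (T (T u)) <= k * (k * N u) by apply: le_trans (bT _) _; exact: ler_wpM2l.
rewrite mulrDl mul1r expr2 -mulrA; rlra.
Qed.

Lemma binomial_op (T : V -> V) (c : R[i]) n u : lop T ->
  iter n (fun v => v + c *: T v) u = \sum_(i < n.+1) ('C(n, i)%:R * c ^+ i) *: iter i T u.
Proof.
move=> lT; elim: n => [|n IH].
  by rewrite big_ord_recl big_ord0 /= expr0 mulr1 scale1r addr0.
rewrite iterS IH (lop_sum lT n.+1 (fun i => ('C(n, i)%:R * c ^+ i) *: iter i T u)).
rewrite big_ord_recl [RHS]big_ord_recl /= -addrA; congr (_ + _).
  by rewrite !bin0.
rewrite [RHS](eq_bigr (fun i : 'I_n.+1 => ('C(n, i.+1)%:R * c ^+ i.+1) *: iter i.+1 T u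
   + ('C(n, i)%:R * c ^+ i.+1) *: iter i.+1 T u)); last first.
  by move=> i _; rewrite /bump /= add1n binS natrD mulrDl scalerDl.
rewrite big_split /= scaler_sumr; congr (_ + _).
  rewrite [RHS]big_ord_recr /= bin_small // mul0r scale0r addr0.
  by apply: eq_bigr => i _.
apply: eq_bigr => i _; rewrite (lopZ lT) scalerA exprS; congr (_ *: _); ring.
Qed.

(** The weight w^(jn) equals w^(-j), since w has order n + 1; it annihilates every degree from 0 to
    n except degree one. *)
Lemma root_average (T : V -> V) (c : R[i]) n u (w : R[i]) : lop T -> (0 < n)%N ->
  n.+1.-primitive_root w ->
  \sum_(j < n.+1) (w ^+ j) ^+ n *: iter n (fun v => v + (c * w ^+ j) *: T v) u
  = (n.+1%:R * (n%:R * c)) *: T u.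
Proof.
move=> lT n0 pw.
under eq_bigr => j _ do rewrite (binomial_op _ _ _ lT) scaler_sumr.
rewrite exchange_big /=.
under eq_bigr => i _.
  under eq_bigr => j _.
    rewrite scalerA (_ : _ * _ = 'C(n, i)%:R * c ^+ i * (w ^+ j) ^+ (n + i)); last first.
      by rewrite exprMn exprD; ring.
    over.
  rewrite -scaler_suml -mulr_sumr (root_sum _ pw).
  over.
have n1 : (1 < n.+1)%N by [].
rewrite (bigD1 (Ordinal n1)) //= big1 ?addr0; last first.
  move=> i; rewrite -val_eqE /= => i1.
  have -> : (n.+1 %| n + i)%N = false.
    apply/negP => /dvdnP [q e]; move: (ltn_ord i) i1 n0 e.
    by move: (nat_of_ord i) => k; case: q => [|[|q]]; nia.
  by rewrite mulr0 scale0r.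
by rewrite addn1 dvdnn bin1 expr1; congr (_ *: _); ring.
Qed.

Lemma cauchy_first (T : V -> V) (c : R) n u (B : R) : lop T -> (0 < n)%N -> 0 <= c ->
  (forall ze, normc ze = 1 -> N (iter n (fun v => v + (c%:C * ze) *: T v) u) <= B) ->
  n%:R * c * N (T u) <= B.
Proof.
move=> lT n0 c0 hB; have [w pw] := @prim_root_ex R n.+1 isT.
have w1 := prim_normc (ltn0Sn n) pw.
have m0 : 0 < n.+1%:R :> R by rewrite ltr0n.
have e := root_average c%:C u lT n0 pw.
rewrite -(ler_pM2l m0).
have -> : n.+1%:R * (n%:R * c * N (T u)) = N ((n.+1%:R * (n%:R * c%:C)) *: T u).
  rewrite NZ !normcM -![_%:R]/(_%:R) -!(rmorph_nat (real_complex R)) !normcR !ger0_norm //; ring.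
rewrite -e; apply: le_trans (N_sum HN n.+1 (fun j => (w ^+ j) ^+ n *: iter n (fun v => v + (c%:C * w ^+ j) *: T v) u)) _.
rewrite mulr_natl -[n.+1 in leRHS]card_ord -sumr_const; apply: ler_sum => j _.
by rewrite NZ !normcX w1 !expr1n mul1r; apply: hB; rewrite normcX w1 expr1n.
Qed.

(** For |t| = p/q the power (1 + t S)^q has norm at most 2 once q is large, while its linear
    coefficient has norm p |S u| at [u]. Averaging over complex phases isolates that coefficient,
    and p is arbitrary. *)
Lemma linear_cartan (S : V -> V) (C : R) : lop S -> 0 <= C ->
  (forall t u, normc t <= 1 -> N (u + t *: S u) <= (1 + C * normc t ^+ 2) * N u) ->
  forall u, S u = 0.
Proof.
move=> lS C0 h u; apply: (N_eq0 HN); rewrite leNgt; apply/negP => Su.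
have [p hp] := archi (2 * N u / N (S u)).
have [q hq] := archi (2 * (C * p%:R ^+ 2 + p%:R)).
have p0 : 0 <= p%:R :> R by [].
have cp0 : 0 <= C * p%:R ^+ 2 by rewrite mulr_ge0 ?sqr_ge0.
have q0 : 0 < q%:R :> R by rlra.
have qn : (0 < q)%N by rewrite -(ltr0n R).
pose c : R := p%:R / q%:R.
have c0 : 0 <= c by rewrite divr_ge0.
have c1 : c <= 1 by rewrite ler_pdivrMr // mul1r; rlra.
have qc : q%:R * c = p%:R by rewrite /c mulrC divfK ?gt_eqF.
have a0 : 0 <= C * c ^+ 2 by rewrite mulr_ge0 ?sqr_ge0.
have nc : q%:R * (C * c ^+ 2) <= 1 / 2.
  have -> : q%:R * (C * c ^+ 2) = (C * p%:R ^+ 2) / q%:R.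
    by rewrite -qc; field; rewrite gt_eqF.
  by rewrite ler_pdivrMr //; rlra.
have : q%:R * c * N (S u) <= 2 * N u.
  apply: (cauchy_first lS qn c0) => ze z1.
  apply: le_trans (_ : (1 + C * c ^+ 2) ^+ q * N u <= _); last first.
    by apply: ler_wpM2r (N_ge0 _) _ _ _; apply: le_trans (pow_lin_le a0 nc) _; rlra.
  elim: (q) => [|m IH]; first by rewrite expr0 mul1r.
  rewrite iterS exprS -mulrA.
  have nn : normc (c%:C * ze) = c by rewrite normcM z1 mulr1 normcR ger0_norm.
  apply: le_trans (h _ _ _) _; first by rewrite nn.
  rewrite nn; apply: ler_wpM2l => //; rlra.
rewrite qc; move: hp; rewrite ltr_pdivrMr //; rlra.
Qed.

(** Vector-valued polynomials, generated so that no degree has to be carried along; the last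
    constructor closes them under pointwise equality. *)
Inductive vpoly : (R[i] -> V) -> Prop :=
| vpoly_mono k v : vpoly (fun t => t ^+ k *: v)
| vpoly_add f g : vpoly f -> vpoly g -> vpoly (fun t => f t + g t)
| vpoly_ext f g : (forall t, f t = g t) -> vpoly f -> vpoly g.

Lemma vpoly_cst v : vpoly (fun=> v).
Proof. by apply: vpoly_ext (vpoly_mono 0 v) => t; rewrite expr0 scale1r. Qed.

Lemma vpoly_shift c f : vpoly f -> vpoly (fun t => (t * c) *: f t).
Proof.
elim=> {f} [k v|f g _ hf _ hg|f g e _ h].
- by apply: vpoly_ext (vpoly_mono k.+1 (c *: v)) => t; rewrite exprSr !scalerA; congr (_ *: _); ring.
- by apply: vpoly_ext (vpoly_add hf hg) => t; rewrite scalerDr.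
- by apply: vpoly_ext h => t; rewrite e.
Qed.

Section Bilinear.
Variable b : V -> V -> V.
Hypothesis lb1 : forall y, lop (b^~ y).
Hypothesis lb2 : forall x, lop (b x).

Lemma vpoly_bil f g : vpoly f -> vpoly g -> vpoly (fun t => b (f t) (g t)).
Proof.
move=> hf hg; elim: hf => {f} [k v|f f' _ h1 _ h2|f f' e _ h].
- elim: hg => {g} [l w|g g' _ h1 _ h2|g g' e _ h].
  + apply: vpoly_ext (vpoly_mono (k + l) (b v w)) => t.
    by rewrite (lopZ (lb1 _)) (lopZ (lb2 _)) scalerA exprD.
  + by apply: vpoly_ext (vpoly_add h1 h2) => t; rewrite (lopD (lb2 _)).
  + by apply: vpoly_ext h => t; rewrite e.
- by apply: vpoly_ext (vpoly_add h1 h2) => t; rewrite (lopD (lb1 _)).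
- by apply: vpoly_ext h => t; rewrite e.
Qed.

End Bilinear.

(** With n + 2 roots the weight w^(-j) selects the degrees congruent to one modulo n + 2; for large
    n no monomial of t^2 f(t) has such a degree. *)
Lemma vpoly_average f : vpoly f -> exists d : nat, forall n (w c : R[i]), (d <= n)%N ->
  n.+2.-primitive_root w ->
  \sum_(j < n.+2) (w ^+ j) ^+ n.+1 *: ((c * w ^+ j) ^+ 2 *: f (c * w ^+ j)) = 0.
Proof.
elim=> {f} [k v|f g _ [d hd] _ [d' hd']|f g e _ [d h]].
- exists k.+1 => n w c kn pw.
  under eq_bigr => j _.
    rewrite !scalerA (_ : _ * _ = c ^+ k.+2 * (w ^+ j) ^+ (n.+1 + k.+2)); last first.
      by rewrite !exprMn !exprD !exprS expr0; ring.
    over.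
  rewrite -scaler_suml -mulr_sumr (root_sum _ pw).
  have -> : (n.+2 %| n.+1 + k.+2)%N = false.
    apply/negP => /dvdnP [q e]; move: kn e; case: q => [|[|q]]; nia.
  by rewrite mulr0 scale0r.
- exists (maxn d d') => n w c; rewrite geq_max => /andP[h1 h2] pw.
  under eq_bigr => j _ do rewrite !scalerDr.
  by rewrite big_split /= hd // hd' // addr0.
- exists d => n w c h1 pw; rewrite -[RHS](h n w c h1 pw).
  by apply: eq_bigr => j _; rewrite e.
Qed.

Lemma vpoly_cauchy (f : R[i] -> V) v0 v1 (c B : R) : vpoly f -> 0 <= c ->
  (forall t, normc t = c -> N (v0 + t *: v1 + t ^+ 2 *: f t) <= B) -> c * N v1 <= B.
Proof.
move=> hf c0 hB; have [d hd] := vpoly_average hf.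
have [w pw] := @prim_root_ex R d.+2 isT.
have w1 := prim_normc (ltn0Sn d.+1) pw.
have m0 : 0 < d.+2%:R :> R by rewrite ltr0n.
pose G j : V := (w ^+ j) ^+ d.+1 *: (v0 + (c%:C * w ^+ j) *: v1 + (c%:C * w ^+ j) ^+ 2 *: f (c%:C * w ^+ j)).
have e : \sum_(j < d.+2) G j = (d.+2%:R * c%:C) *: v1.
  rewrite /G; under eq_bigr => j _ do rewrite !scalerDr.
  rewrite !big_split /= hd // addr0 -scaler_suml (root_sum _ pw).
  have -> : (d.+2 %| d.+1)%N = false by apply/negP => /dvdn_leq; lia.
  rewrite scale0r add0r.
  under eq_bigr => j _.
    rewrite scalerA (_ : _ * _ = c%:C * (w ^+ j) ^+ (d.+2)); last by rewrite [_ ^+ d.+2]exprS; ring.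
    over.
  by rewrite -scaler_suml -mulr_sumr (root_sum _ pw) dvdnn mulrC.
rewrite -(ler_pM2l m0).
have -> : d.+2%:R * (c * N v1) = N ((d.+2%:R * c%:C) *: v1).
  rewrite NZ !normcM -!(rmorph_nat (real_complex R)) !normcR !ger0_norm //; ring.
rewrite -e; apply: le_trans (N_sum HN d.+2 G) _.
rewrite mulr_natl -[d.+2 in leRHS]card_ord -sumr_const; apply: ler_sum => j _.
rewrite /G NZ !normcX w1 !expr1n mul1r; apply: hB.
by rewrite normcM normcX w1 expr1n mulr1 normcR ger0_norm.
Qed.

(** The nonlinear analogue: q steps of size t/q along z |-> b(z,z) give a polynomial in t with
    linear coefficient b(z,z), bounded by 2 on |t| = p once q is large. Cauchy's estimate yields p
    |b(z,z)| <= 2 for every p. *)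
Lemma quadratic_cartan (b : V -> V -> V) (C : R) :
  (forall y, lop (b^~ y)) -> (forall x, lop (b x)) -> 0 <= C ->
  (forall t z, normc t <= 1 -> N z <= 1 -> N (z + t *: b z z) <= 1 + C * normc t ^+ 2) ->
  forall z, b z z = 0.
Proof.
move=> lb1 lb2 C0 h.
(* The iterates leave the unit ball slightly, so the hypothesis is first rescaled to radius [a]. *)
have hs (a : R) t z : 1 <= a -> normc t * a <= 1 -> N z <= a ->
    N (z + t *: b z z) <= a * (1 + C * (normc t * a) ^+ 2).
  move=> a1 ta za; have a0 : 0 < a by rlra.
  have an : (a%:C : R[i]) != 0.
    by rewrite -(rmorph0 (real_complex R)) (inj_eq (@complexI R)) gt_eqF.
  have -> : z + t *: b z z = a%:C *: (a^-1%:C *: z + (t * a%:C) *: b (a^-1%:C *: z) (a^-1%:C *: z)).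
    rewrite (lopZ (lb1 _)) (lopZ (lb2 _)) scalerDr !scalerA -!rmorphM mulfV ?gt_eqF // scale1r.
    rewrite rmorphM fmorphV; congr (_ + _ *: _); field.
    exact: an.
  rewrite (NZp HN _ (ltW a0)); apply: ler_wpM2l; first exact: ltW.
  have nt : normc (t * a%:C) = normc t * a by rewrite normcM normcR ger0_norm // ltW.
  rewrite -nt; apply: h; first by rewrite nt.
  by rewrite (NZp HN) ?invr_ge0 ?(ltW a0) // mulrC ler_pdivrMr ?mul1r.
suff small z : N z <= 1 -> b z z = 0.
  move=> z; pose a := (N z + 1)^-1; have z1 : 0 < N z + 1 by have := N_ge0 z; rlra.
  have a0 : 0 < a by rewrite invr_gt0.
  have sz : N (a%:C *: z) <= 1 by rewrite (NZp HN _ (ltW a0)) /a mulrC ler_pdivrMr //; rlra.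
  move/eqP: (small _ sz); rewrite (lopZ (lb1 _)) (lopZ (lb2 _)) scalerA scaler_eq0.
  rewrite -rmorphM -(rmorph0 (real_complex R)) (inj_eq (@complexI R)) mulf_eq0 orbb gt_eqF //=; exact: eqP.
move=> z1; apply: (N_eq0 HN); rewrite leNgt; apply/negP => Su.
have [p hp] := archi (2 / N (b z z)).
have [q hq] := archi (2 * (4 * C * p%:R ^+ 2 + p%:R)).
have p0 : 0 <= p%:R :> R by [].
have cp0 : 0 <= 4 * C * p%:R ^+ 2 by rewrite !mulr_ge0 ?sqr_ge0.
have q0 : 0 < q%:R :> R by rlra.
pose c : R := p%:R / q%:R.
have c0 : 0 <= c by rewrite divr_ge0.
have c1 : c * 2 <= 1 by rewrite mulrAC ler_pdivrMr // mul1r; rlra.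
have qc : q%:R * c = p%:R by rewrite /c mulrC divfK ?gt_eqF.
pose al := 4 * C * c ^+ 2.
have a0 : 0 <= al by rewrite !mulr_ge0 ?sqr_ge0.
have nc : q%:R * al <= 1 / 2.
  have -> : q%:R * al = (4 * C * p%:R ^+ 2) / q%:R.
    by rewrite /al -qc; field; rewrite gt_eqF.
  by rewrite ler_pdivrMr //; rlra.
pose step (t : R[i]) v : V := v + (t / q%:R) *: b v v.
pose ph j t := iter j (step t) z.
have pol j : exists f, vpoly f /\ forall t, ph j t = z + t *: ((j%:R / q%:R) *: b z z) + t ^+ 2 *: f t.
  elim: j => [|j [f [vf e]]].
    exists (fun=> 0); split; first exact: vpoly_cst.
    by move=> t; rewrite /ph /= mul0r scale0r !scaler0 !addr0.
  set v1 := (_ *: _) in e.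
  pose g t := v1 + t *: f t.
  have vg : vpoly g.
    apply: vpoly_add; first exact: vpoly_cst.
    by apply: vpoly_ext (vpoly_shift 1 vf) => t; rewrite mulr1.
  exists (fun t => f t + ((q%:R^-1 *: b z (g t)) + (q%:R^-1 *: b (g t) z) + (t * q%:R^-1) *: b (g t) (g t))).
  split.
    apply: vpoly_add => //; apply: vpoly_add; last exact/vpoly_shift/vpoly_bil.
    apply: vpoly_add.
      by apply: vpoly_ext (vpoly_bil lb1 lb2 (vpoly_cst (q%:R^-1 *: z)) vg) => t; rewrite (lopZ (lb1 _)).
    by apply: vpoly_ext (vpoly_bil lb1 lb2 vg (vpoly_cst (q%:R^-1 *: z))) => t; rewrite (lopZ (lb2 _)).
  move=> t; rewrite /ph iterS -/(ph j t) /step.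
  have eg : t *: g t = t *: v1 + t ^+ 2 *: f t by rewrite /g; lmod R V.
  have -> : ph j t = z + t *: g t by rewrite e eg addrA.
  move: (g t) eg => G eg.
  rewrite (lopD (lb1 _)) !(lopD (lb2 _)) !(lopZ (lb1 _)) !(lopZ (lb2 _)) {1}eg.
  rewrite /v1 -[j.+1%:R]natr1 mulrDl mul1r.
  move: (b z z) (b z G) (b G z) (b G G) (f t) => B0 B1 B2 B3 F; lmod R V.
have bd j t : normc t = p%:R -> (j <= q)%N -> N (ph j t) <= (1 + al) ^+ j.
  move=> nt; elim: j => [|j IH] jq; first by rewrite expr0.
  have {}IH := IH (ltnW jq).
  have ntq : normc (t / q%:R) = c.
    rewrite normcM nt -(rmorph_nat (real_complex R)) -fmorphV normcR ger0_norm // invr_ge0 //.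
  have j2 : (1 + al) ^+ j <= 2.
    have : j%:R * al <= q%:R * al by rewrite ler_wpM2r // ler_nat ltnW.
    move=> i1; apply: le_trans (pow_lin_le a0 _) _; rlra.
  have j1 : 1 <= (1 + al) ^+ j by rewrite exprn_ege1 //; rlra.
  rewrite /ph iterS -/(ph j t) /step.
  apply: le_trans (hs _ _ _ j1 _ IH) _.
    by rewrite ntq; apply: le_trans (_ : c * 2 <= _) => //; exact: ler_wpM2l.
  rewrite ntq [leRHS]exprSr; apply: ler_wpM2l; first rlra.
  set X := (1 + al) ^+ j in j1 j2 *.
  have X2 : X ^+ 2 <= 4 by rnra.
  have Cc : 0 <= C * c ^+ 2 by rewrite mulr_ge0 // sqr_ge0.
  have := ler_wpM2l Cc X2; rewrite /al; rlra.
have [f [vf e]] := pol q.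
have : p%:R * N ((q%:R / q%:R) *: b z z) <= 2.
  apply: (vpoly_cauchy (v0 := z) vf p0) => t nt; rewrite -e.
  apply: le_trans (bd _ _ nt (leqnn q)) _; apply: le_trans (pow_lin_le a0 nc) _; rlra.
rewrite mulfV ?scale1r; last by rewrite pnatr_eq0 -lt0n -(ltr0n R).
move: hp; rewrite ltr_pdivrMr //; rlra.
Qed.

End Cartan.

Lemma conjcN (R : realType) (z : R[i]) : conjc (- z) = - conjc z.
Proof. by case: z. Qed.

(** * Contractions generated by [L(x,x)] *)

Section Dissipation.
Variables (R : realType) (V : lmodType R[i]) (N : V -> R).
Variables (tp : V -> V -> V -> V) (K : R).
Hypothesis J : jb_axioms N tp K.
Let HN := jb_banach J.
Local Notation N_ge0 := (N_ge0 HN).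
Local Notation NZ := (NZ HN).
Local Notation NZp := (NZp HN).
Local Notation ND := (ND HN).
Local Notation NB := (NB HN).
Local Notation NN := (NN HN).
Local Notation tpE := (tpE J).
Local Notation tpS := (jb_sym J).
Local Notation K_ge0 := (K_ge0 J).
Local Notation K_ge1 := (K_ge1 J).

Lemma bop_sq x v : N x <= 1 -> N (tp x x v) <= K * N v.
Proof.
move=> x1; have := tp_bound J x1 x1 (lexx (N v)); have -> : 1 * 1 * N v = N v by ring.
by [].
Qed.

(** L(x,x) is real and nonnegative under norming functionals, so - ze L(x,x) is dissipative and
    [diss_step] applies. *)
Lemma contraction x ze u : N x <= 1 -> 0 <= Re ze ->
  N (u - ze *: tp x x u) <= (1 + (normc ze * K) ^+ 2) * N u.
Proof.
move=> x1 z0; have K0 := K_ge0; rewrite -scaleNr.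
apply: (@diss_step _ _ _ HN (fun v => - ze *: tp x x v)).
- by rewrite mulr_ge0 ?normc_ge0.
- by move=> a y v; rewrite (lop_tp J); lmod R V.
- by move=> v; rewrite NZ normcN -mulrA; apply: ler_wpM2l; [exact: normc_ge0 | exact: bop_sq].
- move=> v f sf; have [lf _ _] := sf.
  rewrite (lfunZ lf) ReM (jb_herm J _ sf) ReN mulr0 subr0 mulNr oppr_le0.
  by rewrite mulr_ge0 //; exact: (supp_pos J).
Qed.

(** By the hermitian form, L(a,d) - L(d,a) is purely imaginary under norming functionals. *)
Lemma skew_step a d (h : R) z :
  N (z + h%:C *: (tp a d z - tp d a z)) <= (1 + (`|h| * (2 * (K * (N a * N d)))) ^+ 2) * N z.
Proof.
have K0 := K_ge0.
apply: (@diss_step _ _ _ HN (fun v => h%:C *: (tp a d v - tp d a v))).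
- by rewrite !mulr_ge0 ?N_ge0.
- by move=> c y v; rewrite !(lop_tp J); lmod R V.
- move=> v; rewrite (NZr HN) -mulrA; apply: ler_wpM2l => //.
  apply: le_trans (NB _ _) _.
  have := bop_tp J a d v; have := bop_tp J d a v; rewrite (mulrC (N d)); rlra.
- move=> v f sf; have [lf _ _] := sf.
  by rewrite (lfunZ lf) ReMr (lfunB lf) ReB (supp_form J _ _ sf) Re_conj subrr mulr0.
Qed.

(** Quantitative form of [supp_Q]. One flow step of length h from [u] gains h Re(th (f y - conj
    f{u,y,u})), and this gain can only be paid from the deficit h^2 and the flow error C h^2. *)
Lemma approx_support : exists C : R, 0 <= C /\ forall f u (h : R) y,
  lfun f -> (forall v, normc (f v) <= N v) -> N u <= 1 -> 0 < h -> h <= 1 ->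
  1 - h ^+ 2 <= Re (f u) -> N y <= 1 -> normc (f y - conjc (f (tp u y u))) <= C * h.
Proof.
have [C [C1 flow]] := flow_step J; exists (1 + C); split; first rlra.
move=> f u h y lf cf u1 h0 h1 fu y1; apply: normc_rotP => th th1.
have y1' : N (th *: y) <= 1 by rewrite NZ th1 mul1r.
have u1' : N u <= 1 + 0 by rewrite addr0.
have := flow u (th *: y) h 0 y1' (ltW h0) h1 (lexx 0) ler01 u1'.
rewrite mulr0 add0r addr0 => i1.
have := le_trans (le_trans (Re_le_normc _) (cf _)) i1.
rewrite (lfunD lf) (lfunZ lf) (lfunB lf) (tpZm J) !(lfunZ lf) ReD ReMr => i2.
have -> : Re (th * (f y - conjc (f (tp u y u)))) = Re (th * f y - conjc th * f (tp u y u)).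
  by rewrite mulrBr !ReB; congr (_ - _); rewrite -Re_conj conjcM conjcK.
have i3 : h * Re (th * f y - conjc th * f (tp u y u)) <= h * ((1 + C) * h) by rlra.
by rewrite ler_pM2l // in i3.
Qed.

(* [A] approximates [exp (- t ze L(x,x))]: it is a product of [l] factors [1 - (t ze / l) L(x,x)]. *)
Lemma semigroup x ze (t e : R) : N x <= 1 -> normc ze = 1 -> 0 <= Re ze ->
  0 <= t -> t * K <= 1 -> 0 < e ->
  exists A : V -> V, [/\ lop A, bop N A (1 + e) & forall v,
    N (A v - v + (t%:C * ze) *: tp x x v - ((t ^+ 2 / 2)%:C * ze ^+ 2) *: tp x x (tp x x v))
      <= (2 * (t * K) ^+ 3 + e) * N v].
Proof.
move=> x1 z1 zr t0 tK e0; have K0 := K_ge0; have K1 := K_ge1.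
have [l hl] := archi (2 + 2 / e).
have ie0 : 0 < 2 / e by rewrite divr_gt0.
have l0 : 0 < l%:R :> R by rlra.
have le : 2 < e * l%:R by rewrite mulrC -ltr_pdivrMr //; rlra.
pose s := t / l%:R.
have s0 : 0 <= s by rewrite divr_ge0 // ltW.
have ls : l%:R * s = t by rewrite mulrC divfK // gt_eqF.
pose T := tp x x; have lT : lop T := lop_tp J x x.
have bT v : N (T v) <= K * N v by exact: bop_sq.
pose G v := v - (s%:C * ze) *: T v.
have lG : lop G by move=> a y v; rewrite /G lT; lmod R V.
have ns : normc (s%:C * ze) = s by rewrite normcM z1 mulr1 normcR ger0_norm.
pose al := (s * K) ^+ 2; have al0 : 0 <= al by exact: sqr_ge0.
have bG : bop N G (1 + al).
  move=> v; rewrite /G /al -{2}ns; apply: contraction => //.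
  by rewrite ReMr mulr_ge0.
have lal : l%:R * al * l%:R <= 1.
  have -> : l%:R * al * l%:R = (t * K) ^+ 2 by rewrite /al -ls; ring.
  by rewrite expr_le1 // mulr_ge0.
have lal2 : l%:R * al <= 1 / l%:R by rewrite ler_pdivlMr.
have l12 : 1 / l%:R <= 1 / 2 :> R by rewrite ler_pdivrMr //; rlra.
have l1e : 2 * (1 / l%:R) <= e by rewrite mulrA mulr1 ler_pdivrMr //; rlra.
have pj j : (j <= l)%N -> (1 + al) ^+ j <= 1 + 2 * (1 / l%:R).
  move=> jl; have : j%:R * al <= l%:R * al by rewrite ler_wpM2r // ler_nat.
  move=> i1; apply: le_trans (pow_lin_le al0 _) _; rlra.
have bGj j v : (j <= l)%N -> N (iter j G v) <= 2 * N v.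
  move=> jl; apply: le_trans (bop_iter j _ bG v) _; first rlra.
  apply: ler_wpM2r; first exact: N_ge0.
  apply: le_trans (pj j jl) _; rlra.
pose c := s%:C * ze.
have Nc v : N (c *: T v) <= s * K * N v.
  by rewrite NZ ns -mulrA; apply: ler_wpM2l.
have r1 j v : (j <= l)%N -> N (iter j G v - v) <= j%:R * (2 * (s * K)) * N v.
  elim: j => [|j IH] jl; first by rewrite subrr (N0 HN) !mul0r.
  have -> : iter j.+1 G v - v = (iter j G v - v) - c *: T (iter j G v) by rewrite iterS /G -/c; lmod R V.
  apply: le_trans (NB _ _) _.
  have i1 := IH (ltnW jl); have i2 := Nc (iter j G v); have i3 := bGj j v (ltnW jl).
  have sK : 0 <= s * K by rewrite mulr_ge0.
  have := ler_wpM2l sK i3; rewrite -natr1; rlra.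
have r2 j v : (j <= l)%N -> N (iter j G v - v + (j%:R * c) *: T v) <= j%:R ^+ 2 * (2 * (s * K) ^+ 2) * N v.
  elim: j => [|j IH] jl; first by rewrite /= subrr !mul0r scale0r addr0 (N0 HN) expr0n /= !mul0r.
  have -> : iter j.+1 G v - v + (j.+1%:R * c) *: T v =
     (iter j G v - v + (j%:R * c) *: T v) - c *: T (iter j G v - v).
    by rewrite iterS /G -/c (lopB lT) -[j.+1%:R]natr1; lmod R V.
  apply: le_trans (NB _ _) _.
  have i1 := IH (ltnW jl); have i2 := Nc (iter j G v - v); have i3 := r1 j v (ltnW jl).
  have sK : 0 <= s * K by rewrite mulr_ge0.
  have := ler_wpM2l sK i3.
  have : 0 <= (j%:R + 1) * (2 * (s * K) ^+ 2) * N v.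
    by rewrite !mulr_ge0 ?N_ge0 ?sqr_ge0 // addr_ge0.
  rewrite -natr1; move: (j%:R) (s * K) (N v) i1 i2 => j' sk nv i1 i2; rlra.
have r3 j v : (j <= l)%N -> N (iter j G v - v + (j%:R * c) *: T v
    - ((j%:R * (j%:R - 1) / 2) * c ^+ 2) *: T (T v)) <= j%:R ^+ 3 * (2 * (s * K) ^+ 3) * N v.
  elim: j => [|j IH] jl.
    by rewrite /= subrr !mul0r scale0r addr0 scale0r subr0 (N0 HN) expr0n /= !mul0r.
  have -> : iter j.+1 G v - v + (j.+1%:R * c) *: T v - ((j.+1%:R * (j.+1%:R - 1) / 2) * c ^+ 2) *: T (T v) =
     (iter j G v - v + (j%:R * c) *: T v - ((j%:R * (j%:R - 1) / 2) * c ^+ 2) *: T (T v))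
       - c *: T (iter j G v - v + (j%:R * c) *: T v).
    rewrite iterS /G -/c (lopD lT) (lopB lT) (lopZ lT) -[j.+1%:R]natr1.
    move: (T (iter j G v)) (iter j G v) (T v) (T (T v)) => a1 a2 a3 a4.
    have -> : (j%:R + 1) * (j%:R + 1 - 1) / 2 = j%:R * (j%:R - 1) / 2 + j%:R :> R[i] by field.
    move: (j%:R * (j%:R - 1) / 2) => q; lmod R V.
  apply: le_trans (NB _ _) _.
  have i1 := IH (ltnW jl); have i2 := Nc (iter j G v - v + (j%:R * c) *: T v).
  have i3 := r2 j v (ltnW jl).
  have sK : 0 <= s * K by rewrite mulr_ge0.
  have := ler_wpM2l sK i3.
  have : 0 <= (2 * j%:R ^+ 2 + 3 * j%:R + 1) * (2 * (s * K) ^+ 3) * N v.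
    by rewrite !mulr_ge0 ?N_ge0 ?exprn_ge0 // !addr_ge0 ?mulr_ge0 ?exprn_ge0.
  rewrite -natr1; move: (j%:R) (s * K) (N v) i1 i2 => j' sk nv i1 i2; rlra.
exists (iter l G); split.
- exact: lop_iter.
- move=> v; apply: le_trans (bop_iter l _ bG v) _; first rlra.
  apply: ler_wpM2r; first exact: N_ge0.
  apply: le_trans (pj l (leqnn l)) _; rlra.
move=> v; have := r3 l v (leqnn l).
have lC : l%:R * c = t%:C * ze.
  by rewrite /c mulrA -(rmorph_nat (real_complex R)) -rmorphM ls.
have lC2 : (l%:R * (l%:R - 1) / 2) * c ^+ 2 = (t ^+ 2 / 2)%:C * ze ^+ 2 - (t ^+ 2 / 2 / l%:R)%:C * ze ^+ 2.
  rewrite -mulrBl -rmorphB /c exprMn mulrA; congr (_ * _).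
  have -> : (l%:R * (l%:R - 1) / 2 : R[i]) = (l%:R * (l%:R - 1) / 2)%:C.
    by rewrite !(rmorphM, fmorphV, rmorphB, rmorph1, rmorph_nat).
  rewrite -rmorphXn -rmorphM -ls; congr (_%:C); field; exact: lt0r_neq0.
rewrite lC lC2 -/T => i1.
set W := (X in N X <= _) in i1.
have -> : iter l G v - v + (t%:C * ze) *: T v - ((t ^+ 2 / 2)%:C * ze ^+ 2) *: T (T v)
  = W - ((t ^+ 2 / 2 / l%:R)%:C * ze ^+ 2) *: T (T v) by rewrite /W; lmod R V.
apply: le_trans (NB _ _) _; rewrite mulrDl; apply: lerD.
  have -> : 2 * (t * K) ^+ 3 = l%:R ^+ 3 * (2 * (s * K) ^+ 3) by rewrite -ls; ring.
  exact: i1.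
have tt0 : 0 <= t ^+ 2 / 2 / l%:R by rewrite !divr_ge0 ?sqr_ge0 // ltW.
rewrite NZ normcM normcX z1 expr1n mulr1 normcR ger0_norm //.
apply: le_trans (_ : t ^+ 2 / 2 / l%:R * (K * (K * N v)) <= _).
  by apply: ler_wpM2l => //; apply: le_trans (bT _) _; exact: ler_wpM2l.
have -> : t ^+ 2 / 2 / l%:R * (K * (K * N v)) = ((t * K) ^+ 2) * (1 / 2 * (1 / l%:R)) * N v.
  by field; exact: lt0r_neq0.
apply: ler_wpM2r; first exact: N_ge0.
have tk2 : (t * K) ^+ 2 <= 1 by rewrite expr_le1 // mulr_ge0.
have q0 : 0 <= 1 / 2 * (1 / l%:R) :> R by rewrite mulr_ge0 // divr_ge0 // ltW.
have := ler_wpM2r q0 tk2; rlra.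
Qed.

Lemma unit_sqrt (w : R[i]) : normc w = 1 -> exists ze : R[i], [/\ normc ze = 1, 0 <= Re ze & ze ^+ 2 = w].
Proof.
move=> w1; have e := sqrtCK w; set q := sqrtC w in e.
have q1 : normc q = 1.
  have : normc q ^+ 2 = 1 by rewrite -normcX e.
  by move=> /eqP; rewrite sqrf_eq1 => /orP[/eqP //|/eqP h]; have := normc_ge0 q; rlra.
have [h|h] := leP 0 (Re q); first by exists q.
by exists (- q); rewrite normcN ReN sqrrN; split=> //; rlra.
Qed.

End Dissipation.

(** * Functionals that nearly vanish at [{x,x,z}] nearly vanish after [L(x,x)] *)

Section MomentArithmetic.
Variable R : realType.

Lemma moment_arith1 (C K kap t s : R) : 0 <= C -> 1 <= K -> K <= kap -> 0 <= t -> t <= s ->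
  2 * (C * (4 * kap * s * t)) + 4 * kap * t ^+ 2 * (1 + K) <= t * ((8 * (C * kap) + 8 * kap ^+ 3) * s).
Proof.
move=> C0 K1 kK t0 ts.
have k3 : kap <= kap ^+ 2 by rewrite expr2 ler_peMl //; rlra.
have k33 : kap ^+ 2 <= kap ^+ 3 by rewrite ler_weXn2l //; rlra.
have kk1 : kap * (1 + K) <= 2 * kap ^+ 3.
  have : kap * K <= kap * kap by apply: ler_wpM2l => //; rlra.
  rewrite -expr2; rlra.
have tt : t ^+ 2 * (kap * (1 + K)) <= (t * s) * (2 * kap ^+ 3).
  apply: ler_pM => //; [exact: sqr_ge0 | by rewrite mulr_ge0 //; rlra |].
  by rewrite expr2; apply: ler_wpM2l.
rlra.
Qed.

Lemma moment_arith2 (C K kap t s : R) : 1 <= K -> K <= kap -> 0 <= t -> t <= s ->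
  C * (4 * kap * s * t) + K * (10 * kap * t ^+ 2 + 36 * kap ^+ 2 * t ^+ 2)
    <= t * ((4 * (C * kap) + 46 * kap ^+ 3) * s).
Proof.
move=> K1 kK t0 ts; have t2 := sqr_ge0 t.
have k3 : kap <= kap ^+ 2 by rewrite expr2 ler_peMl //; rlra.
have kk1 : K * (10 * kap * t ^+ 2 + 36 * kap ^+ 2 * t ^+ 2) <= 46 * kap ^+ 3 * t ^+ 2.
  apply: le_trans (_ : kap * (46 * kap ^+ 2 * t ^+ 2) <= _); last by rewrite [kap ^+ 3]exprS; rlra.
  have kt : kap * t ^+ 2 <= kap ^+ 2 * t ^+ 2 by apply: ler_wpM2r.
  have k0t : 0 <= kap * t ^+ 2 by rewrite mulr_ge0 //; rlra.
  apply: ler_pM => //; rlra.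
have tt : kap ^+ 3 * t ^+ 2 <= kap ^+ 3 * (t * s).
  apply: ler_wpM2l; first by rewrite exprn_ge0 //; rlra.
  by rewrite expr2; apply: ler_wpM2l.
rlra.
Qed.

End MomentArithmetic.

Section Moments.
Variables (R : realType) (V : lmodType R[i]) (N : V -> R).
Variables (tp : V -> V -> V -> V) (K : R).
Hypothesis J : jb_axioms N tp K.
Let HN := jb_banach J.
Local Notation N_ge0 := (N_ge0 HN).
Local Notation NZ := (NZ HN).
Local Notation NZp := (NZp HN).
Local Notation ND := (ND HN).
Local Notation NB := (NB HN).
Local Notation NN := (NN HN).
Local Notation tpE := (tpE J).
Local Notation tpS := (jb_sym J).
Local Notation K_ge0 := (K_ge0 J).
Local Notation K_ge1 := (K_ge1 J).

Section SmallMoment.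
Variables (x z : V) (P : V -> R[i]) (s t kap : R).
Hypothesis x1 : N x <= 1.
Hypothesis sP : supp N P z.
Hypothesis z1 : N z = 1.
Hypothesis kapE : kap = K ^+ 3.
Hypothesis tE : t = s ^+ 2.
Hypothesis s0 : 0 < s.
Hypothesis sk : s * (4 * kap) <= 1.
Hypothesis Pz : Re (P (tp x x z)) <= s ^+ 4.
Local Notation T := (tp x x).

Lemma kap_facts : [/\ 1 <= kap, K <= kap & K ^+ 2 <= kap].
Proof.
have K1 := K_ge1; rewrite kapE; split; rewrite ?expr1 //; first by rewrite exprn_ege1.
  by rewrite -{1}(expr1 K) ler_weXn2l.
by rewrite ler_weXn2l.
Qed.

Lemma t_facts : [/\ 0 < t, t <= 1, t * K <= 1 & s <= 1].
Proof.
have [k1 kK _] := kap_facts; have K1 := K_ge1.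
have s1' : s <= s * kap by rewrite ler_peMr // ltW.
have sk' := sk; have s0' := s0; have s1 : s <= 1 by rlra.
rewrite tE; split=> //; first by rewrite exprn_gt0.
  by rewrite expr_le1 // ltW.
have : s * K <= s * kap by rewrite ler_wpM2l // ltW.
move=> i; rewrite expr2 -mulrA; apply: le_trans (_ : s * K <= 1); last rlra.
by rewrite ler_piMl // mulr_ge0 //; rlra.
Qed.

Lemma tK3 : (t * K) ^+ 3 = kap * t ^+ 3. Proof. by rewrite exprMn mulrC kapE. Qed.

(** Choose a unit ze with Re ze >= 0 whose square makes P(T T z) positive. Then Re P(A z) <= 1 + t^3
    bounds the quadratic term by the linear one, which is at most t^3, and by cubic errors. *)
Lemma second_moment : normc (P (T (T z))) <= 10 * kap * t.
Proof.
have [k1 kK k2] := kap_facts; have [t0 t1 tK _] := t_facts; have [lP cP Pz1] := sP.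
set p2 := P _.
have [th [th1 thp]] := phase p2.
have [ze [z1' zr z2]] := unit_sqrt th1.
have t3 : 0 < t ^+ 3 by rewrite exprn_gt0.
have [A [lA bA rA]] := semigroup J x1 z1' zr (ltW t0) tK t3.
have i1 := le_trans (le_trans (Re_le_normc _) (cP _)) (bA z).
have := rA z; set W := (X in N X <= _) => i2.
have i3 := le_trans (abs_Re_le (P W)) (le_trans (cP W) i2).
have eA : A z = W + z - (t%:C * ze) *: tp x x z + ((t ^+ 2 / 2)%:C * ze ^+ 2) *: tp x x (tp x x z).
  by rewrite /W; lmod R V.
have P1 := jb_herm J x sP.
have p1 := supp_pos J x sP.
have zr1 : Re ze <= 1 by rewrite -z1' Re_le_normc.
have {}i1 := i1; rewrite eA (lfunD lP) (lfunB lP) (lfunD lP) !(lfunZ lP) Pz1 z1 -/p2 z2 in i1.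
rewrite -!mulrA thp !(ReD, ReN) !ReMr !ReR ReM P1 mulr0 subr0 !mulr1 in i1.
rewrite z1 tK3 ler_norml in i3; case/andP: i3 => i3 _.
have Pz' := Pz; set p := Re (P (tp x x z)) in Pz' p1 i1.
have i5 : t * (Re ze * p) <= t * t ^+ 2.
  apply: ler_wpM2l; first exact: ltW.
  have -> : t ^+ 2 = s ^+ 4 by rewrite tE; ring.
  by apply: le_trans Pz'; rewrite ler_piMl.
have t2 : 0 < t ^+ 2 by rewrite exprn_gt0.
rewrite -(ler_pM2l t2).
have -> : t ^+ 2 * (10 * kap * t) = 10 * kap * t ^+ 3 by ring.
have : t ^+ 3 <= kap * t ^+ 3 by rewrite ler_peMl // ltW.
rlra.
Qed.

(** [P] almost attains its norm at A z, and P after A almost attains it at z. Applying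
    [approx_support] in both situations and keeping first-order terms in t gives P(T y) close to
    conj P(T u) with u = {z,y,z}, and P{T z,y,z} close to 0; the Jordan identity for T{z,y,z} turns
    the two into smallness of P(T y). *)
Lemma small_functional (C : R) y : 0 <= C ->
  (forall f u (h : R) y, lfun f -> (forall v, normc (f v) <= N v) -> N u <= 1 -> 0 < h -> h <= 1 ->
    1 - h ^+ 2 <= Re (f u) -> N y <= 1 -> normc (f y - conjc (f (tp u y u))) <= C * h) ->
  N y <= 1 -> normc (P (T y)) <= (12 * (C * kap) + 54 * kap ^+ 3) * s.
Proof.
move=> C0 HC y1; have [k1 kK k2] := kap_facts; have [t0 t1 tK s1] := t_facts; have [lP cP Pz1] := sP.
have K0 := K_ge0; have K1 := K_ge1; have k0 : 0 <= kap by apply: le_trans k1.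
have t0' := ltW t0.
have p2 := second_moment; have sk' := sk; have s0' := s0.
have t2 : 0 < t ^+ 2 by rewrite exprn_gt0.
have t3 : 0 < t ^+ 3 by rewrite exprn_gt0.
have t32 : t ^+ 3 <= t ^+ 2 by rewrite exprS ler_piMl // ltW.
have t21 : t ^+ 2 <= t by rewrite expr2 ler_piMl // ltW.
have n1 : normc (1 : R[i]) = 1 by rewrite Normc.normc1.
have r1 : 0 <= Re (1 : R[i]) by [].
have [A [lA bA rA]] := semigroup J x1 n1 r1 (ltW t0) tK t3.
pose W v := A v - v + t%:C *: T v - (t ^+ 2 / 2)%:C *: T (T v).
have NW v : N (W v) <= 3 * kap * t ^+ 3 * N v.
  have := rA v; rewrite expr1n !mulr1 -/(W v) tK3 => i; apply: le_trans i _.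
  apply: ler_wpM2r; first exact: N_ge0.
  have : t ^+ 3 <= kap * t ^+ 3 by rewrite ler_peMl // ltW.
  rlra.
pose rho v := A v - v + t%:C *: T v.
have Nrho v : N (rho v) <= 4 * kap * t ^+ 2 * N v.
  have -> : rho v = W v + (t ^+ 2 / 2)%:C *: T (T v) by rewrite /W /rho; lmod R V.
  apply: le_trans (ND _ _) _; rewrite NZp; last rlra.
  have i1 := NW v.
  have i2 : N (T (T v)) <= K ^+ 2 * N v.
    apply: le_trans (bop_sq J _ x1) _; rewrite expr2 -mulrA; apply: ler_wpM2l => //; exact: (bop_sq J).
  have i3 : K ^+ 2 * N v <= kap * N v by apply: ler_wpM2r => //; exact: N_ge0.
  have kv : 0 <= kap * N v by rewrite mulr_ge0 ?N_ge0.
  have i4 : t ^+ 3 * (kap * N v) <= t ^+ 2 * (kap * N v) by exact: ler_wpM2r.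
  have i5 : t ^+ 2 * N (T (T v)) <= t ^+ 2 * (kap * N v) by apply: ler_wpM2l; [exact: ltW | rlra].
  have : 0 <= t ^+ 2 * (kap * N v) by rewrite mulr_ge0 // ltW.
  rlra.
have PAz : 1 - 9 * (kap * t ^+ 3) <= Re (P (A z)).
  have eA : A z = W z + z - t%:C *: T z + (t ^+ 2 / 2)%:C *: T (T z) by rewrite /W; lmod R V.
  rewrite eA (lfunD lP) (lfunB lP) (lfunD lP) !(lfunZ lP) Pz1 z1 !(ReD, ReN) !ReMr ReR.
  have i1 := le_trans (abs_Re_le (P (W z))) (le_trans (cP _) (NW z)).
  have i2 := le_trans (abs_Re_le (P (T (T z)))) p2.
  rewrite z1 mulr1 ler_norml in i1; case/andP: i1 => i1 _.
  rewrite ler_norml in i2; case/andP: i2 => i2 _.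
  have i3 : t * Re (P (T z)) <= t * t ^+ 2.
    apply: ler_wpM2l; first exact: ltW.
    have -> : t ^+ 2 = s ^+ 4 by rewrite tE; ring.
    exact: Pz.
  have i4 : t ^+ 2 * - (10 * kap * t) <= t ^+ 2 * Re (P (T (T z))) by apply: ler_wpM2l => //; exact: ltW.
  have : t ^+ 3 <= kap * t ^+ 3 by rewrite ler_peMl // ltW.
  rlra.
(* Scale: h^2 is of the order t^3 of the deficit, so after division by t there remains h/t, of order
   s. *)
pose h := 4 * kap * s ^+ 3.
have s3 : 0 < s ^+ 3 by rewrite exprn_gt0.
have h0 : 0 < h by rewrite mulr_gt0 //; rlra.
have hs : h = 4 * kap * s * t by rewrite /h tE; ring.
have h1 : h <= 1.
  rewrite hs -[leRHS]mulr1; apply: ler_pM => //; last rlra.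
  by rewrite !mulr_ge0 // ltW.
have hh : h ^+ 2 = 16 * (kap * (kap * t ^+ 3)) by rewrite /h tE; ring.
have kt3 : 0 <= kap * t ^+ 3 by rewrite mulr_ge0 //; rlra.
have kkt : kap * t ^+ 3 <= kap * (kap * t ^+ 3) by rewrite ler_peMl.
have ktt : t ^+ 3 <= kap * t ^+ 3 by rewrite ler_peMl // ltW.
pose g := (1 + t ^+ 3)^-1.
have g1 : 0 < 1 + t ^+ 3 by rlra.
have g0 : 0 < g by rewrite invr_gt0.
have gE : g * (1 + t ^+ 3) = 1 by rewrite mulVf // gt_eqF.
have g1' : g <= 1 by rewrite invf_le1 //; rlra.
have gg : 1 - g = g * t ^+ 3 by rlra.
have gt3 : g * t ^+ 3 <= t ^+ 3 by rewrite ler_piMl // ltW.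
have gPz : 1 - h ^+ 2 <= g * Re (P (A z)).
  have i1 : g * (1 - 9 * (kap * t ^+ 3)) <= g * Re (P (A z)) by apply: ler_wpM2l => //; exact: ltW.
  have i2 : g * (kap * t ^+ 3) <= kap * t ^+ 3 by rewrite ler_piMl.
  rlra.
have ts : t <= s by rewrite tE expr2 ler_piMl // ltW.
set u := tp z y z.
have zl : N z <= 1 by rewrite z1.
have Nu : N u <= K by have := tp_bound J zl y1 zl; rewrite !mulr1.
have Pu : conjc (P u) = P y by rewrite (supp_Q J _ sP) z1 expr1n mul1r conjcK.
have q1 : normc (P (T y) - conjc (P (T u))) <= (8 * (C * kap) + 8 * kap ^+ 3) * s.
  pose f1 v := g%:C * P (A v).
  have lf1 : lfun f1 by move=> a v w; rewrite /f1 lA lP; ring.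
  have cf1 v : normc (f1 v) <= N v.
    rewrite normcM normcR gtr0_norm //.
    apply: le_trans (_ : g * ((1 + t ^+ 3) * N v) <= _); last by rewrite mulrA gE mul1r.
    by apply: ler_wpM2l; [exact: ltW | exact: le_trans (cP _) (bA _)].
  have fz : 1 - h ^+ 2 <= Re (f1 z) by rewrite /f1 ReMr.
  have := HC f1 z h y lf1 cf1 zl h0 h1 fz y1; rewrite -/u /f1 conjcM conjc_real -mulrBr.
  rewrite normcM normcR gtr0_norm // => i1.
  have i2 : normc (P (A y) - conjc (P (A u))) <= 2 * (C * h).
    have Ch : 0 <= C * h by rewrite mulr_ge0 // ltW.
    have : (1 + t ^+ 3) * (g * normc (P (A y) - conjc (P (A u)))) <= (1 + t ^+ 3) * (C * h).
      by apply: ler_wpM2l => //; exact: ltW.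
    have gE' : (1 + t ^+ 3) * g = 1 by rewrite mulrC.
    rewrite [(1 + t ^+ 3) * (g * _)]mulrA gE' mul1r => i; apply: le_trans i _; apply: ler_wpM2r => //; rlra.
  have eA v : P (A v) = P v - t%:C * P (T v) + P (rho v).
    rewrite -(lfunZ lP) -(lfunB lP) -(lfunD lP); congr P; rewrite /rho; lmod R V.
  have e1 : P (A y) - conjc (P (A u)) =
     - (t%:C * (P (T y) - conjc (P (T u)))) + (P (rho y) - conjc (P (rho u))).
    by rewrite !eA conjcD conjcD conjcN conjcM conjc_real Pu; ring.
  have i3 : normc (t%:C * (P (T y) - conjc (P (T u)))) <= 2 * (C * h) + 4 * kap * t ^+ 2 * (1 + K).
    have -> : t%:C * (P (T y) - conjc (P (T u))) =
      (P (rho y) - conjc (P (rho u))) - (P (A y) - conjc (P (A u))) by rewrite e1; ring.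
    apply: le_trans (normcB _ _) _; apply: le_trans (lerD (normcB _ _) i2) _.
    rewrite normc_conj.
    have kt : 0 <= 4 * kap * t ^+ 2 by rewrite mulr_ge0 ?sqr_ge0 // mulr_ge0.
    have j1 := le_trans (cP (rho y)) (Nrho y); have j2 := le_trans (cP (rho u)) (Nrho u).
    have := ler_wpM2l kt y1; have := ler_wpM2l kt Nu; rlra.
  rewrite normcM normcR gtr0_norm // in i3.
  rewrite -(ler_pM2l t0); apply: le_trans i3 _; rewrite hs.
  exact: moment_arith1.
have q2 : normc (2 * P (tp (T z) y z)) <= (4 * (C * kap) + 46 * kap ^+ 3) * s.
  pose u1 := g%:C *: A z.
  have Nu1 : N u1 <= 1.
    rewrite /u1 (NZp _ (ltW g0)); have := bA z; rewrite z1 mulr1 => i.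
    by rewrite -gE; apply: ler_wpM2l => //; exact: ltW.
  have fu : 1 - h ^+ 2 <= Re (P u1) by rewrite /u1 (lfunZ lP) ReMr.
  have := HC P u1 h y lP cP Nu1 h0 h1 fu y1 => i1.
  pose w := u1 - z; pose r := w + t%:C *: T z.
  have Nr : N r <= 5 * kap * t ^+ 2.
    have -> : r = rho z - (1 - g)%:C *: A z by rewrite /r /w /u1 /rho rmorphB rmorph1; lmod R V.
    apply: le_trans (NB _ _) _; rewrite gg (NZr HN) ger0_norm; last by rewrite mulr_ge0 // ltW.
    have := Nrho z; rewrite z1 mulr1 => j1.
    have := bA z; rewrite z1 mulr1 => j2.
    have : g * t ^+ 3 * N (A z) <= g * t ^+ 3 * (1 + t ^+ 3).
      by apply: ler_wpM2l => //; rewrite mulr_ge0 // ltW.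
    have -> : g * t ^+ 3 * (1 + t ^+ 3) = g * (1 + t ^+ 3) * t ^+ 3 by ring.
    rewrite gE mul1r.
    have : t ^+ 2 <= kap * t ^+ 2 by rewrite ler_peMl // ltW.
    rlra.
  have Nw : N w <= 6 * kap * t.
    have -> : w = r - t%:C *: T z by rewrite /r addrK.
    apply: le_trans (NB _ _) _; rewrite (NZp _ (ltW t0)).
    have := bop_sq J z x1; rewrite z1 mulr1 => j.
    have : t * N (T z) <= t * kap by apply: ler_wpM2l; [exact: ltW | rlra].
    have : kap * t ^+ 2 <= kap * t by apply: ler_wpM2l => //; rlra.
    rlra.
  have e1 : tp u1 y u1 = u + (tp w y z + tp w y z) + tp w y w.
    have -> : u1 = z + w by rewrite /w addrC subrK.
    by rewrite /u; move: (w) => w'; rewrite !tpE (tpS z y w'); lmod R V.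
  have ez : tp w y z = tp r y z - t%:C *: tp (T z) y z.
    have -> : w = r - t%:C *: T z by rewrite /r addrK.
    by move: (r) => r'; rewrite !tpE.
  have N1 := tp_bound J Nr y1 zl; have N2 := tp_bound J Nw y1 Nw.
  pose X := tp r y z + tp r y z + tp w y w.
  have NX : N X <= K * (10 * kap * t ^+ 2 + 36 * kap ^+ 2 * t ^+ 2).
    apply: le_trans (ND _ _) _; apply: le_trans (lerD (ND _ _) (lexx _)) _; rlra.
  have e2 : t%:C * (2 * P (tp (T z) y z)) = P X + conjc (P y - conjc (P (tp u1 y u1))).
    have Pu' : conjc (P y) = P u by rewrite -Pu conjcK.
    rewrite conjcD conjcN conjcK Pu' e1 /X !(lfunD lP) ez !(lfunB lP) (lfunZ lP); ring.
  have i2 : normc (t%:C * (2 * P (tp (T z) y z))) <= C * h + K * (10 * kap * t ^+ 2 + 36 * kap ^+ 2 * t ^+ 2).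
    rewrite e2; apply: le_trans (normcD _ _) _; rewrite normc_conj.
    have := le_trans (cP X) NX; rlra.
  rewrite normcM normcR gtr0_norm // in i2.
  rewrite -(ler_pM2l t0); apply: le_trans i2 _; rewrite hs.
  exact: moment_arith2.
have idn : conjc (P (T y)) = 2 * P (tp (T z) y z) - P (T u).
  have e1 : conjc (P (T y)) = P (tp z (T y) z) by rewrite (supp_Q J _ sP) z1 expr1n mul1r.
  rewrite e1 /u (jb_jordan J x x z y z) (tpS z y (T z)) (lfunD lP) (lfunB lP); ring.
have e2 : 2 * conjc (P (T y)) = 2 * P (tp (T z) y z) + conjc (P (T y) - conjc (P (T u))).
  by rewrite conjcD conjcN conjcK idn; ring.
have : normc (2 * conjc (P (T y))) <= (12 * (C * kap) + 54 * kap ^+ 3) * s.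
  rewrite e2; apply: le_trans (normcD _ _) _; rewrite normc_conj; rlra.
rewrite normcM normc_conj.
have -> : normc (2 : R[i]) = 2 by rewrite -(rmorph_nat (real_complex R)) normcR ger0_norm.
have := normc_ge0 (P (T y)); rlra.
Qed.

End SmallMoment.

Lemma moment_small (e : R) : 0 < e -> exists d : R, 0 < d /\ forall x z P,
  N x <= 1 -> supp N P z -> N z = 1 -> Re (P (tp x x z)) <= d ->
  forall y, N y <= 1 -> normc (P (tp x x y)) <= e.
Proof.
move=> e0; have [C [C0 HC]] := approx_support J.
have K1 := K_ge1; have k1 : 1 <= K ^+ 3 by rewrite exprn_ege1.
pose D := 12 * (C * K ^+ 3) + 54 * (K ^+ 3) ^+ 3.
have D0 : 0 < D.
  have : 0 <= C * K ^+ 3 by rewrite mulr_ge0 //; rlra.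
  have : 1 <= (K ^+ 3) ^+ 3 by rewrite exprn_ege1.
  rewrite /D; rlra.
have k4 : 0 < 4 * K ^+ 3 by rlra.
pose s := Num.min (e / D) (4 * K ^+ 3)^-1.
have s0 : 0 < s by rewrite lt_min divr_gt0 // invr_gt0.
have sk : s * (4 * K ^+ 3) <= 1 by rewrite -ler_pdivlMr // mul1r ge_min lexx orbT.
have sD : D * s <= e by rewrite mulrC -ler_pdivlMr // ge_min lexx.
exists (s ^+ 4); split; first by rewrite exprn_gt0.
move=> x z P x1 sP z1 Pz y y1; apply: le_trans sD.
exact: (@small_functional x z P s (s ^+ 2) (K ^+ 3)).
Qed.

End Moments.

(** * The step operator *)

Section StepOperator.
Variables (R : realType) (V : lmodType R[i]) (N : V -> R).
Variables (tp : V -> V -> V -> V) (K : R).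
Hypothesis J : jb_axioms N tp K.
Let HN := jb_banach J.
Local Notation N_ge0 := (N_ge0 HN).
Local Notation NZ := (NZ HN).
Local Notation NZp := (NZp HN).
Local Notation ND := (ND HN).
Local Notation NB := (NB HN).
Local Notation NN := (NN HN).
Local Notation tpE := (tpE J).
Local Notation tpS := (jb_sym J).
Local Notation K_ge0 := (K_ge0 J).
Local Notation K_ge1 := (K_ge1 J).

Section Euler.
Variables (x : V) (tau : R).
Hypothesis x1 : N x <= 1.
Hypothesis tau0 : 0 <= tau.
Definition damp v := v - tau%:C *: tp x x v.
Local Notation T := (tp x x).
Local Notation F := damp.
Let lT : lop T := lop_tp J x x.
Local Notation be := (1 + (tau * K) ^+ 2).
Local Notation al := (5 * (tau * K) ^+ 2).

Lemma lop_damp : lop F.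
Proof. by move=> a y v; rewrite /damp lT; lmod R V. Qed.

Lemma damp_comm v : F (T v) = T (F v).
Proof. by rewrite /damp (lopB lT) (lopZ lT). Qed.

Lemma damp_Q v : F (tp x v x) = tp x (F v) x.
Proof. by rewrite /damp (triple_commute J) !tpE. Qed.

Lemma iter_damp_comm n v : iter n F (T v) = T (iter n F v).
Proof. by elim: n => //= n ->; rewrite damp_comm. Qed.

Lemma iter_damp_Q n v : iter n F (tp x v x) = tp x (iter n F v) x.
Proof. by elim: n => //= n ->; rewrite damp_Q. Qed.

Lemma be_ge1 : 1 <= be. Proof. by rewrite lerDl sqr_ge0. Qed.

Lemma bop_damp : bop N F be.
Proof.
move=> v; have := @contraction _ _ _ _ _ J x tau%:C v x1 tau0.
by rewrite normcR ger0_norm.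
Qed.

Lemma bop_iter_damp n : bop N (iter n F) (be ^+ n).
Proof. by apply: bop_iter bop_damp; have := be_ge1; rlra. Qed.

(** The decay of T exp(-sT) in an analytic semigroup, by a Cauchy estimate: for |ze| = 1 the product
    of [F] with 1 + tau ze T is 1 - tau (1 - ze) T up to second order, and Re(1 - ze) >= 0 keeps it
    almost contractive. *)
Lemma damp_rate n u : (0 < n)%N -> n%:R * tau * N (T (iter n F u)) <= (1 + al) ^+ n * N u.
Proof.
move=> n0; apply: (cauchy_first HN lT n0 tau0) => ze z1.
pose H v := v + (tau%:C * ze) *: T v.
have lH : lop H by move=> a y v; rewrite /H lT; lmod R V.
have cFH v : F (H v) = H (F v).
  by rewrite {1}/H (lopD lop_damp) (lopZ lop_damp) damp_comm.
have -> : iter n H (iter n F u) = iter n (fun v => F (H v)) u.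
  elim: (n) => // m IH; rewrite [RHS]iterS -IH !iterS.
  have -> : iter m H (F (iter m F u)) = F (iter m H (iter m F u)).
    by elim: (m) (iter m F u) => // k IHk v; rewrite !iterS IHk cFH.
  by rewrite cFH.
apply: (bop_iter (N := N) (T := fun v => F (H v)) n).
  by have := sqr_ge0 (tau * K); rlra.
move=> v; have K0 := K_ge0.
have -> : F (H v) = (v - (tau%:C * (1 - ze)) *: T v) - (tau%:C * (tau%:C * ze)) *: T (T v).
  by rewrite /damp /H (lopD lT) (lopZ lT); lmod R V.
apply: le_trans (NB _ _) _.
have nz : normc (tau%:C * (1 - ze)) <= 2 * tau.
  rewrite normcM normcR ger0_norm // mulrC; apply: ler_wpM2r => //.
  by apply: le_trans (normcB _ _) _; rewrite z1 Normc.normc1.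
have i1 : N (v - (tau%:C * (1 - ze)) *: T v) <= (1 + (2 * tau * K) ^+ 2) * N v.
  apply: le_trans (contraction J _ x1 _) _.
    by rewrite ReMr mulr_ge0 // ReB subr_ge0; apply: le_trans (Re_le_normc _) _; rewrite z1.
  apply: ler_wpM2r; first exact: N_ge0.
  rewrite lerD2l lerXn2r // ?nnegrE ?mulr_ge0 ?normc_ge0 //.
  by apply: ler_wpM2r.
have i2 : N ((tau%:C * (tau%:C * ze)) *: T (T v)) <= (tau * K) ^+ 2 * N v.
  rewrite NZ !normcM z1 mulr1 normcR ger0_norm //.
  have -> : (tau * K) ^+ 2 * N v = tau * tau * (K * (K * N v)) by ring.
  apply: ler_wpM2l; first exact: mulr_ge0.
  by apply: le_trans (bop_sq J _ x1) _; apply: ler_wpM2l => //; exact: (bop_sq J).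
apply: le_trans (lerD i1 i2) _.
have -> : (2 * tau * K) ^+ 2 = 4 * (tau * K) ^+ 2 by ring.
rlra.
Qed.

(** To first order in tau this is the Jordan identity for L(x,x); the middle slot enters that
    identity with the opposite sign, hence [F v] on the other side. *)
Lemma damp_triple_step a v d :
  N (tp (F a) v (F d) - F (tp a (F v) d)) <= 2 * (K ^+ 3 * tau ^+ 2) * (N a * N v * N d).
Proof.
have K0 := K_ge0.
have -> : tp (F a) v (F d) - F (tp a (F v) d) =
   (tau ^+ 2)%:C *: (tp (T a) v (T d) - T (tp a (T v) d)).
  rewrite /damp !tpE (jb_jordan J x x a v d) rmorphXn.
  move: (T (tp _ _ _)) (tp (T a) v (T d)) => a1 a2; lmod R V.
rewrite NZp ?sqr_ge0 //.
have Ta := bop_sq J a x1; have Td := bop_sq J d x1; have Tv := bop_sq J v x1.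
have i1 := tp_bound J Ta (lexx (N v)) Td.
have i2 := tp_bound J (lexx (N a)) Tv (lexx (N d)).
have i3 := le_trans (bop_sq J (tp a (T v) d) x1) (ler_wpM2l K0 i2).
have t2 := sqr_ge0 tau.
have i4 : N (tp (T a) v (T d) - T (tp a (T v) d)) <= 2 * (K ^+ 3 * (N a * N v * N d)).
  by apply: le_trans (NB _ _) _; rlra.
by have := ler_wpM2l t2 i4; rlra.
Qed.

Lemma damp_triple n a v d :
  N (tp (iter n F a) v (iter n F d) - iter n F (tp a (iter n F v) d))
    <= n%:R * be ^+ (4 * n) * (2 * (K ^+ 3 * tau ^+ 2)) * (N a * N v * N d).
Proof.
have K0 := K_ge0; have b1 := be_ge1; have b0 : 0 <= be by rlra.
set c := 2 * _; have c0 : 0 <= c by rewrite !mulr_ge0 ?exprn_ge0.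
elim: n a d => [|n IH] a d; first by rewrite /= subrr (N0 HN) !mul0r.
rewrite iterSr [iter n.+1 F d]iterSr [iter n.+1 F (tp _ _ _)]iterSr [iter n.+1 F v]iterS.
set v' := iter n F v.
have -> : tp (iter n F (F a)) v (iter n F (F d)) - iter n F (F (tp a (F v') d)) =
  (tp (iter n F (F a)) v (iter n F (F d)) - iter n F (tp (F a) v' (F d)))
  + iter n F (tp (F a) v' (F d) - F (tp a (F v') d)).
  have lI := lopB (lop_iter lop_damp n) (tp (F a) v' (F d)) (F (tp a (F v') d)).
  by rewrite lI addrA subrK.
apply: le_trans (ND _ _) _.
have Fa := bop_damp a; have Fd := bop_damp d; have Fv := bop_iter_damp n v.
have n0 := N_ge0.
have i1 : N (F a) * N v * N (F d) <= be ^+ 2 * (N a * N v * N d).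
  have -> : be ^+ 2 * (N a * N v * N d) = (be * N a) * N v * (be * N d) by ring.
  by apply: ler_pM; rewrite ?mulr_ge0 // ler_wpM2r.
have bn k : 0 <= be ^+ k by rewrite exprn_ge0.
have j1 : N (tp (iter n F (F a)) v (iter n F (F d)) - iter n F (tp (F a) v' (F d)))
   <= n%:R * be ^+ (4 * n) * c * (be ^+ 2 * (N a * N v * N d)).
  by apply: le_trans (IH _ _) _; apply: ler_wpM2l => //; rewrite !mulr_ge0.
have j2 : N (iter n F (tp (F a) v' (F d) - F (tp a (F v') d))) <= be ^+ n * (c * (be ^+ n * (N a * N v * N d))).
  apply: le_trans (bop_iter_damp _ _) _; apply: ler_wpM2l => //.
  apply: le_trans (damp_triple_step _ _ _) _; apply: ler_wpM2l => //.
  have -> : be ^+ n * (N a * N v * N d) = N a * (be ^+ n * N v) * N d by ring.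
  by apply: ler_wpM2r => //; apply: ler_wpM2l.
apply: le_trans (lerD j1 j2) _.
have Y0 : 0 <= N a * N v * N d by rewrite !mulr_ge0.
set Y := N a * N v * N d in Y0 *.
have k1 : be ^+ (4 * n) * be ^+ 2 <= be ^+ (4 * n.+1).
  by rewrite -exprD ler_weXn2l // mulnS addnC leq_add2r.
have k2 : be ^+ n * be ^+ n <= be ^+ (4 * n.+1).
  by rewrite -exprD ler_weXn2l // addnn -mul2n leq_mul.
have cY : 0 <= c * Y by rewrite mulr_ge0.
have h1 := ler_wpM2r (mulr_ge0 (ler0n R n) cY) k1.
have h2 := ler_wpM2r cY k2.
rewrite -natr1; move: (be ^+ (4 * n.+1)) (be ^+ (4 * n)) (be ^+ n) (be ^+ 2) h1 h2 => b4 b5 b6 b7 h1 h2.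
rlra.
Qed.

Lemma damp_defect (P : V -> R[i]) (e : R) n y : lfun P -> (forall w, N w <= 1 -> normc (P (T w)) <= e) ->
  be ^+ n <= 2 -> N y <= 1 -> normc (P (iter n F y - y)) <= n%:R * (tau * (2 * e)).
Proof.
move=> lP hP bn y1; have b1 := be_ge1.
have e0 : 0 <= e by apply: le_trans (normc_ge0 _) (hP 0 _); rewrite (N0 HN).
have hP2 w : N w <= 2 -> normc (P (T w)) <= 2 * e.
  move=> w2; have -> : w = 2%:C *: (2^-1%:C *: w).
    by rewrite scalerA -rmorphM mulfV ?scale1r.
  rewrite (lopZ lT) (lfunZ lP) normcM normcR ger0_norm //; apply: ler_wpM2l => //; apply: hP.
  by rewrite NZp //; rlra.
have key m : (m <= n)%N -> normc (P (iter m F y - y)) <= m%:R * (tau * (2 * e)).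
  elim: m => [|m IH] mn; first by rewrite subrr (lfun0 lP) Normc.normc0 mul0r.
  have -> : iter m.+1 F y - y = (iter m F y - y) - tau%:C *: T (iter m F y).
    by rewrite iterS {1}/damp; lmod R V.
  rewrite (lfunB lP) (lfunZ lP); apply: le_trans (normcB _ _) _.
  rewrite normcM normcR ger0_norm // -natr1 mulrDl mul1r; apply: lerD; first exact: IH (ltnW mn).
  apply: ler_wpM2l => //; apply: hP2.
  apply: le_trans (bop_iter_damp _ _) _.
  have : be ^+ m <= be ^+ n by rewrite ler_weXn2l // ltnW.
  have : 0 <= be ^+ m by rewrite exprn_ge0 //; rlra.
  have := N_ge0 y; move: (be ^+ m) (be ^+ n) bn => b2 b3; rnra.
exact: key.
Qed.

End Euler.

(** [B] is damping for total time 2S, in 2m steps. Smallness of {x,x,By} is the decay rate. The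
    half-way vector X = F^m x is small since its cube is close to F^m{x, F^m X, x}, which has
    decayed. Then {x,By,x} is close to {X,y,X}, and {By, pw x k, By} to B{y, B(pw x k), y} with B(pw
    x k) small. *)
Lemma damped_operator (de : R) : 0 < de -> de <= 1 -> exists S : R, 0 <= S /\
  forall x, N x <= 1 -> exists B : V -> V, [/\ lop B,
    (forall y, N y <= 1 -> [/\ N (B y) <= 1 + de, N (tp x x (B y)) <= de,
       N (tp x (B y) x) <= 2 * K * de &
       forall k, N (tp (B y) (pw tp x k) (B y)) <= 5 * K ^+ k.+1 * de]) &
    forall P (e : R), lfun P -> (forall w, N w <= 1 -> normc (P (tp x x w)) <= e) ->
      forall y, N y <= 1 -> normc (P (B y - y)) <= S * e].
Proof.
move=> d0 d1; have K0 := K_ge0; have K1 := K_ge1.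
have d3 : 0 < de ^+ 3 by rewrite exprn_gt0.
have d31 : de ^+ 3 <= de by rewrite exprS ler_piMr ?exprn_ile1 // ltW.
(* [S] makes the decay 1/S at most de^3/4; [m] then makes the accumulated second-order error K^3
   S^2/m at most de^3/160. *)
have [S hS] := archi (4 / de ^+ 3).
have q0 : 0 < 4 / de ^+ 3 by rewrite divr_gt0.
have S0 : 0 < S%:R :> R by rlra.
have Sd : 4 < S%:R * de ^+ 3 by rewrite -ltr_pdivrMr.
pose Z := K ^+ 3 * S%:R ^+ 2.
have Z0 : 0 <= Z by rewrite mulr_ge0 ?sqr_ge0 // exprn_ge0.
have [m hm] := archi (160 * Z / de ^+ 3).
have qz : 0 <= 160 * Z / de ^+ 3 by rewrite divr_ge0 ?mulr_ge0 // ltW.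
have m0 : 0 < m%:R :> R by rlra.
have mn : (0 < m)%N by rewrite -(ltr0n R).
have mZ : 160 * Z < m%:R * de ^+ 3 by rewrite -ltr_pdivrMr.
pose tau : R := S%:R / m%:R.
have tau0 : 0 <= tau by rewrite divr_ge0 // ltW.
have mt : m%:R * tau = S%:R by rewrite mulrC divfK // gt_eqF.
exists (4 * S%:R); split; first by rewrite mulr_ge0.
move=> x x1; pose F := damp x tau.
have lF := @lop_damp x tau.
pose al := (tau * K) ^+ 2; have al0 : 0 <= al by exact: sqr_ge0.
have mZ' : m%:R * (K ^+ 3 * tau ^+ 2) * 160 <= de ^+ 3.
  have -> : m%:R * (K ^+ 3 * tau ^+ 2) * 160 = 160 * Z / m%:R.
    by rewrite /Z -mt; field; exact: lt0r_neq0.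
  by rewrite ler_pdivrMr // [leRHS]mulrC ltW.
have K23 : K ^+ 2 <= K ^+ 3 by rewrite ler_weXn2l.
have mal : m%:R * al * 160 <= de ^+ 3.
  apply: le_trans mZ'; rewrite /al exprMn [tau ^+ 2 * _]mulrC.
  apply: ler_wpM2r => //; apply: ler_wpM2l => //; apply: ler_wpM2r => //; exact: sqr_ge0.
have mal0 : 0 <= m%:R * al by rewrite mulr_ge0.
have pw5 j : (j <= 2)%N -> (1 + 5 * al) ^+ (j * m) <= 2.
  move=> j8; have i1 : (j * m)%N%:R * (5 * al) <= 1 / 2.
    have : j%:R <= 2 :> R by rewrite ler_nat.
    rewrite natrM => jj; have : j%:R * (m%:R * al) <= 2 * (m%:R * al) by apply: ler_wpM2r.
    rlra.
  by apply: le_trans (pow_lin_le _ i1) _; rlra.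
have pw1 j : (j <= 8)%N -> (1 + al) ^+ (j * m) <= 1 + 16 * (m%:R * al).
  move=> j8; have jj : j%:R * (m%:R * al) <= 8 * (m%:R * al) by apply: ler_wpM2r => //; rewrite ler_nat.
  have i1 : (j * m)%N%:R * al <= 1 / 2 by rewrite natrM; rlra.
  by apply: le_trans (pow_lin_le _ i1) _; rewrite // natrM; rlra.
have pw2 j : (j <= 8)%N -> (1 + al) ^+ (j * m) <= 2 by move=> /pw1; rlra.
have bF j v : (j <= 8)%N -> N (iter (j * m) F v) <= 2 * N v.
  move=> j8; apply: le_trans (bop_iter_damp x1 tau0 _ _) _.
  by apply: ler_wpM2r; [exact: N_ge0 | exact: pw2].
have m1 v : N (iter m F v) <= 2 * N v by have := @bF 1%N v; rewrite mul1n; exact.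
have rate v : N (tp x x (iter (2 * m) F v)) <= 1 / S%:R * N v.
  have m20 : (0 < 2 * m)%N by rewrite muln_gt0.
  have := damp_rate x1 tau0 v m20; have -> : (2 * m)%N%:R * tau = 2 * S%:R by rewrite natrM -mulrA mt.
  have := ler_wpM2r (N_ge0 v) (pw5 2 isT) => i1 i2.
  rewrite mulrAC ler_pdivlMr // mul1r; move: (le_trans i2 i1); rlra.
pose er := m%:R * (K ^+ 3 * tau ^+ 2).
have er0 : 0 <= er by rewrite !mulr_ge0 ?exprn_ge0.
have trip1 a v d : N (tp (iter m F a) v (iter m F d) - iter m F (tp a (iter m F v) d)) <= 4 * er * (N a * N v * N d).
  apply: le_trans (damp_triple x1 tau0 m a v d) _.
  apply: ler_wpM2r; first by rewrite !mulr_ge0 ?N_ge0.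
  have := ler_wpM2l er0 (pw2 4 isT); rewrite /er -/al; rlra.
have trip2 a v d : N (tp (iter (2 * m) F a) v (iter (2 * m) F d) - iter (2 * m) F (tp a (iter (2 * m) F v) d)) <= 8 * er * (N a * N v * N d).
  apply: le_trans (damp_triple x1 tau0 (2 * m) a v d) _.
  apply: ler_wpM2r; first by rewrite !mulr_ge0 ?N_ge0.
  have := ler_wpM2l er0 (pw2 8 isT); rewrite /er -/al mulnA natrM; rlra.
have erd : 160 * er <= de ^+ 3 by rewrite /er mulrC.
have S1 : 1 / S%:R <= de ^+ 3 / 4 :> R by rewrite ler_pdivrMr //; rlra.
have it2 v : iter (2 * m) F v = iter m F (iter m F v) by rewrite mulSn mul1n iterD.
have Fx : N (iter m F x) <= de.
  suff : N (iter m F x) ^+ 3 <= de ^+ 3 by rewrite ler_pXn2r // ?nnegrE ?N_ge0 // ltW.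
  rewrite -(jb_cube J); set X := iter m F x.
  have -> : tp X X X = (tp X X X - iter m F (tp x (iter m F X) x)) + iter m F (tp x (iter m F X) x).
    by rewrite subrK.
  apply: le_trans (ND _ _) _.
  have i1 := trip1 x X x.
  have i2 : N (tp x (iter m F X) x) <= de ^+ 3 / 4.
    rewrite /X -it2 -(iter_damp_Q x tau) (iter_damp_comm x tau); apply: le_trans (rate _) _.
    apply: le_trans (_ : 1 / S%:R * 1 <= _); last by rewrite mulr1.
    by apply: ler_wpM2l => //; rewrite divr_ge0.
  have i3 := m1 (tp x (iter m F X) x).
  have i4 : N x * N X * N x <= 2.
    have := m1 x; rewrite -/X => i; have -> : 2 = 1 * 2 * 1 :> R by ring.
    by apply: ler_pM; rewrite ?mulr_ge0 ?N_ge0 //; apply: ler_pM; rewrite ?N_ge0 //; rlra.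
  have := ler_wpM2l er0 i4; rlra.
exists (iter (2 * m) F); split; first exact: lop_iter.
  move=> y y1; split.
  - apply: le_trans (bop_iter_damp x1 tau0 _ _) _; rewrite -/al.
    apply: le_trans (_ : (1 + al) ^+ (2 * m) * 1 <= _).
      by apply: ler_wpM2l => //; rewrite exprn_ge0 //; rlra.
    by rewrite mulr1; apply: le_trans (pw1 2 isT) _; rlra.
  - apply: le_trans (rate y) _; apply: le_trans (_ : 1 / S%:R * 1 <= _); last rlra.
    by apply: ler_wpM2l => //; rewrite divr_ge0.
  - rewrite it2 -(iter_damp_Q x tau) -/F; set X := iter m F x.
    have -> : iter m F (tp x (iter m F y) x) = tp X y X - (tp X y X - iter m F (tp x (iter m F y) x)).
      by rewrite subKr.
    apply: le_trans (NB _ _) _; have i1 := trip1 x y x; have i2 := tp_bound J Fx y1 Fx.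
    have i4 : N x * N y * N x <= 1.
      have -> : 1 = 1 * 1 * 1 :> R by ring.
      by apply: ler_pM; rewrite ?mulr_ge0 ?N_ge0 //; apply: ler_pM; rewrite ?N_ge0.
    have i5 := ler_wpM2l er0 i4.
    have i6 : de * 1 * de <= de by rewrite mulr1 ler_piMl // ltW.
    have i7 := ler_wpM2l K0 i6.
    have i8 : 1 * de <= K * de by apply: ler_wpM2r => //; exact: ltW.
    rewrite -/X in i1 i2; rlra.
  - move=> k; set b := iter (2 * m) F y.
    have -> : tp b (pw tp x k) b = (tp b (pw tp x k) b - iter (2 * m) F (tp y (iter (2 * m) F (pw tp x k)) y))
      + iter (2 * m) F (tp y (iter (2 * m) F (pw tp x k)) y) by rewrite subrK.
    apply: le_trans (ND _ _) _.
    have i1 := trip2 y (pw tp x k) y.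
    have xk : N (pw tp x k) <= 1 by apply: le_trans (N_pw J x k) _; rewrite exprn_ile1 // N_ge0.
    have i4 : N y * N (pw tp x k) * N y <= 1.
      have -> : 1 = 1 * 1 * 1 :> R by ring.
      by apply: ler_pM; rewrite ?mulr_ge0 ?N_ge0 //; apply: ler_pM; rewrite ?N_ge0.
    have i5 := ler_wpM2l er0 i4.
    have i2 : N (iter (2 * m) F (pw tp x k)) <= K ^+ k * (2 * de).
      elim: k {i1 xk i4 i5} => [|k IH].
        by rewrite expr0 mul1r it2; apply: le_trans (m1 _) _; apply: ler_wpM2l.
      rewrite pwS (iter_damp_comm x tau); apply: le_trans (bop_sq J _ x1) _.
      by rewrite exprS -mulrA; apply: ler_wpM2l.
    have i3 := tp_bound J y1 i2 y1.
    have i6 := bF 2%N (tp y (iter (2 * m) F (pw tp x k)) y) isT.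
    have kk : 1 <= K * K ^+ k by rewrite -exprS exprn_ege1.
    have i7 : 1 * de <= (K * K ^+ k) * de by apply: ler_wpM2r => //; exact: ltW.
    rewrite -/b in i1; rewrite exprS; rlra.
move=> P e lP hP y y1.
have := damp_defect x1 tau0 lP hP (pw2 2 isT) y1.
have -> : (2 * m)%N%:R * (tau * (2 * e)) = 4 * S%:R * e by rewrite natrM -mt; ring.
by rewrite -/F.
Qed.

End StepOperator.

(** * The path from [B y] to [B y + r x] *)

Section Path.
Variables (R : realType) (V : lmodType R[i]) (N : V -> R).
Variables (tp : V -> V -> V -> V) (K : R).
Hypothesis J : jb_axioms N tp K.
Let HN := jb_banach J.
Local Notation N_ge0 := (N_ge0 HN).
Local Notation NZ := (NZ HN).
Local Notation NZp := (NZp HN).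
Local Notation ND := (ND HN).
Local Notation NB := (NB HN).
Local Notation NN := (NN HN).
Local Notation tpE := (tpE J).
Local Notation tpS := (jb_sym J).
Local Notation K_ge0 := (K_ge0 J).
Local Notation K_ge1 := (K_ge1 J).
Local Notation pw := (pw tp).

Lemma N_pw_ball x k : N x <= 1 -> N (pw x k) <= 1.
Proof. by move=> x1; apply: le_trans (N_pw J x k) _; rewrite exprn_ile1 // N_ge0. Qed.

Lemma L_pw0_bound k : exists C : R, 0 <= C /\ forall x b, N x <= 1 ->
  N (tp (pw x k) x b) <= C * (N (tp x x b) + N (tp x b x)).
Proof.
have K0 := K_ge0.
elim: k => [|k [C [C0 IH]]].
  by exists 1; split=> // x b x1; rewrite mul1r lerDl N_ge0.
exists (K + K * C); split; first by rewrite addr_ge0 ?mulr_ge0.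
move=> x b x1; set A := N (tp x x b); set B := N (tp x b x).
have xk := N_pw_ball k x1.
have -> : tp (pw x k.+1) x b = tp (tp x x b) x (pw x k) - tp x (tp x b x) (pw x k) + tp x x (tp b x (pw x k)).
  rewrite pwS (tpS _ x b) (jb_jordan J b x x x (pw x k)) (tpS b x x).
  by congr (_ + _).
apply: le_trans (ND _ _) _; apply: le_trans (lerD (NB _ _) (lexx _)) _.
have i1 := tp_bound J (lexx A) x1 xk; have i2 := tp_bound J x1 (lexx B) xk.
have := bop_sq J (tp b x (pw x k)) x1; rewrite (tpS b x (pw x k)).
have := ler_wpM2l K0 (IH x b x1); rewrite -/A -/B; rlra.
Qed.

(** The Jordan identity lowers the second index at the price of raising the first, which the
    quantifier over [i] inside the induction allows. *)
Lemma L_pw_bound j : forall i, exists C : R, 0 <= C /\ forall x b, N x <= 1 ->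
  N (tp (pw x i) (pw x j) b) <= C * (N (tp x x b) + N (tp x b x)).
Proof.
have K0 := K_ge0; elim: j => [|j IH] i; first exact: L_pw0_bound.
have [C1 [C10 h1]] := IH i.+1; have [C2 [C20 h2]] := IH i.
exists (C1 + K * C2 + K); split; first by rewrite !addr_ge0 ?mulr_ge0.
move=> x b x1; set A := N (tp x x b); set B := N (tp x b x).
have -> : tp (pw x i) (pw x j.+1) b = tp (pw x i.+1) (pw x j) b - tp x x (tp (pw x i) (pw x j) b)
   + tp (pw x i) (pw x j) (tp x x b).
  by rewrite (jb_jordan J x x (pw x i) (pw x j) b) !pwS; lmod R V.
apply: le_trans (ND _ _) _; apply: le_trans (lerD (NB _ _) (lexx _)) _.
have i1 := h1 x b x1; have i2 := ler_wpM2l K0 (h2 x b x1).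
have i3 := bop_sq J (tp (pw x i) (pw x j) b) x1.
have i4 := tp_bound J (N_pw_ball i x1) (N_pw_ball j x1) (lexx A).
have B0 : 0 <= K * B by rewrite mulr_ge0 ?N_ge0.
rewrite -/A -/B in i1 i2; rewrite -/A; rlra.
Qed.

(** Truncation of x + s^2 x^3 + s^4 x^5 + ..., the formal solution c of c - s^2 {x,c,x} = x; with
    the full series s |-> s x would be an exact integral curve. *)
Fixpoint geo (x : V) (s : R) n : V :=
  if n is k.+1 then geo x s k + ((s ^+ 2) ^+ k)%:C *: pw x k else 0.

Lemma geo_id x s n :
  geo x s n - (s ^+ 2)%:C *: tp x (geo x s n) x + ((s ^+ 2) ^+ n)%:C *: pw x n = x.
Proof.
elim: n => [|n IH] /=; first by rewrite (tp0m J) scaler0 subr0 add0r expr0 scale1r.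
have e : tp x (pw x n) x = tp x x (pw x n) by have := tp_pw J x 0 n 0; rewrite addn0 add0n.
rewrite -[RHS]IH !tpE e; move: (geo x s n) (s ^+ 2) => g s2; rewrite exprS rmorphM; lmod R V.
Qed.

Lemma N_geo x (s r : R) n : N x <= 1 -> 0 <= s -> s <= r -> r < 1 -> N (geo x s n) <= (1 - r ^+ 2)^-1.
Proof.
move=> x1 s0 sr r1; have r2 : r ^+ 2 < 1 by rewrite expr_lt1 //; rlra.
have s2 : s ^+ 2 <= r ^+ 2 by rewrite lerXn2r // nnegrE; rlra.
have s20 := sqr_ge0 s.
have d0 : 0 < 1 - r ^+ 2 by rlra.
suff h : N (geo x s n) * (1 - s ^+ 2) <= 1 - (s ^+ 2) ^+ n.
  rewrite -[leRHS]mul1r ler_pdivlMr //; have : 0 <= (s ^+ 2) ^+ n by rewrite exprn_ge0.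
  have := ler_wpM2l (N_ge0 (geo x s n)) (_ : 1 - r ^+ 2 <= 1 - s ^+ 2).
  by move/(_ ltac:(rlra)); rlra.
elim: n => [|n IH] /=; first by rewrite (N0 HN) mul0r expr0 subrr.
have q0 : 0 <= (s ^+ 2) ^+ n by rewrite exprn_ge0.
have i1 : N (geo x s n + ((s ^+ 2) ^+ n)%:C *: pw x n) <= N (geo x s n) + (s ^+ 2) ^+ n.
  apply: le_trans (ND _ _) _; rewrite lerD2l (NZp _ q0) ler_piMr //; exact: N_pw_ball.
have d1 : 0 <= 1 - s ^+ 2 by rlra.
have := ler_wpM2r d1 i1; rewrite [_ ^+ n.+1]exprSr; rlra.
Qed.

Lemma tp_geo_bound x (s D : R) n p q : N x <= 1 -> 0 <= s -> s <= 1 -> 0 <= D ->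
  (forall k, (k < n)%N -> N (tp p (pw x k) q) <= D) -> N (tp p (geo x s n) q) <= n%:R * D.
Proof.
move=> x1 s0 s1 D0; elim: n => [|n IH] h /=; first by rewrite (tp0m J) (N0 HN) mul0r.
rewrite !tpE; apply: le_trans (ND _ _) _; rewrite -natr1 mulrDl mul1r.
have q0 : 0 <= (s ^+ 2) ^+ n by rewrite !exprn_ge0.
have q1 : (s ^+ 2) ^+ n <= 1 by rewrite -exprM exprn_ile1.
apply: lerD; first by apply: IH => k kn; apply: h; exact: ltnW.
rewrite (NZp _ q0); apply: le_trans (_ : 1 * N (tp p (pw x n) q) <= _); last by rewrite mul1r h.
by apply: ler_wpM2r => //; exact: N_ge0.
Qed.

Lemma max_bound (f : nat -> R -> Prop) n :
  (forall k, exists C : R, 0 <= C /\ forall C', C <= C' -> f k C') ->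
  exists C : R, 0 <= C /\ forall k, (k < n)%N -> f k C.
Proof.
move=> h; suff [C [C0 hC]] : exists C : R, 0 <= C /\ forall k C', (k < n)%N -> C <= C' -> f k C'.
  by exists C; split=> // k kn; exact: hC.
elim: n => [|n [C [C0 IH]]]; first by exists 0.
have [D [D0 hD]] := h n; exists (C + D); split; first exact: addr_ge0.
move=> k C'; rewrite ltnS leq_eqVlt => /orP[/eqP ->|kn] CD; first by apply: hD; rlra.
by apply: IH => //; rlra.
Qed.

(** The Gronwall factor of [path_bound], bounded independently of the fineness [q]. *)
Lemma exp_bound (q : nat) A : (0 < q)%N -> (1 + (2 * q%:R)^-1 : R) ^+ (2 * q * A) <= 4 ^+ A.
Proof.
move=> q0; have q0' : 0 < 2 * q%:R :> R by rewrite mulr_gt0 // ltr0n.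
have a0 : 0 <= (2 * q%:R)^-1 :> R by rewrite invr_ge0 ltW.
have a1 : 0 <= 1 + (2 * q%:R)^-1 :> R by rewrite addr_ge0.
rewrite exprM; apply: lerXn2r; rewrite ?nnegrE ?exprn_ge0 //.
have i : (1 + (2 * q%:R)^-1 : R) ^+ q <= 2.
  have e : q%:R * (2 * q%:R)^-1 = 1 / 2 :> R by field; rewrite pnatr_eq0 -lt0n.
  by apply: le_trans (pow_lin_le a0 _) _; rewrite e //; rlra.
rewrite mulnC exprM; have -> : 4 = 2 ^+ 2 :> R by ring.
by apply: lerXn2r; rewrite ?nnegrE ?exprn_ge0.
Qed.

(* The path [s |-> b + s x] is almost an integral curve of the fields [c_s - {v, c_s, v}],
   [c_s = geo x s], which are tangent to the unit sphere. *)
Lemma path_bound (r e : R) : 0 <= r -> r < 1 -> 0 < e -> e <= 1 ->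
  exists de : R, [/\ 0 < de, de <= 1 & forall x b, N x <= 1 -> N b <= 1 + de ->
    N (tp x x b) <= de -> N (tp x b x) <= 2 * K * de ->
    (forall k, N (tp b (pw x k) b) <= 5 * K ^+ k.+1 * de) -> N (b + r%:C *: x) <= 1 + e].
Proof.
move=> r0 r1 e0 e1; have K0 := K_ge0; have K1 := K_ge1.
have [C [C1 flow]] := flow_step J.
have r2 : r ^+ 2 < 1 by rewrite expr_lt1.
have [Ga GaE] : exists G : R, G = (1 - r ^+ 2)^-1 by exists (1 - r ^+ 2)^-1.
have Ga1 : 1 <= Ga by rewrite GaE invf_ge1 //; have := sqr_ge0 r; rlra.
have Ga0 : 0 < Ga by rlra.
have C0 : 0 <= C by rlra.
(* Order of choice: the growth exponent [A], then the truncation [n], then [de], and the fineness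
   [q] of the subdivision last. *)
have Ga00 := ltW Ga0; have [A hA] := archi (C * Ga).
have CG1 : 1 <= C * Ga by have := ler_pM ler01 ler01 C1 Ga1; rewrite mulr1.
have [X XE] : exists X : R, X = 4 ^+ A by exists (4 ^+ A).
have X1 : 1 <= X by rewrite XE exprn_ege1 //; rlra.
have X0 : 0 <= X by rlra.
have eX : 0 < e / (4 * X) by rewrite divr_gt0 //; rlra.
have [n hn] := expr_small (sqr_ge0 r) r2 eX.
have {}hn := hn n (leqnn n).
pose Lb k (C : R) := forall x b, N x <= 1 ->
  N (tp (pw x 0) (pw x k) b) <= C * (N (tp x x b) + N (tp x b x)).
have [|Cm [Cm0 hCm]] := @max_bound Lb n.
  move=> k; have [D [D0 hD]] := L_pw_bound k 0; exists D; split=> // C' DC x b x1.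
  by apply: le_trans (hD x b x1) _; apply: ler_wpM2r => //; rewrite addr_ge0 ?N_ge0.
have [W WE] : exists W : R, W = n%:R * (5 * K ^+ n) + 2 * (n%:R * (Cm * (3 * K))) by eexists.
have W0 : 0 <= W by rewrite WE addr_ge0 // !mulr_ge0 // exprn_ge0.
have XW : 0 < 4 * X * (W + 1) by rewrite mulr_gt0 //; rlra.
have [de de0 deE] : exists2 de : R, 0 < de & de * (4 * X * (W + 1)) = e.
  by exists (e / (4 * X * (W + 1))); [rewrite divr_gt0 | rewrite divfK // gt_eqF].
have de00 := ltW de0; have XdW : 0 <= X * de * W by rewrite !mulr_ge0.
have Xd1 : X * de * W + X * de = e / 4 by rewrite -deE; field.
have de1 : de <= 1.
  have : 1 * de <= X * de by apply: ler_wpM2r => //; exact: ltW.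
  rlra.
have [q hq] := archi (4 * X * (C * Ga ^+ 2) / e + 1).
have z0 : 0 <= 4 * X * (C * Ga ^+ 2) / e.
  by rewrite divr_ge0 ?(ltW e0) // mulr_ge0 ?mulr_ge0 ?sqr_ge0.
have q0 : 0 < q%:R :> R by rlra.
have qn : (0 < q)%N by rewrite -(ltr0n R).
have qe : 4 * X * (C * Ga ^+ 2) <= e * q%:R by rewrite [leRHS]mulrC -ler_pdivrMr //; rlra.
have A0 : 1 <= A%:R :> R by apply: le_trans CG1 (ltW hA).
pose L := (2 * q * A)%N.
have LE : L%:R = 2 * q%:R * A%:R :> R by rewrite !natrM.
have Lq : q%:R <= L%:R :> R.
  by rewrite LE; have := ler_wpM2l (ltW q0) A0; rlra.
have L0 : 0 < L%:R :> R by rlra.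
have [h [h0 Lh hL]] : exists h : R, [/\ 0 <= h, L%:R * h = r & h <= 1 / L%:R].
  exists (r / L%:R); split; first by rewrite divr_ge0 // ltW.
    by rewrite mulrC divfK // gt_eqF.
  by apply: ler_wpM2r; [rewrite invr_ge0 ltW | exact: ltW].
have hCG : C * Ga * h <= (2 * q%:R)^-1.
  apply: le_trans (_ : A%:R * (1 / L%:R) <= _).
    by apply: ler_pM => //; [rlra | exact: ltW].
  rewrite LE; have -> : A%:R * (1 / (2 * q%:R * A%:R)) = (2 * q%:R)^-1 :> R by field; rlra.
  by [].
have q21 : (2 * q%:R)^-1 <= 1 :> R by rewrite invf_le1; rlra.
have hG1 : h * Ga <= 1.
  have : 1 * (Ga * h) <= C * (Ga * h) by apply: ler_wpM2r; rewrite ?mulr_ge0 //; rlra.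
  rlra.
exists de; split=> // x b x1 b1 Tb Qb bkb.
have [w wE] : exists w : R, w = C * Ga ^+ 2 * h + (de * W + e / (4 * X)) by eexists.
have w0 : 0 <= w.
  rewrite wE; apply: addr_ge0; first by rewrite mulr_ge0 // mulr_ge0 // sqr_ge0.
  by apply: addr_ge0; [exact: mulr_ge0 | exact: ltW].
have [rho rhoE] : exists rho : R, rho = 1 + C * Ga * h by eexists.
have rho1 : 1 <= rho by rewrite rhoE lerDl !mulr_ge0.
(* Discrete Gronwall bound for the excess of the norm over one after [i] steps. *)
pose Er i := rho ^+ i * (de + i%:R * (h * w)).
have hw : 0 <= h * w by rewrite mulr_ge0.
have ErL i : (i <= L)%N -> Er i <= e.
  move=> iL; apply: le_trans (_ : X * (de + 1 * w) <= _).
    apply: ler_pM.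
    - by rewrite exprn_ge0 // (le_trans ler01).
    - by rewrite addr_ge0 ?mulr_ge0 //; exact: ltW.
    - apply: le_trans (_ : rho ^+ L <= _); first by rewrite ler_weXn2l.
      rewrite XE; apply: le_trans (exp_bound A qn); apply: lerXn2r; rewrite ?nnegrE; [rlra | | by rewrite rhoE lerD2l].
      by rewrite addr_ge0 // invr_ge0; rlra.
    - rewrite lerD2l mulrA; apply: ler_wpM2r => //.
      apply: le_trans (_ : L%:R * h <= _); last by rewrite Lh ltW.
      by apply: ler_wpM2r => //; rewrite ler_nat.
  have k1 : C * Ga ^+ 2 * h <= C * Ga ^+ 2 * (1 / q%:R).
    apply: ler_wpM2l; first by rewrite mulr_ge0 // sqr_ge0.
    apply: le_trans hL _; rewrite ler_pdivrMr // mulrAC ler_pdivlMr //; rlra.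
  have k2 : X * (C * Ga ^+ 2 * (1 / q%:R)) <= e / 4.
    have -> : X * (C * Ga ^+ 2 * (1 / q%:R)) = X * (C * Ga ^+ 2) / q%:R by field; rlra.
    by rewrite ler_pdivrMr //; rlra.
  have k3 : X * (e / (4 * X)) = e / 4 by field; rlra.
  have := ler_wpM2l X0 k1; rewrite wE; rlra.
have Er0 i : 0 <= Er i.
  by rewrite /Er mulr_ge0 ?exprn_ge0 ?addr_ge0 // ?mulr_ge0 // (le_trans ler01).
have main i : (i <= L)%N -> N (b + (i%:R * h)%:C *: x) <= 1 + Er i.
  elim: i => [|i IH] iL.
    by rewrite !mul0r scale0r addr0 /Er expr0 mul0r addr0 mul1r.
  have {}IH := IH (ltnW iL).
  set s := i%:R * h; have s0 : 0 <= s by rewrite mulr_ge0.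
  have sr : s <= r by rewrite -Lh; apply: ler_wpM2r => //; rewrite ler_nat ltnW.
  set v := b + s%:C *: x in IH.
  pose c := geo x s n.
  have Nc : N c <= Ga by rewrite GaE; exact: N_geo sr r1.
  (* Defect of the field along b + s x: the terms of {b + s x, c, b + s x} that involve [b], and the
     truncated tail of the series. *)
  pose err := tp b c b + (2 * s)%:C *: tp x c b + ((s ^+ 2) ^+ n)%:C *: pw x n.
  have s1 : s <= 1 by apply: le_trans sr _; exact: ltW.
  have Nerr : N err <= de * W + e / (4 * X).
    apply: le_trans (ND _ _) _; apply: lerD; last first.
      have q00 : 0 <= (s ^+ 2) ^+ n by rewrite !exprn_ge0.
      rewrite (NZp _ q00); apply: le_trans (_ : (s ^+ 2) ^+ n * 1 <= _).
        by apply: ler_wpM2l => //; exact: N_pw_ball.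
      rewrite mulr1; apply: le_trans hn; apply: lerXn2r; rewrite ?nnegrE ?sqr_ge0 //.
      by apply: lerXn2r; rewrite ?nnegrE.
    apply: le_trans (ND _ _) _.
    have j1 : N (tp b c b) <= n%:R * (5 * K ^+ n * de).
      apply: tp_geo_bound => //; first by rewrite !mulr_ge0 ?exprn_ge0 // ltW.
      move=> k kn; apply: le_trans (bkb k) _; apply: ler_wpM2r; first exact: ltW.
      by apply: ler_wpM2l => //; rewrite ler_weXn2l.
    have j2 : N (tp x c b) <= n%:R * (Cm * (3 * K * de)).
      apply: tp_geo_bound => //; first by rewrite !mulr_ge0 // ltW.
      move=> k kn; apply: le_trans (hCm k kn x b x1) _; apply: ler_wpM2l => //.
      have : 1 * de <= K * de by apply: ler_wpM2r => //; exact: ltW.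
      rlra.
    rewrite NZp; last by rewrite mulr_ge0.
    have : s * N (tp x c b) <= 1 * (n%:R * (Cm * (3 * K * de))).
      by apply: ler_pM => //; exact: N_ge0.
    rewrite WE; rlra.
  have ex : x = c - tp v c v + err.
    rewrite -[LHS](geo_id x s n) -/c /v /err; move: (c) => c'.
    by rewrite !tpE (tpS b c' x) !(rmorphM, rmorphXn, rmorph_nat); lmod R V.
  (* The field is rescaled by [Ga] because [flow_step] wants a generator in the unit ball. *)
  have -> : b + (i.+1%:R * h)%:C *: x =
    (v + (h * Ga)%:C *: (Ga^-1%:C *: c - tp v (Ga^-1%:C *: c) v)) + h%:C *: err.
    have e2 : b + (i.+1%:R * h)%:C *: x = v + h%:C *: x.
      by rewrite /v /s -natr1 mulrDl mul1r rmorphD; lmod R V.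
    rewrite e2 [in LHS]ex (tpZmr J) -scalerBr scalerA -rmorphM mulfK ?gt_eqF //; lmod R V.
  apply: le_trans (ND _ _) _; rewrite (NZp _ h0).
  have c1 : N (Ga^-1%:C *: c) <= 1.
    have Gi : 0 <= Ga^-1 by rewrite invr_ge0.
    by rewrite (NZp _ Gi) mulrC ler_pdivrMr // mul1r.
  have hG0 : 0 <= h * Ga by rewrite mulr_ge0 // ltW.
  have Ei1 : Er i <= 1 by apply: le_trans (ErL i (ltnW iL)) e1.
  have st := flow v _ (h * Ga) (Er i) c1 hG0 hG1 (Er0 i) Ei1 IH.
  apply: le_trans (lerD st (ler_wpM2l h0 Nerr)) _.
  have -> : 1 + Er i + C * (h * Ga * Er i + (h * Ga) ^+ 2) + h * (de * W + e / (4 * X))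
     = 1 + (rho * Er i + h * w) by rewrite rhoE wE; ring.
  rewrite lerD2l /Er exprS -natr1.
  have : 1 * (h * w) <= rho ^+ i.+1 * (h * w) by apply: ler_wpM2r => //; rewrite exprn_ege1.
  rewrite exprS; rlra.
have := main L (leqnn L); rewrite Lh => i1; apply: le_trans i1 _.
by rewrite lerD2l; exact: ErL.
Qed.

Lemma step_operator (r e : R) : 0 <= r -> r < 1 -> 0 < e -> e <= 1 ->
  exists d : R, 0 < d /\ forall x, N x <= 1 -> exists B : V -> V, [/\ lop B,
    (forall y, N y <= 1 -> N (B y + r%:C *: x) <= 1 + e) &
    forall P z, supp N P z -> N z = 1 -> Re (P (tp x x z)) <= d ->
      forall y, N y <= 1 -> normc (P (B y - y)) <= e].
Proof.
move=> r0 r1 e0 e1; have [de [de0 de1 hp]] := path_bound r0 r1 e0 e1.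
have [S [S0 hB]] := damped_operator J de0 de1.
have eS : 0 < e / (S + 1) by rewrite divr_gt0 //; rlra.
have [d [d0 hd]] := moment_small J eS.
exists d; split=> // x x1; have [B [lB hB1 hB2]] := hB x x1; exists B; split=> //.
  by move=> y y1; have [b1 b2 b3 b4] := hB1 y y1; exact: hp.
move=> P z sP z1 Pz y y1; have [lP _ _] := sP.
apply: le_trans (hB2 P (e / (S + 1)) lP (hd x z P x1 sP z1 Pz) y y1) _.
have S1 : 0 < S + 1 by rlra.
by rewrite mulrA ler_pdivrMr // [S * e]mulrC; apply: ler_wpM2l; [exact: ltW | rlra].
Qed.

End Path.

Lemma ultra_of_base (I J : Type) (A : J -> set I) (j0 : J) :
  (forall j k, exists l, A l `<=` A j `&` A k) -> (forall j, A j !=set0) ->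
  exists U : set_system I, UltraFilter U /\ forall j, U (A j).
Proof.
move=> dA nA; have FF : ProperFilter (filter_from [set: J] A).
  apply: filter_from_proper; last by move=> j _; exact: nA.
  apply: filter_from_filter; first by exists j0.
  by move=> j k _ _; have [l hl] := dA j k; exists l.
have [U [UF sU]] := ultraFilterLemma FF.
by exists U; split=> // j; apply: sU; exists j.
Qed.

Section UltraExtra.
Variables (R : realType) (I : Type) (U : set_system I).
Hypothesis UF : UltraFilter U.

Lemma ucv_eq_near (g g' : I -> R[i]) l (A : set I) :
  U A -> (forall i, A i -> g i = g' i) -> ucv U g l -> ucv U g' l.
Proof.
move=> UA e h d d0; apply: (ultraS UF) (ultraI UF (h d d0) UA) => i /= [h1 Ai].
by rewrite -(e i Ai).
Qed.

Lemma ucv_sum (T : Type) (s : seq T) (g : T -> I -> R[i]) (l : T -> R[i]) :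
  (forall t, ucv U (g t) (l t)) -> ucv U (fun i => \sum_(t <- s) g t i) (\sum_(t <- s) l t).
Proof.
move=> h; elim: s => [|t s IH].
  by rewrite big_nil; under eq_fun do rewrite big_nil; exact: ucv_cst.
by rewrite big_cons; under eq_fun do rewrite big_cons; apply: ucvD.
Qed.

End UltraExtra.

(** * Weak-star limits in a dual pair *)

Section DualPair.
Variables (R : realType) (E : lmodType R[i]) (n : E -> R).
Variables (D : lmodType R[i]) (N : D -> R) (ev : D -> E -> R[i]).

(** [D] plays the dual of [E] as a type of its own; [dp_bound] and [dp_rep] together say that [N] is
    the dual norm. *)
Record dual_pair : Prop := {
  dp_E : cbanach n;
  dp_D : cbanach N;
  dp_lin : forall a f g e, ev (a *: f + g) e = a * ev f e + ev g e;
  dp_lfun : forall f, lfun (ev f);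
  dp_bound : forall f e, normc (ev f e) <= N f * n e;
  dp_rep : forall (g : E -> R[i]) (c : R), 0 <= c -> lfun g ->
    (forall e, normc (g e) <= c * n e) -> exists f, N f <= c /\ forall e, ev f e = g e;
  dp_inj : forall f g, (forall e, ev f e = ev g e) -> f = g }.

Hypothesis DP : dual_pair.
Let Hn := dp_E DP.
Let HN := dp_D DP.

Lemma evD f g e : ev (f + g) e = ev f e + ev g e.
Proof. by rewrite -[f]scale1r (dp_lin DP) scale1r mul1r. Qed.
Lemma ev0 e : ev 0 e = 0.
Proof. by apply: (@addrI _ (ev 0 e)); rewrite -evD !addr0. Qed.
Lemma evZ a f e : ev (a *: f) e = a * ev f e.
Proof. by rewrite -[a *: f]addr0 (dp_lin DP) ev0 addr0. Qed.
Lemma evN f e : ev (- f) e = - ev f e.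
Proof. by rewrite -scaleN1r evZ mulN1r. Qed.
Lemma evB f g e : ev (f - g) e = ev f e - ev g e.
Proof. by rewrite evD evN. Qed.
Lemma lfun_ev e : lfun (ev^~ e).
Proof. by move=> a f g; exact: (dp_lin DP). Qed.

Lemma dual_norm_le f (c : R) : 0 <= c -> (forall e, normc (ev f e) <= c * n e) -> N f <= c.
Proof.
move=> c0 h; have [g [Ng eg]] := dp_rep DP c0 (dp_lfun DP f) h.
by rewrite -(dp_inj DP eg).
Qed.

Lemma norming e : exists f, N f <= 1 /\ ev f e = (n e)%:C.
Proof.
have [g [lg bg ge]] := exists_supp Hn e.
have [f [Nf fg]] := dp_rep DP ler01 lg (fun v => ltac:(rewrite mul1r; exact: bg v)).
by exists f; rewrite fg.
Qed.

Lemma pre_norm_le e (c : R) : (forall f, N f <= 1 -> normc (ev f e) <= c) -> n e <= c.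
Proof.
move=> h; have [f [f1 fe]] := norming e; have := h f f1.
by rewrite fe normcR ger0_norm // (N_ge0 Hn).
Qed.

Section Limits.
Variables (I : Type) (U : set_system I).
Hypothesis UF : UltraFilter U.

Definition wcv (g : I -> D) f := forall e, ucv U (fun i => ev (g i) e) (ev f e).

Lemma wcv_ex (g : I -> D) (c : R) : 0 <= c -> (forall i, N (g i) <= c) ->
  exists f, N f <= c /\ wcv g f.
Proof.
move=> c0 gc.
have bd e i : normc (ev (g i) e) <= c * n e.
  apply: le_trans (dp_bound DP _ _) _; apply: ler_wpM2r => //; exact: N_ge0.
have [F hF] := choice (fun e => ucv_ex UF (bd e)).
have lF : lfun F.
  move=> a x y; apply: (ucv_uniq UF (hF _)).
  under eq_fun do rewrite (dp_lfun DP).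
  by apply: (ucvD UF) => //; exact: (ucvZ UF).
have [f [Nf fF]] := dp_rep DP c0 lF (fun e => ucv_le UF (bd e) (hF e)).
by exists f; split=> // e; rewrite fF.
Qed.

Lemma wcv_le g f (c : R) : 0 <= c -> (forall i, N (g i) <= c) -> wcv g f -> N f <= c.
Proof.
move=> c0 gc h; apply: dual_norm_le => // e; apply: (ucv_le UF _ (h e)) => i.
by apply: le_trans (dp_bound DP _ _) _; apply: ler_wpM2r => //; exact: N_ge0.
Qed.

Lemma wcv_uniq g f f' : wcv g f -> wcv g f' -> f = f'.
Proof. by move=> h h'; apply: (dp_inj DP) => e; exact: (ucv_uniq UF (h e) (h' e)). Qed.
Lemma wcv_cst f : wcv (fun=> f) f.
Proof. by move=> e; exact: ucv_cst. Qed.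
Lemma wcvD g g' f f' : wcv g f -> wcv g' f' -> wcv (fun i => g i + g' i) (f + f').
Proof. by move=> h h' e; rewrite evD; under eq_fun do rewrite evD; exact: ucvD. Qed.
Lemma wcvZ a g f : wcv g f -> wcv (fun i => a *: g i) (a *: f).
Proof. by move=> h e; rewrite evZ; under eq_fun do rewrite evZ; exact: ucvZ. Qed.
Lemma wcvB g g' f f' : wcv g f -> wcv g' f' -> wcv (fun i => g i - g' i) (f - f').
Proof. by move=> h h' e; rewrite evB; under eq_fun do rewrite evB; exact: ucvB. Qed.

End Limits.

Section Continuity.
Variables (tp : D -> D -> D -> D) (K : R).
Hypothesis J : jb_axioms N tp K.
Local Notation K_ge0 := (K_ge0 J).

Lemma phase_form (t : R[i]) : exists th : R[i], normc th = 1 /\ t = (normc t)%:C * th.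
Proof.
have [th [t1 e]] := phase t; exists (conjc th); split; first by rewrite normc_conj.
have cc : conjc th * th = 1.
  by apply: complex_ext; rewrite ?ReM ?ImM Re_conj Im_conj /=; have := normc_sq th; rewrite t1 expr1n; rlra.
by rewrite -e -mulrA [t * _]mulrC mulrA [th * _]mulrC cc mul1r.
Qed.

Section NullNet.
Variables (I : Type) (U : set_system I).
Hypothesis UF : UltraFilter U.
Variable d : I -> D.
Hypothesis d1 : forall i, N (d i) <= 1.
Hypothesis d0 : wcv U d 0.

(** The ultralimit B(z,w) of {z,d,w} exists by compactness. Since d tends to 0, Euler steps from z
    with generator - conj(th) d converge to z + t B(z,z), and semicontinuity of the norm transfers
    the bound 1 + C |t|^2. [quadratic_cartan] kills the diagonal, polarization the rest. *)
Lemma middle_null z w : wcv U (fun i => tp z (d i) w) 0.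
Proof.
have K0 := K_ge0.
have bd z' w' i : N (tp z' (d i) w') <= K * (N z' * 1 * N w') by apply: (tp_bound J).
have c0 z' w' : 0 <= K * (N z' * 1 * N w') by rewrite !mulr_ge0 ?(N_ge0 HN).
have [b hb] := choice (fun p : D * D => wcv_ex UF (c0 p.1 p.2) (bd p.1 p.2)).
pose B z' w' := b (z', w').
have cB z' w' : wcv U (fun i => tp z' (d i) w') (B z' w') by exact: (hb (z', w')).2.
have Bs z' w' : B z' w' = B w' z'.
  apply: (wcv_uniq UF (cB z' w')); have := cB w' z'.
  by congr wcv; apply/funext => i; exact: (jb_sym J).
have lB2 y : lop (B y).
  move=> a u v; apply: (wcv_uniq UF (cB _ _)).
  have -> : (fun i => tp y (d i) (a *: u + v)) = (fun i => a *: tp y (d i) u + tp y (d i) v).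
    by apply/funext => i; rewrite (lop_tp J).
  by apply: (wcvD UF) => //; exact: (wcvZ UF).
have lB1 y : lop (B^~ y) by move=> a u v; rewrite /= !(Bs _ y) lB2.
have [C [C1 flow]] := flow_step J.
have B0 : forall z, B z z = 0.
  apply: (@quadratic_cartan _ _ _ HN B C) => //; first rlra.
  move=> t u t1 u1; have [th [th1 te]] := phase_form t.
  pose g i := u + (normc t)%:C *: ((- conjc th) *: d i - tp u ((- conjc th) *: d i) u).
  have gc : wcv U g (u + t *: B u u).
    have -> : u + t *: B u u = u + (normc t)%:C *: ((- conjc th) *: 0 - (- th) *: B u u).
      by rewrite {1}te; lmod R D.
    apply: (wcvD UF) (wcv_cst UF _) _; apply: (wcvZ UF); apply: (wcvB UF); first exact: (wcvZ UF).
    have -> : (fun i => tp u (- conjc th *: d i) u) = (fun i => (- th) *: tp u (d i) u).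
      by apply/funext => i; rewrite (tpZm J) conjcN conjcK.
    exact: (wcvZ UF).
  apply: (wcv_le UF _ _ gc).
    by rewrite addr_ge0 // mulr_ge0 ?sqr_ge0 //; rlra.
  move=> i.
  have Nd : N (- conjc th *: d i) <= 1 by rewrite (NZ HN) normcN normc_conj th1 mul1r.
  have u1' : N u <= 1 + 0 by rewrite addr0.
  have := flow u _ (normc t) 0 Nd (normc_ge0 t) t1 (lexx 0) ler01 u1'.
  by rewrite mulr0 add0r addr0.
suff -> : 0 = B z w by exact: cB.
have := B0 (z + w); rewrite (lopD (lB1 _)) !(lopD (lB2 _)) !B0 add0r addr0 (Bs w z) => e.
have n2 : (2%:R : R[i]) != 0 by rewrite pnatr_eq0.
have e2 : 2%:R *: B z w = 0 by rewrite scaler_nat mulr2n.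
by rewrite -[RHS](scalerK n2) e2 scaler0.
Qed.

(** The same scheme with skew steps: the companion term {a,d,u} disappears in the limit by
    [middle_null], which leaves a linear defect for [linear_cartan]. *)
Lemma outer_null a w : wcv U (fun i => tp (d i) a w) 0.
Proof.
have K0 := K_ge0.
have bd w' i : N (tp (d i) a w') <= K * (1 * N a * N w') by apply: (tp_bound J).
have c0 w' : 0 <= K * (1 * N a * N w') by rewrite !mulr_ge0 ?(N_ge0 HN).
have [S hS] := choice (fun w' => wcv_ex UF (c0 w') (bd w')).
have cS w' : wcv U (fun i => tp (d i) a w') (S w') by exact: (hS w').2.
have lS : lop S.
  move=> c u v; apply: (wcv_uniq UF (cS _)).
  have -> : (fun i => tp (d i) a (c *: u + v)) = (fun i => c *: tp (d i) a u + tp (d i) a v).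
    by apply/funext => i; rewrite (lop_tp J).
  by apply: (wcvD UF) => //; exact: (wcvZ UF).
pose C := (2 * (K * N a)) ^+ 2.
suff S0 : forall u, S u = 0 by rewrite -(S0 w); exact: cS.
apply: (@linear_cartan _ _ _ HN S C) => //; first exact: sqr_ge0.
move=> t u t1; have [th [th1 te]] := phase_form t.
pose g i := u + (normc t)%:C *: (tp (th *: d i) a u - tp a (th *: d i) u).
have gc : wcv U g (u + t *: S u).
  have -> : u + t *: S u = u + (normc t)%:C *: (th *: S u - conjc th *: 0).
    by rewrite {1}te; lmod R D.
  apply: (wcvD UF) (wcv_cst UF _) _; apply: (wcvZ UF); apply: (wcvB UF).
    have -> : (fun i => tp (th *: d i) a u) = (fun i => th *: tp (d i) a u).
      by apply/funext => i; rewrite (tpZl J).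
    exact: (wcvZ UF).
  have -> : (fun i => tp a (th *: d i) u) = (fun i => conjc th *: tp a (d i) u).
    by apply/funext => i; rewrite (tpZm J).
  by apply: (wcvZ UF); exact: middle_null.
apply: (wcv_le UF _ _ gc).
  by rewrite mulr_ge0 ?(N_ge0 HN) // addr_ge0 // mulr_ge0 ?sqr_ge0.
move=> i; apply: le_trans (skew_step J _ _ _ _) _.
apply: ler_wpM2r; first exact: N_ge0.
rewrite lerD2l ger0_norm ?normc_ge0 // exprMn mulrC; apply: ler_wpM2r; first exact: sqr_ge0.
apply: lerXn2r; rewrite ?nnegrE ?mulr_ge0 ?(N_ge0 HN) //.
apply: ler_wpM2l => //; apply: ler_wpM2l => //.
rewrite -[leRHS]mul1r; apply: ler_wpM2r; first exact: N_ge0.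
by rewrite (NZ HN) th1 mul1r.
Qed.

End NullNet.

Section BoundedNet.
Variables (I : Type) (U : set_system I).
Hypothesis UF : UltraFilter U.
Variables (d : I -> D) (f : D).
Hypothesis d1 : forall i, N (d i) <= 1.
Hypothesis df : wcv U d f.

(** Differences with the limit are halved so that they stay in the unit ball. *)
Let hd i := 2^-1%:C *: (d i - f).
Lemma half_ball i : N (hd i) <= 1.
Proof.
have f1 : N f <= 1 by apply: (wcv_le UF _ _ df).
rewrite (NZp HN) ?invr_ge0 //; have := NB HN (d i) f; have := d1 i; rlra.
Qed.
Lemma half_null : wcv U hd 0.
Proof.
rewrite -(scaler0 D 2^-1%:C) -(subrr f).
by apply: (wcvZ UF); apply: (wcvB UF) => //; exact: (wcv_cst UF).
Qed.

Lemma half_back i : d i = 2%:C *: hd i + f.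
Proof. by rewrite /hd scalerA -rmorphM mulfV ?scale1r ?subrK. Qed.

Lemma middle_cont z w : wcv U (fun i => tp z (d i) w) (tp z f w).
Proof.
have -> : (fun i => tp z (d i) w) = (fun i => 2%:C *: tp z (hd i) w + tp z f w).
  by apply/funext => i; rewrite half_back (tpDm J) (tpZmr J).
rewrite -{2}[tp z f w]add0r -(scaler0 D 2%:C); apply: (wcvD UF); last exact: (wcv_cst UF).
by apply: (wcvZ UF); apply: (middle_null UF half_ball half_null).
Qed.

End BoundedNet.
End Continuity.

(** * Functionals that are weak-star continuous on the ball come from the predual *)

Section Grothendieck.
Variable Phi : D -> R[i].
Hypothesis lPhi : lfun Phi.
Hypothesis wPhi : forall (U : set_system D) (d : D -> D), UltraFilter U ->
  (forall i, N (d i) <= 1) -> wcv U d 0 -> ucv U (fun i => Phi (d i)) 0.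

(** Otherwise the counterexamples, directed by finite lists in [E], carry an ultrafilter along which
    f tends to zero weak-star while |Phi f| stays above [e]. *)
Lemma phi_finite (e : R) : 0 < e -> exists s : seq E, forall f, N f <= 1 ->
  (forall x, x \in s -> normc (ev f x) <= 1) -> normc (Phi f) <= e.
Proof.
move=> e0; apply: contrapT => none.
pose A (s : seq E) : set D := [set f | [/\ N f <= 1, e < normc (Phi f) &
  forall x, x \in s -> normc (ev f x) <= 1]].
have nA s : A s !=set0.
  apply: contrapT => h; apply: none; exists s => f f1 fs; rewrite leNgt; apply/negP => ef.
  by apply: h; exists f.
have [s t|U [UF UA]] := ultra_of_base [::] _ nA.
  exists (s ++ t) => f [f1 f2 f3]; split; split=> // x xs; apply: f3; rewrite mem_cat xs ?orbT //.
(* Cut-off to the ball, since [wPhi] speaks of families that are bounded everywhere. *)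
pose d f := if N f <= 1 then f else 0.
have d1 i : N (d i) <= 1 by rewrite /d; case: ifP => // _; rewrite (N0 HN).
have dA : U [set f | d f = f] by apply: (ultraS UF) (UA [::]) => f [f1 _ _] /=; rewrite /d f1.
have d0 : wcv U d 0.
  move=> x; rewrite ev0 => r r0; have [m hm] := archi (1 / r).
  have m0 : 0 < m%:R :> R by apply: le_lt_trans hm; rewrite divr_ge0 // ltW.
  (* Putting the multiple m x into the list turns the bound 1 there into 1/m at x. *)
  apply: (ultraS UF) (ultraI UF dA (UA [:: m%:R%:C *: x])) => f /= [-> [_ _ h]].
  have := h _ (mem_head _ _); rewrite (lfunZ (dp_lfun DP f)) normcM normcR ger0_norm // subr0.
  move: hm; rewrite ltr_pdivrMr // => hm h1.
  rewrite -(ltr_pM2l m0); rlra.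
have [f [/= h [ef h2]]] := ultra_ex UF (ultraI UF (wPhi UF d1 d0 e0) (ultraI UF dA (UA [::]))).
by move: h; rewrite subr0 ef; case: h2 => _ h2 _ h3; rlra.
Qed.

Lemma kernel_span (s : seq E) (Psi : D -> R[i]) : lfun Psi ->
  (forall f, (forall x, x \in s -> ev f x = 0) -> Psi f = 0) -> exists e, forall f, Psi f = ev f e.
Proof.
elim: s Psi => [|x s IH] Psi lP h.
  by exists 0 => f; rewrite (lfun0 (dp_lfun DP f)); exact: h.
have [[f0 f0s f0x]|none] := pselect (exists2 f0, (forall y, y \in s -> ev f0 y = 0) & ev f0 x = 1).
  have [||e he] := IH (fun f => Psi f - Psi f0 * ev f x).
  - by move=> a f g; rewrite lP (dp_lin DP); ring.
  - move=> f fs; have := h (f - ev f x *: f0).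
    rewrite (lfunB lP) (lfunZ lP) mulrC; apply=> y.
    rewrite inE evB evZ => /orP[/eqP ->|ys]; first by rewrite f0x mulr1 subrr.
    by rewrite fs // f0s // mulr0 subrr.
  exists (Psi f0 *: x + e) => f; rewrite (dp_lfun DP f) -he; ring.
apply: IH => // f fs; apply: h => y; rewrite inE => /orP[/eqP ->|]; last exact: fs.
apply/eqP/negPn/negP => fx; apply: none; exists ((ev f x)^-1 *: f).
  by move=> z zs; rewrite evZ (fs z zs) mulr0.
by rewrite evZ mulVf.
Qed.

(** On the annihilator of a suitable finite list [Phi] has norm at most [e]; extend this restriction
    with the same bound. The difference vanishes on the annihilator, hence is evaluation at a
    combination of the list. *)
Lemma phi_approx (e : R) : 0 < e -> exists x, forall f, N f <= 1 -> normc (Phi f - ev f x) <= e.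
Proof.
move=> e0; have [s hs] := phi_finite e0.
pose W : set D := [set f | forall x, x \in s -> ev f x = 0].
have [||||Psi [lPsi bPsi eqPsi]] := @hahn_banach_subspace _ _ _ HN W Phi e (ltW e0).
- by move=> x _; rewrite ev0.
- by move=> a f g hf hg x xs; rewrite (dp_lin DP) hf // hg // mulr0 addr0.
- by move=> a f g _ _; exact: lPhi.
- move=> f fW; have [f0|f0] := eqVneq (N f) 0.
    have -> : f = 0 by apply: (N_eq0 HN); rewrite f0.
    by rewrite (lfun0 lPhi) Normc.normc0 mulr_ge0 ?(N_ge0 HN) ?ltW.
  have fp : 0 < N f by rewrite lt_neqAle eq_sym f0 (N_ge0 HN).
  have i0 : 0 <= (N f)^-1 by rewrite invr_ge0 ltW.
  have := hs ((N f)^-1%:C *: f); rewrite (NZp HN _ i0) mulVf // (lfunZ lPhi) normcM normcR ger0_norm //.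
  move=> h; rewrite -ler_pdivrMr // mulrC; apply: h => // x xs.
  by rewrite evZ fW // mulr0 Normc.normc0.
have [||x hx] := @kernel_span s (fun f => Phi f - Psi f).
- by move=> a f g; rewrite lPhi lPsi; ring.
- by move=> f fs; rewrite eqPsi ?subrr.
exists x => f f1; rewrite -hx opprB addrC subrK.
by apply: le_trans (bPsi f) _; rewrite ler_piMr // ltW.
Qed.

Lemma grothendieck : exists x, forall f, Phi f = ev f x.
Proof.
have pos m : 0 < (m.+1%:R)^-1 :> R by rewrite invr_gt0 ltr0n.
have [u hu] := choice (fun m => phi_approx (pos m)).
have cau p q : n (u p - u q) <= (p.+1%:R)^-1 + (q.+1%:R)^-1.
  apply: pre_norm_le => f f1; rewrite (lfunB (dp_lfun DP f)).
  have -> : ev f (u p) - ev f (u q) = (Phi f - ev f (u q)) - (Phi f - ev f (u p)) by ring.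
  by apply: le_trans (normcB _ _) _; rewrite addrC; apply: lerD; exact: hu.
have small (e : R) : 0 < e -> exists M, forall p, (M <= p)%N -> (p.+1%:R)^-1 < e.
  move=> e0; have [M hM] := archi (1 / e); exists M => p Mp.
  have M1 : M%:R <= p.+1%:R :> R by rewrite ler_nat leqW.
  have p0 : 0 < p.+1%:R :> R by rewrite ltr0n.
  rewrite -[ltLHS]mul1r ltr_pdivrMr // mulrC -ltr_pdivrMr //; rlra.
have [|x hx] := @nrm_complete _ _ _ Hn u.
  move=> e e0; have [|M hM] := small (e / 2); first rlra.
  exists M => p q Mp Mq; apply: le_lt_trans (cau p q) _.
  by rewrite [ltRHS]splitr; apply: ltrD; exact: hM.
have key f : N f <= 1 -> Phi f = ev f x.
  move=> f1; apply/eqP; rewrite -subr_eq0; apply/eqP/normc_le0.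
  apply: (@le_eps _ _ _ 2) => // e e0; rewrite add0r.
  have [M hM] := small e e0; have [M' hM'] := hx e e0.
  pose p := (M + M')%N.
  have -> : Phi f - ev f x = (Phi f - ev f (u p)) + ev f (u p - x).
    by rewrite (lfunB (dp_lfun DP f)) addrA subrK.
  apply: le_trans (normcD _ _) _.
  have i1 := le_trans (hu p f f1) (ltW (hM p (leq_addr _ _))); have i3 := hM' p (leq_addl _ _).
  have i4 := dp_bound DP f (u p - x).
  have : N f * n (u p - x) <= 1 * n (u p - x) by apply: ler_wpM2r => //; exact: (N_ge0 Hn).
  rlra.
exists x => f; have z1 : 0 < N f + 1 by have := N_ge0 HN f; rlra.
have a0 : 0 < (N f + 1)^-1 by rewrite invr_gt0.
have an : ((N f + 1)^-1%:C : R[i]) != 0.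
  by rewrite -(rmorph0 (real_complex R)) (inj_eq (@complexI R)) gt_eqF.
have := key ((N f + 1)^-1%:C *: f); rewrite (NZp HN _ (ltW a0)) (lfunZ lPhi) evZ => h.
apply: (mulfI an); apply: h; rewrite mulrC ler_pdivrMr //; rlra.
Qed.

End Grothendieck.

End DualPair.

(** * Weak compactness through ultrafilters, and separation *)

Section WeakCompactness.
Variables (R : realType) (E : lmodType R[i]) (n : E -> R).
Variables (D : lmodType R[i]) (N : D -> R) (ev : D -> E -> R[i]).
Hypothesis DP : dual_pair n N ev.
Let Hn := dp_E DP.
Let HN := dp_D DP.

Lemma dual_ev f : Dset n (ev f).
Proof.
split; first by move=> a x y; rewrite (dp_lfun DP).
by exists (N f) => x; exact: (dp_bound DP).
Qed.

Lemma ev_of_dual g : Dset n g -> exists f, forall x, ev f x = g x.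
Proof.
move=> [lg [c hc]].
have [|f [_ hf]] := dp_rep DP (normr_ge0 c) lg; last by exists f.
by move=> x; apply: le_trans (hc x) _; apply: ler_wpM2r; [exact: (N_ge0 Hn) | exact: ler_norm].
Qed.

Lemma ultra_fin (I : Type) (U : set_system I) k (A : nat -> set I) : UltraFilter U ->
  (forall i, (i < k)%N -> U (A i)) -> U [set x | forall i, (i < k)%N -> A i x].
Proof.
move=> UF; elim: k => [|k IH] h.
  by apply: (ultraS UF) (@filterT _ U _).
have h1 := IH (fun i ik => h i (ltnW ik)); have h2 := h k (ltnSn k).
apply: (ultraS UF) (ultraI UF h1 h2) => x /= [h3 h4] i.
by rewrite ltnS leq_eqVlt => /orP[/eqP ->|] //; exact: h3.
Qed.

Lemma nth_sig (T : Type) (F : set T) (t0 : T) (l : seq {V | F V}) i : (i < size l)%N ->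
  F (nth t0 [seq sval V | V <- l] i).
Proof. by elim: l i => [|[V FV] l IH] [|i] //=; exact: IH. Qed.

(** Without a finite subcover, the points of [K] missed by finite subfamilies carry an ultrafilter.
    Its limit lies in some member V of the cover, although the one-element family V is missed along
    the ultrafilter. *)
Lemma weakly_compact_intro (K : set E) :
  (forall U : set_system E, UltraFilter U -> U K ->
     exists x, K x /\ forall f, ucv U (ev f) (ev f x)) -> weakly_compact n K.
Proof.
move=> h F Fo cov; apply: contrapT => none.
pose A (l : seq {V | F V}) : set E := [set x | K x /\
  forall i, (i < size l)%N -> ~ nth set0 [seq sval V | V <- l] i x].
have nA l : A l !=set0.
  apply: contrapT => hA; apply: none; exists (size l), (nth set0 [seq sval V | V <- l]).
  split; first by move=> i; exact: nth_sig.
  move=> x Kx; apply: contrapT => hx; apply: hA; exists x; split=> // i il gx.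
  by apply: hx; exists i.
have [l l'|U [UF UA]] := ultra_of_base [::] _ nA.
  exists (l ++ l') => x [Kx hx]; split; split=> // i il gx; rewrite size_cat map_cat in hx.
    by apply: (hx i); [exact: ltn_addr | rewrite nth_cat size_map il].
  apply: (hx (size l + i)%N); first by rewrite ltn_add2l.
  by rewrite nth_cat size_map ltnNge leq_addr /= addKn.
have [|x [Kx cx]] := h U UF; first by apply: (ultraS UF) (UA [::]) => x [].
have [V [FV Vx]] := cov x Kx.
have [k [fs [e [e0 [fsD hV]]]]] := Fo V FV x Vx.
have UV : U [set y | forall i, (i < k)%N -> normc (fs i y - fs i x) < e].
  apply: ultra_fin => i ik; have [f hf] := ev_of_dual (fsD i ik).
  by apply: (ultraS UF) (cx f e e0) => y /=; rewrite !hf.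
have [y [/hV Vy [_ hy]]] := ultra_ex UF (ultraI UF UV (UA [:: exist _ V FV])).
exact: (hy 0%N).
Qed.

Lemma weakly_compact_lim (K : set E) (I : Type) (U : set_system I) (b : I -> E) :
  weakly_compact n K -> UltraFilter U -> U [set i | K (b i)] ->
  exists x, K x /\ forall f, ucv U (fun i => ev f (b i)) (ev f x).
Proof.
move=> wK UF UK; apply: contrapT => none.
have [|x Kx|k [g [Fg cov]]] := wK [set V | weak_open n V /\ ~ U [set i | V (b i)]].
- by move=> V [].
- have [[f [e [e0 nU]]]|hx] := pselect (exists f (e : R), 0 < e /\ ~ U [set i | normc (ev f (b i) - ev f x) < e]); last first.
    exfalso; apply: none; exists x; split=> // f e e0; apply: contrapT => nU; apply: hx.
    by exists f, e.
  exists [set y | normc (ev f y - ev f x) < e]; split; last by rewrite /= subrr Normc.normc0.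
  split=> // y /= hy; exists 1%N, (fun=> ev f), (e - normc (ev f y - ev f x)).
  split; first by rewrite subr_gt0.
  split=> [i _|z /(_ 0%N isT) hz]; first exact: dual_ev.
  have -> : ev f z - ev f x = (ev f z - ev f y) + (ev f y - ev f x) by rewrite addrA subrK.
  by apply: le_lt_trans (normcD _ _) _; rlra.
have UC : U [set j | forall i, (i < k)%N -> (~` [set j | g i (b j)]) j].
  apply: ultra_fin => i ik; have [_ nU] := Fg i ik.
  by have [|] := in_ultra_setVsetC [set j | g i (b j)] UF.
have [j [Kj hj]] := ultra_ex UF (ultraI UF UK UC).
by have [i [ik gx]] := cov (b j) Kj; exact: (hj i ik).
Qed.

(** Hahn-Banach for the infimum [p] of |v + s(a - k)| - s lam over s >= 0 and k in [K], starting
    from the zero space. Convexity of [K] makes [p] subadditive, p(v) <= |v| bounds the functional,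
    and p(-(a - k)) <= -lam is the separation. *)
Lemma separation (K : set E) a (lam : R) : K !=set0 ->
  (forall x y (t : R), K x -> K y -> 0 <= t -> t <= 1 -> K ((1 - t)%:C *: x + t%:C *: y)) ->
  (forall k, K k -> lam <= n (a - k)) ->
  exists x, N x <= 1 /\ forall k, K k -> lam <= Re (ev x (a - k)).
Proof.
move=> [k0 Kk0] cK far.
pose S (v : E) : set R := [set r | exists (s : R) k, [/\ 0 <= s, K k & r = n (v + s%:C *: (a - k)) - s * lam]].
pose p (v : E) : R := inf (S v).
have Sn v : S v !=set0 by exists (n (v + 0%:C *: (a - k0)) - 0 * lam), 0, k0.
have lbS v : lbound (S v) (- n v).
  move=> _ [s [k [s0 Kk ->]]].
  have i1 := N_sub_ge Hn (s%:C *: (a - k)) (- v).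
  rewrite opprK (NN Hn) (NZp Hn _ s0) addrC [_ + v]addrC in i1.
  have := ler_wpM2l s0 (far k Kk); rlra.
have hlb v : has_lbound (S v) by exists (- n v); exact: lbS.
have ple v r : S v r -> p v <= r by move=> Sr; exact: (ge_inf (hlb v)).
have pge v r : lbound (S v) r -> r <= p v by move=> h; exact: lb_le_inf.
have pn v : p v <= n v by apply: (ple); exists 0, k0; split=> //; rewrite scale0r addr0 mul0r subr0.
have pD x y : p (x + y) <= p x + p y.
  rewrite -lerBlDl; apply: (pge) => _ [s [k [s0 Kk ->]]].
  rewrite lerBlDl -lerBlDr; apply: (pge) => _ [t [l [t0 Kl ->]]].
  rewrite lerBlDr.
  have [st|st] := eqVneq (s + t) 0.
    have sz : s = 0 by rlra.
    have tz : t = 0 by rlra.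
    rewrite sz tz !scale0r !mul0r !addr0 !subr0; apply: le_trans (pn _) _.
    exact: (ND Hn).
  have st0 : 0 < s + t by rewrite lt_neqAle eq_sym st addr_ge0.
  (* The weight for which s(a - k) + t(a - l) is (s + t) times the difference of [a] and a convex
     combination of k and l. *)
  pose u := t / (s + t).
  have us : (s + t) * (1 - u) = s by rewrite /u; field; exact: st.
  have ut : (s + t) * u = t by rewrite /u; field; exact: st.
  have u0 : 0 <= u by rewrite divr_ge0 // ltW.
  have u1 : u <= 1 by rewrite ler_pdivrMr //; rlra.
  apply: le_trans (_ : n ((x + y) + (s + t)%:C *: (a - ((1 - u)%:C *: k + u%:C *: l))) - (s + t) * lam <= _).
    by apply: (ple); exists (s + t), ((1 - u)%:C *: k + u%:C *: l); split; [exact: ltW | exact: cK |].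
  have -> : (x + y) + (s + t)%:C *: (a - ((1 - u)%:C *: k + u%:C *: l)) =
     (y + s%:C *: (a - k)) + (x + t%:C *: (a - l)).
    rewrite scalerBr scalerDr !scalerA -!rmorphM us ut rmorphD; lmod R E.
  have := ND Hn (y + s%:C *: (a - k)) (x + t%:C *: (a - l)); rlra.
have pZle (t : R) x : 0 < t -> p (t%:C *: x) <= t * p x.
  move=> t0; rewrite mulrC -ler_pdivrMr //; apply: (pge) => _ [s [k [s0 Kk ->]]].
  rewrite ler_pdivrMr //; apply: (ple); exists (t * s), k; split=> //; first by rewrite mulr_ge0 // ltW.
  have -> : t%:C *: x + (t * s)%:C *: (a - k) = t%:C *: (x + s%:C *: (a - k)).
    by rewrite rmorphM; lmod R E.
  rewrite (NZp Hn _ (ltW t0)); ring.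
have pZ (t : R) x : 0 < t -> p (t%:C *: x) = t * p x.
  move=> t0; apply/eqP; rewrite eq_le pZle //=.
  have t1 : 0 < t^-1 by rewrite invr_gt0.
  have := pZle t^-1 (t%:C *: x) t1; rewrite scalerA -rmorphM mulVf ?gt_eqF // scale1r.
  by rewrite mulrC ler_pdivlMr // mulrC.
have p0 : 0 <= p 0.
  apply: (pge) => _ [s [k [s0 Kk ->]]]; rewrite add0r (NZp Hn _ s0) -mulrBr mulr_ge0 // subr_ge0.
  exact: far.
have gr : hb_graph p [set a : E * R | a = (0, 0)].
  split=> //.
  - by move=> _ _ -> -> /=; rewrite !addr0.
  - by move=> _ t -> /=; rewrite scaler0 mulr0.
  - by move=> _ -> /=.
have [g [gD gZ gp _]] := hahn_banach pD pZ gr.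
have lF := complexify gD gZ; set F := (fun v => _) in lF.
have bF v : normc (F v) <= 1 * n v.
  apply: (lfun_Re_bound Hn lF) => w; rewrite mul1r /=; exact: le_trans (gp _) (pn _).
have [x [x1 hx]] := dp_rep DP ler01 lF bF.
exists x; split=> // k Kk; rewrite hx /=.
have gN : g (- (a - k)) = - g (a - k).
  have := gD (a - k) (- (a - k)); rewrite subrr.
  have := gZ 0 0; rewrite scaler0 mul0r => ->; rlra.
have := gp (- (a - k)); rewrite gN => i1.
have : p (- (a - k)) <= - lam.
  by apply: (ple); exists 1, k; split=> //; rewrite scale1r addNr (N0 Hn) mul1r sub0r.
rlra.
Qed.

End WeakCompactness.

(** * Choice of the next point *)

Section NextPoint.
Variables (R : realType) (E : lmodType R[i]) (n : E -> R).
Variables (D : lmodType R[i]) (N : D -> R) (ev : D -> E -> R[i]).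
Hypothesis DP : dual_pair n N ev.
Variables (tp : D -> D -> D -> D) (K : R).
Hypothesis J : jb_axioms N tp K.
Let Hn := dp_E DP.
Let HN := dp_D DP.

Lemma pre_ext x y : (forall f, ev f x = ev f y) -> x = y.
Proof.
move=> h; apply/eqP; rewrite -subr_eq0; apply/eqP/(N_eq0 Hn)/(pre_norm_le DP) => f _.
by rewrite (lfunB (dp_lfun DP f)) h subrr Normc.normc0.
Qed.

(** [outer_null] is the continuity in f that [grothendieck] asks for. *)
Lemma kappa_ex (L : seq (E * D)) w :
  exists x, forall f, ev f x = \sum_(p <- L) ev (tp f w p.2) p.1.
Proof.
have [||x hx] := @grothendieck _ _ _ _ _ _ DP (fun f => \sum_(p <- L) ev (tp f w p.2) p.1).
- move=> a f g; rewrite mulr_sumr -big_split; apply: eq_bigr => p _ /=.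
  by rewrite (jb_linl J) (dp_lin DP).
- move=> U d UF d1 d0.
  suff : ucv U (fun i => \sum_(p <- L) ev (tp (d i) w p.2) p.1) (\sum_(p <- L) ev (0 : D) p.1).
    by rewrite [X in ucv _ _ X]big1 // => p _; rewrite (ev0 DP).
  by apply: (ucv_sum UF) => p; exact: (outer_null DP J UF d1 d0).
- by exists x => f; rewrite hx.
Qed.

Definition kset (kap : D -> E) (t : R) : set E := [set x | exists2 w, N w <= 1 & x = t%:C *: kap w].

Section Kset.
Variables (L : seq (E * D)) (kap : D -> E) (t : R).
Hypothesis hk : forall w f, ev f (kap w) = \sum_(p <- L) ev (tp f w p.2) p.1.

(** A weak-star limit of the parameters w is sent by [kap] to the weak limit of the points, by
    continuity of the product in its middle variable. *)
Lemma kset_compact : weakly_compact n (kset kap t).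
Proof.
apply: (weakly_compact_intro DP) => U UF UK.
have sel x : exists w, N w <= 1 /\ (kset kap t x -> x = t%:C *: kap w).
  have [[w w1 e]|nx] := pselect (kset kap t x); first by exists w.
  by exists 0; rewrite (N0 HN).
have [d hd] := choice sel.
have d1 x : N (d x) <= 1 by case: (hd x).
have [w [w1 cw]] := wcv_ex DP UF ler01 d1.
exists (t%:C *: kap w); split; first by exists w.
move=> f; rewrite (lfunZ (dp_lfun DP f)) hk.
apply: (ucv_eq_near UF UK (g := fun x => t%:C * \sum_(p <- L) ev (tp f (d x) p.2) p.1)).
  by move=> x Kx; have [_ /(_ Kx) e] := hd x; rewrite [in RHS]e (lfunZ (dp_lfun DP f)) hk.
apply: (ucvZ UF); apply: (ucv_sum UF) => p.
exact: (middle_cont DP J UF d1 cw).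
Qed.

Lemma kset_convex x y (s : R) : kset kap t x -> kset kap t y -> 0 <= s -> s <= 1 ->
  kset kap t ((1 - s)%:C *: x + s%:C *: y).
Proof.
move=> [w w1 ->] [v v1 ->] s0 s1; exists ((1 - s)%:C *: w + s%:C *: v).
  apply: le_trans (ND HN _ _) _; rewrite !(NZp HN) //; last rlra.
  have s1' : 0 <= 1 - s by rlra.
  have := ler_wpM2l s1' w1; have := ler_wpM2l s0 v1; rlra.
apply: pre_ext => f; have lf := dp_lfun DP f; rewrite (lfunD lf) !(lfunZ lf) !hk.
rewrite !mulr_sumr -big_split; apply: eq_bigr => p _ /=.
rewrite !(tpDm J) !(tpZmr J) (evD DP) !(evZ DP); ring.
Qed.

End Kset.

Variables (A : set E) (M lam lam' : R).
Hypothesis AM : forall a, A a -> n a <= M.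
Hypothesis M0 : 0 < M.
Hypothesis lam'0 : 0 < lam'.
Hypothesis lamlam : lam' < lam.
Hypothesis far : forall C, C !=set0 -> weakly_compact n C ->
  exists a, A a /\ forall k, C k -> lam <= n (a - k).

Lemma next_point (s : seq E) (e : R) : (forall b, b \in s -> A b) -> 0 < e ->
  exists a x B, [/\ A a, lop B, lam' <= normc (ev x a),
    (forall y th, N y <= 1 -> normc th = 1 -> N (th *: x + B y) <= 1) &
    forall b, b \in s -> normc (ev x b) <= e /\
      forall y, N y <= 1 -> normc (ev (B y - y) b) <= e].
Proof.
move=> sA e0; have lam'0' := lam'0; have ll := lamlam; have M0' := M0.
have lam0 : 0 < lam by rlra.
(* The gap between [lam'] and [lam] pays for scaling [x] by r < 1 and then by 1/(1 + e1) with e1 <=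
   q. *)
have [r [q [r0 r1 q0 rq]]] : exists r q : R, [/\ 0 <= r, r < 1, 0 < q & lam' * (1 + q) <= r * lam].
  exists ((lam + lam') / (2 * lam)), ((lam - lam') / (2 * lam)).
  have l2 : 0 < 2 * lam by rlra.
  split; [by rewrite divr_ge0 //; rlra | by rewrite ltr_pdivrMr //; rlra | by rewrite divr_gt0 //; rlra |].
  have -> : (lam + lam') / (2 * lam) * lam = (lam + lam') / 2 by field; rlra.
  have i : (lam - lam') / (2 * lam) * lam = (lam - lam') / 2 by field; rlra.
  have j : 0 < (lam - lam') / (2 * lam) by rewrite divr_gt0 //; rlra.
  have := ler_wpM2l (ltW j) (ltW ll); rlra.
have [e1 [e10 e11 e1q e1M]] : exists e1 : R, [/\ 0 < e1, e1 <= 1, e1 <= q & 2 * e1 * M <= e].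
  exists (Num.min (Num.min 1 q) (e / (2 * M))).
  have M2 : 0 < 2 * M by rlra.
  split; first by rewrite !lt_min ltr01 q0 divr_gt0.
  - by rewrite !ge_min lexx.
  - by rewrite !ge_min lexx orbT.
  - have : Num.min (Num.min 1 q) (e / (2 * M)) <= e / (2 * M) by rewrite ge_min lexx orbT.
    rewrite ler_pdivlMr //; rlra.
have [d [d0 stp]] := step_operator J r0 r1 e10 e11.
have [z hz] := choice (norming DP).
have z1 b : N (z b) <= 1 by case: (hz b).
have zb b : ev (z b) b = (n b)%:C by case: (hz b).
(* Normalized so that [P b] norms the unit vector [z b]; for n b = 0 the inverse is 0, so [P b]
   vanishes and that case is treated apart. *)
pose nb b := (n b)^-1%:C *: b.
pose P b v := ev v (nb b).
have PE b v : P b v = (n b)^-1%:C * ev v b by rewrite /P /nb (lfunZ (dp_lfun DP v)).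
have sP b : n b != 0 -> supp N (P b) (z b) /\ N (z b) = 1.
  move=> b0; have bp : 0 < n b by rewrite lt_neqAle eq_sym b0 (N_ge0 Hn).
  have nz : N (z b) = 1.
    apply/eqP; rewrite eq_le z1 /=; have := dp_bound DP (z b) b.
    by rewrite zb normcR gtr0_norm // -[leLHS]mul1r ler_pM2r.
  split=> //; split; first exact: (lfun_ev DP).
  - move=> v; rewrite PE normcM normcR gtr0_norm ?invr_gt0 // mulrC ler_pdivrMr //.
    exact: (dp_bound DP).
  - by rewrite PE zb nz -rmorphM mulVf.
pose L := [seq (nb b, z b) | b <- s].
have [kap hkap] := choice (kappa_ex L).
have hk w f : ev f (kap w) = \sum_(b <- s) P b (tp f w (z b)) by rewrite hkap /L big_map.
(* With t d = M, separation at w = x bounds t times the sum of the nonnegative numbers P_b{x,x,z_b}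
   by M, hence each of them by d. *)
pose t := M / d; have t0 : 0 < t by rewrite divr_gt0.
have [|a [Aa fara]] := far (C := kset kap t) _ (@kset_compact L kap t hkap).
  by exists (t%:C *: kap 0), 0; rewrite ?(N0 HN).
have kn0 : kset kap t !=set0 by exists (t%:C *: kap 0), 0; rewrite ?(N0 HN).
have [x [x1 hx]] := separation DP kn0 (@kset_convex L kap t hkap) fara.
have hx' w : N w <= 1 -> lam <= Re (ev x a) - t * Re (ev x (kap w)).
  move=> w1; have := hx (t%:C *: kap w) (ex_intro2 _ _ w w1 erefl).
  by rewrite (lfunB (dp_lfun DP x)) (lfunZ (dp_lfun DP x)) ReB ReMr.
have xa : lam <= Re (ev x a).
  have := hx' 0; rewrite (N0 HN) => /(_ ler01); rewrite hk big1 ?mulr0 ?subr0 //.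
  by move=> b _; rewrite (tp0m J) /P (ev0 DP).
have xaM : Re (ev x a) <= M.
  apply: le_trans (Re_le_normc _) _; apply: le_trans (dp_bound DP _ _) _.
  by apply: le_trans (AM Aa); rewrite ler_piMl // (N_ge0 Hn).
have pos b : 0 <= Re (P b (tp x x (z b))).
  have [b0|b0] := eqVneq (n b) 0; last by have [s1 _] := sP b b0; exact: (supp_pos J).
  by rewrite PE b0 invr0 mul0r.
have small b : b \in s -> Re (P b (tp x x (z b))) <= d.
  move=> bs; have := hx' x x1; rewrite hk.
  have -> : Re (\sum_(b <- s) P b (tp x x (z b))) = \sum_(b <- s) Re (P b (tp x x (z b))).
    by elim: (s) => [|b' s' IH]; rewrite ?big_nil ?big_cons // ReD IH.
  move=> i1; have i2 : Re (P b (tp x x (z b))) <= \sum_(b <- s) Re (P b (tp x x (z b))).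
    rewrite (big_rem b bs) /= lerDl; apply: sumr_ge0 => b' _; exact: pos.
  have i3 := ler_wpM2l (ltW t0) i2.
  rewrite -(ler_pM2l t0); have -> : t * d = M by rewrite /t divfK // gt_eqF.
  rlra.
have [B [lB hB1 hB2]] := stp x x1.
pose g := (1 + e1)^-1.
have g0 : 0 < g by rewrite invr_gt0; rlra.
have gE : g * (1 + e1) = 1 by rewrite mulVf //; rlra.
have g1 : g <= 1 by rewrite invf_le1; rlra.
have rot y th : N y <= 1 -> normc th = 1 -> N (th *: (r%:C *: x) + B y) <= 1 + e1.
  move=> y1 th1.
  have cc : th * conjc th = 1.
    by apply: complex_ext; rewrite ?ReM ?ImM Re_conj Im_conj /=; have := normc_sq th; rewrite th1 expr1n; rlra.
  have -> : th *: (r%:C *: x) + B y = th *: (B (conjc th *: y) + r%:C *: x).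
    by rewrite (lopZ lB) scalerDr [in RHS]scalerA cc scale1r addrC.
  by rewrite (NZ HN) th1 mul1r; apply: hB1; rewrite (NZ HN) normc_conj th1 mul1r.
have defect b y : b \in s -> N y <= 1 -> normc (ev (B y - y) b) <= e1 * n b.
  move=> bs y1; have [b0|b0] := eqVneq (n b) 0.
    have -> : b = 0 by apply: (N_eq0 Hn); rewrite b0.
    by rewrite (lfun0 (dp_lfun DP _)) Normc.normc0 mulr_ge0 ?(N_ge0 Hn) ?ltW.
  have [s1 nz] := sP b b0; have bp : 0 < n b by rewrite lt_neqAle eq_sym b0 (N_ge0 Hn).
  have := hB2 _ _ s1 nz (small b bs) y y1.
  by rewrite PE normcM normcR gtr0_norm ?invr_gt0 // mulrC ler_pdivrMr.
exists a, ((g * r)%:C *: x), (fun v => g%:C *: B v); split=> //.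
- by move=> c u v; rewrite lB; lmod R D.
- rewrite (evZ DP) normcM normcR ger0_norm ?mulr_ge0 ?(ltW g0) //.
  rewrite -mulrA -[g]invrK -/g; rewrite mulrC; rewrite invrK.
  have i1 : r * lam <= r * normc (ev x a) by apply: ler_wpM2l => //; apply: le_trans xa (Re_le_normc _).
  have i2 : lam' * (1 + e1) <= r * normc (ev x a).
    have : lam' * (1 + e1) <= lam' * (1 + q) by apply: ler_wpM2l; rlra.
    rlra.
  by have := ler_wpM2l (ltW g0) i2; rewrite mulrCA gE mulr1 [_ * g]mulrC.
- move=> y th y1 th1.
  have -> : th *: ((g * r)%:C *: x) + g%:C *: B y = g%:C *: (th *: (r%:C *: x) + B y).
    by rewrite rmorphM; lmod R D.
  rewrite (NZp HN _ (ltW g0)) -gE; apply: ler_wpM2l; [exact: ltW | exact: rot].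
move=> b bs; have bM := AM (sA b bs); have nb0 := N_ge0 Hn b.
have e1b : 2 * e1 * n b <= e.
  by apply: le_trans e1M; apply: ler_wpM2l => //; rlra.
split.
  rewrite (evZ DP) normcM normcR ger0_norm ?mulr_ge0 ?(ltW g0) //.
  have xr : r * normc (ev x b) <= 2 * e1 * n b.
    have [b0|b0] := eqVneq (n b) 0.
      have -> : b = 0 by apply: (N_eq0 Hn); rewrite b0.
      by rewrite (lfun0 (dp_lfun DP _)) Normc.normc0 mulr0 (N0 Hn) mulr0.
    have [[lP cP Pz] nz] := sP b b0; have bp : 0 < n b by rewrite lt_neqAle eq_sym b0 (N_ge0 Hn).
    (* [P b] has real part at least 1 - e1 at B z and at most 1 + e1 at every th r x + B z, so only
       2 e1 is left for r x. *)
    have h1 : normc (P b (r%:C *: x)) <= 2 * e1.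
      apply: normc_rotP => th th1; rewrite -(lfunZ lP).
      have i1 := le_trans (le_trans (Re_le_normc _) (cP _)) (rot (z b) th (z1 b) th1).
      rewrite (lfunD lP) ReD in i1.
      have i2 := hB2 _ _ (sP b b0).1 nz (small b bs) (z b) (z1 b).
      have := le_trans (abs_Re_le _) i2; rewrite (lfunB lP) ReB Pz nz ReR ler_norml => /andP[i3 _].
      rlra.
    rewrite (lfunZ lP) PE !normcM !normcR (ger0_norm r0) gtr0_norm ?invr_gt0 // in h1.
    by move: h1; rewrite mulrCA mulrC ler_pdivrMr.
  rewrite -mulrA; apply: le_trans e1b; apply: le_trans xr.
  by rewrite ler_piMl // mulr_ge0 ?normc_ge0.
move=> y y1; have -> : g%:C *: B y - y = g%:C *: ((B y - y) - e1%:C *: y).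
  have -> : y = (g * (1 + e1))%:C *: y by rewrite gE scale1r.
  by rewrite gE rmorph1; rewrite -{2}[y]scale1r -(rmorph1 (real_complex R)) -gE rmorphM rmorphD rmorph1; lmod R D.
rewrite (evZ DP) normcM normcR (gtr0_norm g0); apply: le_trans e1b.
apply: le_trans (_ : normc (ev (B y - y - e1%:C *: y) b) <= _).
  by rewrite ler_piMl // normc_ge0.
rewrite (evB DP) (evZ DP); apply: le_trans (normcB _ _) _.
rewrite normcM normcR (gtr0_norm e10).
have i1 := defect b y bs y1.
have i2 : normc (ev y b) <= n b by apply: le_trans (dp_bound DP _ _) _; rewrite ler_piMl.
have := ler_wpM2l (ltW e10) i2; rlra.
Qed.

End NextPoint.

Section Series.
Variable R : realType.

Lemma bounded_tails (c : nat -> R) (M e : R) : (forall j, 0 <= c j) ->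
  (forall l, \sum_(j < l) c j <= M) -> 0 < e ->
  exists k0, forall k l, (k0 <= k)%N -> \sum_(j < l) c (k + j)%N <= e.
Proof.
move=> c0 bM e0; pose S := range (fun l : nat => \sum_(j < l) c j).
have hS : has_sup S by split; [exists (\sum_(j < 0) c j), 0%N | exists M => _ [l _ <-]].
have [_ [k0 _ <-] hk] := sup_adherent e0 hS.
exists k0 => k l kk.
have spl a b : \sum_(j < a + b) c j = \sum_(j < a) c j + \sum_(j < b) c (a + j)%N.
  by rewrite big_split_ord.
have : \sum_(j < k + l) c j <= sup S by apply: (ub_le_sup hS.2); exists (k + l)%N.
rewrite spl; have := spl k0 (k - k0)%N; rewrite subnKC // => ->.
have : 0 <= \sum_(j < k - k0) c (k0 + j)%N by apply: sumr_ge0.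
rlra.
Qed.

End Series.

(** * The sequence and its witnesses *)

Section Construction.
Variables (R : realType) (E : lmodType R[i]) (n : E -> R).
Variables (D : lmodType R[i]) (N : D -> R) (ev : D -> E -> R[i]).
Hypothesis DP : dual_pair n N ev.
Let Hn := dp_E DP.
Let HN := dp_D DP.
Variables (A : set E) (lam eta : R).
Hypothesis eta0 : 0 < eta.
Hypothesis next : forall (s : seq E) (e : R), (forall b, b \in s -> A b) -> 0 < e ->
  exists a x B, [/\ A a, lop B, lam <= normc (ev x a),
    (forall y th, N y <= 1 -> normc th = 1 -> N (th *: x + B y) <= 1) &
    forall b, b \in s -> normc (ev x b) <= e /\
      forall y, N y <= 1 -> normc (ev (B y - y) b) <= e].

Definition tol m : R := eta * (2^-1) ^+ m.
Lemma tol_gt0 m : 0 < tol m. Proof. by rewrite mulr_gt0 // exprn_gt0 ?invr_gt0. Qed.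
Lemma tolS m : tol m.+1 = tol m / 2. Proof. by rewrite /tol exprSr mulrA. Qed.
Lemma tol_le m : tol m <= eta.
Proof. by rewrite ler_piMr // ?exprn_ile1 ?invr_ge0 ?invf_le1 ?ler1n // ltW. Qed.

Lemma sequences : exists (a : nat -> E) (x : nat -> D) (B : nat -> D -> D), forall m,
  [/\ A (a m), lop (B m), lam <= normc (ev (x m) (a m)),
    (forall y th, N y <= 1 -> normc th = 1 -> N (th *: x m + B m y) <= 1) &
    forall i, (i < m)%N -> normc (ev (x m) (a i)) <= tol m / 4 /\
      forall y, N y <= 1 -> normc (ev (B m y - y) (a i)) <= tol m / 4].
Proof.
have t4 m : 0 < tol m / 4 by rewrite divr_gt0 ?tol_gt0.
have sel (p : nat * seq E) : exists o : E * D * (D -> D), (forall b, b \in p.2 -> A b) ->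
  [/\ A o.1.1, lop o.2, lam <= normc (ev o.1.2 o.1.1),
    (forall y th, N y <= 1 -> normc th = 1 -> N (th *: o.1.2 + o.2 y) <= 1) &
    forall b, b \in p.2 -> normc (ev o.1.2 b) <= tol p.1 / 4 /\
      forall y, N y <= 1 -> normc (ev (o.2 y - y) b) <= tol p.1 / 4].
  have [h|h] := pselect (forall b, b \in p.2 -> A b); last by exists (0, 0, id).
  by have [a [x [B hB]]] := next h (t4 p.1); exists (a, x, B).
have [F hF] := choice sel.
(* The list of points chosen before stage [m]: each choice is made against all earlier points. *)
pose fix hist m := if m is k.+1 then (F (k, hist k)).1.1 :: hist k else [::].
have hA m b : b \in hist m -> A b.
  elim: m b => [|m IH] b //=; rewrite inE => /orP[/eqP ->|]; last exact: IH.
  by case: (hF (m, hist m) IH).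
have mem m i : (i < m)%N -> (F (i, hist i)).1.1 \in hist m.
  elim: m => // m IH; rewrite ltnS leq_eqVlt => /orP[/eqP ->|im] /=; first exact: mem_head.
  by rewrite inE IH ?orbT.
exists (fun m => (F (m, hist m)).1.1), (fun m => (F (m, hist m)).1.2), (fun m => (F (m, hist m)).2) => m.
have [h1 h2 h3 h4 h5] := hF (m, hist m) (hA m); split=> // i im.
exact: (h5 _ (mem m i im)).
Qed.

(** One of the signs 1 and -1 suffices, since the two moduli add up to at least 2 |u|. *)
Lemma sign_align (u v : R[i]) : exists th : R[i], normc th = 1 /\ normc u <= normc (th * u + v).
Proof.
have [h|h] := leP (normc u) (normc (u + v)).
  by exists 1; rewrite Normc.normc1 mul1r.
exists (-1); rewrite normcN Normc.normc1 mulN1r; split=> //.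
have : normc (u + u) <= normc (u + v) + normc (- u + v).
  by have -> : u + u = (u + v) - (- u + v) by [ring]; exact: normcB.
have -> : normc (u + u) = 2 * normc u.
  have -> : u + u = 2%:C * u by rewrite rmorph_nat; ring.
  by rewrite normcM normcR ger0_norm.
rlra.
Qed.

Section Chain.
Variables (a : nat -> E) (x : nat -> D) (B : nat -> D -> D).
Hypothesis lB : forall m, lop (B m).
Hypothesis xa : forall m, lam <= normc (ev (x m) (a m)).
Hypothesis ball : forall m y th, N y <= 1 -> normc th = 1 -> N (th *: x m + B m y) <= 1.
Hypothesis xsmall : forall m i, (i < m)%N -> normc (ev (x m) (a i)) <= tol m / 4.
Hypothesis Bsmall : forall m i y, (i < m)%N -> N y <= 1 -> normc (ev (B m y - y) (a i)) <= tol m / 4.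

Lemma x_ball m : N (x m) <= 1.
Proof.
have := @ball m 0 1; rewrite (N0 HN) Normc.normc1 scale1r (lop0 (lB m)) addr0.
by apply; rewrite ?ler01.
Qed.

Lemma B_ball m y : N y <= 1 -> N (B m y) <= 1.
Proof.
move=> y1; have h1 := @ball m y 1 y1 (Normc.normc1 _).
have h2 : N ((-1) *: x m + B m y) <= 1 by apply: ball => //; rewrite normcN Normc.normc1.
have e : B m y = (2^-1)%:C *: ((1 *: x m + B m y) + ((-1) *: x m + B m y)).
  have -> : (1 *: x m + B m y) + ((-1) *: x m + B m y) = 2%:C *: B m y by rewrite rmorph_nat; lmod R D.
  by rewrite scalerA -rmorphM mulVf ?scale1r.
rewrite e (NZp HN) ?invr_ge0 //.
have := ND HN (1 *: x m + B m y) ((-1) *: x m + B m y); rlra.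
Qed.

Fixpoint chain j l v : D := if l is k.+1 then B (j + k).+1 (chain j k v) else v.

Lemma lop_chain j l : lop (chain j l).
Proof. by elim: l => [|l IH] c u v //=; rewrite IH lB. Qed.

Lemma chain_ball j l v : N v <= 1 -> N (chain j l v) <= 1.
Proof. by move=> v1; elim: l => //= l IH; exact: B_ball. Qed.

Lemma chainS j l v : chain j l.+1 v = chain j.+1 l (B j.+1 v).
Proof. by elim: l => [|l IH]; [rewrite /= addn0 | rewrite /= -IH /= addnS]. Qed.

Lemma chain_near j l i v : (i <= j)%N -> N v <= 1 ->
  normc (ev (chain j l v - v) (a i)) <= (tol j - tol (j + l)) / 2.
Proof.
move=> ij v1; elim: l => [|l IH] /=.
  by rewrite subrr (ev0 DP) Normc.normc0 addn0 subrr mul0r.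
have -> : B (j + l).+1 (chain j l v) - v =
  (B (j + l).+1 (chain j l v) - chain j l v) + (chain j l v - v) by rewrite addrA subrK.
rewrite (evD DP); apply: le_trans (normcD _ _) _.
have ijl : (i < (j + l).+1)%N by rewrite ltnS (leq_trans ij) // leq_addr.
have := Bsmall ijl (chain_ball j l v1); rewrite addnS tolS.
have := tol_gt0 (j + l); rlra.
Qed.

Variable U : set_system nat.
Hypothesis UF : UltraFilter U.
Hypothesis Utail : forall k, U [set m | (k <= m)%N].

Lemma chain_lim_ex j v : exists f, N v <= 1 -> N f <= 1 /\ wcv ev U (fun m => chain j (m - j) v) f.
Proof.
have [v1|v1] := leP (N v) 1; last by exists 0.
by have [f hf] := wcv_ex DP UF ler01 (fun m => chain_ball j (m - j) v1); exists f.
Qed.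

(** What remains of [x j] after all later operators have acted: the weak-star limit of B_m ...
    B_(j+1) x_j. *)
Definition xinf j := projT1 (cid (chain_lim_ex j (x j))).
Lemma xinf_cv j : wcv ev U (fun m => chain j (m - j) (x j)) (xinf j).
Proof. by case: (projT2 (cid (chain_lim_ex j (x j))) (x_ball j)). Qed.

(** Partial sums x_k + th_0 x_(k+1) + ... with the operators interleaved. [ball] keeps each of them
    in the unit ball, and in the limit the remaining operators turn it into the plain sum [psum] of
    the [xinf]. *)
Definition admissible k (th : nat -> R[i]) (s : nat -> D) :=
  [/\ forall l, normc (th l) = 1, s 0%N = x k &
      forall l, s l.+1 = th l *: x (k + l).+1 + B (k + l).+1 (s l)].

Section Admissible.
Variables (k : nat) (th : nat -> R[i]) (s : nat -> D).
Hypothesis adm : admissible k th s.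

Lemma adm_ball l : N (s l) <= 1.
Proof.
have [h1 h2 h3] := adm; elim: l => [|l IH]; first by rewrite h2 x_ball.
by rewrite h3; exact: ball.
Qed.

Definition psum l := xinf k + \sum_(j < l) th j *: xinf (k + j).+1.

Lemma adm_cv l : wcv ev U (fun m => chain (k + l) (m - (k + l)) (s l)) (psum l).
Proof.
have [h1 h2 h3] := adm; elim: l => [|l IH].
  by rewrite /psum big_ord0 addr0 addn0 h2; exact: xinf_cv.
rewrite /psum big_ord_recr /= addrA -/(psum l) addrC.
have near (g g' : nat -> D) f : (forall m, ((k + l).+1 <= m)%N -> g m = g' m) -> wcv ev U g f -> wcv ev U g' f.
  by move=> e h q; apply: (ucv_eq_near UF (Utail (k + l).+1)) (h q) => m km /=; rewrite e.
apply: near; last by apply: (wcvD DP UF) IH; apply: (wcvZ DP UF (th l)); exact: xinf_cv.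
move=> m km /=; rewrite h3 addnS (lopD (lop_chain _ _)) (lopZ (lop_chain _ _)); congr (_ + _).
by rewrite -chainS -subSn // subSS.
Qed.

Lemma psum_ball l : N (psum l) <= 1.
Proof. by apply: (wcv_le DP UF ler01 _ (adm_cv l)) => m; apply: chain_ball; exact: adm_ball. Qed.

End Admissible.

Lemma adm_of_phases k th : (forall l, normc (th l) = 1) -> exists s, admissible k th s.
Proof.
move=> h; pose fix s l := if l is l'.+1 then th l' *: x (k + l').+1 + B (k + l').+1 (s l') else x k.
by exists s.
Qed.

(** The phases are chosen one after the other so that the new x_(k+l+1) suffers no cancellation at
    its own point a_(k+l+1). *)
Lemma adm_aligned k : exists th s, admissible k th s /\
  forall l, lam <= normc (ev (s l) (a (k + l)%N)).
Proof.
have [ph hph] := choice (fun p : R[i] * R[i] => sign_align p.1 p.2).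
pose T l v := ph (ev (x (k + l).+1) (a (k + l).+1), ev (B (k + l).+1 v) (a (k + l).+1)).
pose fix s l := if l is l'.+1 then T l' (s l') *: x (k + l').+1 + B (k + l').+1 (s l') else x k.
exists (fun l => T l (s l)), s; split.
  by split=> // l; case: (hph (ev (x (k + l).+1) (a (k + l).+1), ev (B (k + l).+1 (s l)) (a (k + l).+1))).
case=> [|l] /=; first by rewrite addn0; exact: xa.
rewrite addnS (dp_lin DP); have := hph (ev (x (k + l).+1) (a (k + l).+1), ev (B (k + l).+1 (s l)) (a (k + l).+1)).
by case=> _ /= h; apply: le_trans (xa _) h.
Qed.

(** Each later stage changes the value at an earlier point by at most half its tolerance; the
    tolerances on the two sides make the induction telescope. *)
Lemma aligned_low k th s l j : admissible k th s -> lam <= normc (ev (s l) (a (k + l)%N)) ->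
  lam - tol (k + l) <= normc (ev (s (l + j)%N) (a (k + l)%N)) - tol (k + (l + j)).
Proof.
move=> adm h; have [h1 h2 h3] := adm; elim: j => [|j IH].
  by rewrite addn0; rlra.
apply: le_trans IH _; rewrite addnS h3 addnS tolS.
set m := (k + (l + j))%N; have lm : (k + l < m.+1)%N by rewrite ltnS leq_add2l leq_addr.
have i1 := xsmall lm; have i2 := Bsmall lm (adm_ball adm (l + j)).
rewrite (dp_lin DP).
have e : ev (s (l + j)%N) (a (k + l)%N) = (th (l + j)%N * ev (x m.+1) (a (k + l)%N) + ev (B m.+1 (s (l + j)%N)) (a (k + l)%N))
  - (th (l + j)%N * ev (x m.+1) (a (k + l)%N) + ev (B m.+1 (s (l + j)%N) - s (l + j)%N) (a (k + l)%N)).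
  by rewrite (evB DP); ring.
have i3 := normcB (th (l + j)%N * ev (x m.+1) (a (k + l)%N) + ev (B m.+1 (s (l + j)%N)) (a (k + l)%N))
  (th (l + j)%N * ev (x m.+1) (a (k + l)%N) + ev (B m.+1 (s (l + j)%N) - s (l + j)%N) (a (k + l)%N)).
rewrite -e in i3.
have i4 := normcD (th (l + j)%N * ev (x m.+1) (a (k + l)%N)) (ev (B m.+1 (s (l + j)%N) - s (l + j)%N) (a (k + l)%N)).
rewrite normcM h1 mul1r in i4; rewrite tolS in i1 i2.
have := tol_gt0 m; rlra.
Qed.

Lemma psum_low k th s l j : admissible k th s -> lam <= normc (ev (s l) (a (k + l)%N)) ->
  lam - 2 * eta <= normc (ev (psum k th (l + j)) (a (k + l)%N)).
Proof.
move=> adm h; have i1 := aligned_low j adm h.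
apply: (ucv_ge_near UF (@filterT _ U _)) (adm_cv adm (l + j) (a (k + l)%N)) => m _.
set J := (k + (l + j))%N; set v := s (l + j)%N.
have lm : (k + l <= J)%N by rewrite leq_add2l leq_addr.
have i2 := chain_near (m - J) lm (adm_ball adm (l + j)).
rewrite -/v in i1 i2; rewrite (evB DP) in i2.
have i3 : normc (ev v (a (k + l)%N)) <= normc (ev (chain J (m - J) v) (a (k + l)%N)) + normc (ev (chain J (m - J) v) (a (k + l)%N) - ev v (a (k + l)%N)).
  by apply: le_trans (normcB _ _); rewrite opprB addrCA subrr addr0.
have := tol_gt0 (J + (m - J)); have := tol_le J; have := tol_le (k + l); have := tol_gt0 J; have := tol_gt0 (k + l).
have eta0' := eta0; rlra.
Qed.

(** With phases that turn every term into its modulus at [q], the sum is the difference of [psum]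
    and [xinf 0] at [q], both in the unit ball. *)
Lemma xinf_summable q l : \sum_(j < l) normc (ev (xinf j.+1) q) <= 2 * n q.
Proof.
have [th hth] := choice (fun j => phase (ev (xinf j.+1) q)).
have [s adm] := @adm_of_phases 0 th (fun l => (hth l).1).
have i1 := le_trans (dp_bound DP (psum 0 th l) q) (ler_wpM2r (N_ge0 Hn q) (psum_ball adm l)).
have i2 : normc (ev (xinf 0) q) <= n q.
  have := le_trans (dp_bound DP (psum 0 th 0) q) (ler_wpM2r (N_ge0 Hn q) (psum_ball adm 0)).
  by rewrite /psum big_ord0 addr0 mul1r.
have e : (\sum_(j < l) normc (ev (xinf j.+1) q))%:C = ev (psum 0 th l) q - ev (xinf 0) q.
  rewrite /psum (evD DP) addrC addKr; elim: (l) => [|l' IH]; first by rewrite !big_ord0 (ev0 DP).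
  rewrite big_ord_recr rmorphD [in RHS]big_ord_recr (evD DP) (evZ DP).
  by congr (_ + _); [exact: IH | exact/esym/(hth l').2].
have := congr1 (@ComplexField.Normc.normc R) e; rewrite normcR ger0_norm; last first.
  by apply: sumr_ge0 => j _; exact: normc_ge0.
move=> ->; apply: le_trans (normcB _ _) _; rlra.
Qed.

Lemma xinf_tails q (e : R) : 0 < e -> exists k0, forall k l th, (k0 <= k)%N ->
  (forall j, normc (th j) = 1) -> normc (ev (psum k th l) q) <= e.
Proof.
move=> e0; have [|k0 hk0] := @bounded_tails R (fun j => normc (ev (xinf j.+1) q)) (2 * n q) e _ (xinf_summable q) e0.
  by move=> j; exact: normc_ge0.
exists k0.+1 => -[|k] l th // kk h1; apply: le_trans (hk0 k l.+1 kk).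
rewrite /psum (evD DP) big_ord_recl /= addn0; apply: le_trans (normcD _ _) _; rewrite lerD2l.
elim: l => [|l IH]; first by rewrite !big_ord0 (ev0 DP) Normc.normc0.
rewrite !big_ord_recr /= (evD DP) (evZ DP); apply: le_trans (normcD _ _) _; apply: lerD => //.
by rewrite normcM h1 mul1r /bump /= add1n addSn addnS.
Qed.

(** f_k is a weak-star limit of the aligned sums that start at k: it keeps their lower bounds at the
    points a_i, and the tails of the summable series make it small at each fixed q. *)
Lemma witnesses : exists f : nat -> D, [/\ forall k, N (f k) <= 1,
  forall k i, (k <= i)%N -> lam - 2 * eta <= normc (ev (f k) (a i)) &
  forall q (e : R), 0 < e -> exists k0, forall k, (k0 <= k)%N -> normc (ev (f k) q) <= e].
Proof.
have sel k : exists f, [/\ N f <= 1,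
   forall i, (k <= i)%N -> lam - 2 * eta <= normc (ev f (a i)) &
   forall q e, (forall l th, (forall j, normc (th j) = 1) -> normc (ev (psum k th l) q) <= e) -> normc (ev f q) <= e].
  have [th [s [adm low]]] := adm_aligned k.
  have [f [f1 cf]] := wcv_ex DP UF ler01 (psum_ball adm).
  exists f; split=> //.
    move=> i ki; apply: (ucv_ge_near UF (Utail (i - k)%N)) (cf (a i)) => m /= im.
    have := psum_low (m - (i - k)) adm (low (i - k)%N).
    by rewrite subnKC // subnKC.
  by move=> q e h; apply: (ucv_le UF _ (cf q)) => m; apply: h; case: adm.
have [f hf] := choice sel; exists f; split.
- by move=> k; case: (hf k).
- by move=> k i ki; case: (hf k) => _ h _; exact: h.
- move=> q e e0; have [k0 hk0] := xinf_tails q e0; exists k0 => k kk.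
  by case: (hf k) => _ _; apply=> l th h1; exact: hk0.
Qed.

End Chain.

Lemma construction : exists (a : nat -> E) (f : nat -> D), [/\ forall m, A (a m),
  forall k, N (f k) <= 1,
  forall k i, (k <= i)%N -> lam - 2 * eta <= normc (ev (f k) (a i)) &
  forall q (e : R), 0 < e -> exists k0, forall k, (k0 <= k)%N -> normc (ev (f k) q) <= e].
Proof.
have [a [x [B h]]] := sequences.
have [j k|k|U [UF Ut]] := @ultra_of_base nat nat (fun k => [set m | (k <= m)%N]) 0%N.
- by exists (maxn j k) => m /=; rewrite geq_max => /andP[].
- by exists k => /=.
have h1 m : lop (B m) by case: (h m).
have h2 m : lam <= normc (ev (x m) (a m)) by case: (h m).
have h3 m y th : N y <= 1 -> normc th = 1 -> N (th *: x m + B m y) <= 1.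
  by case: (h m) => _ _ _ H _; exact: H.
have h4 m i : (i < m)%N -> normc (ev (x m) (a i)) <= tol m / 4.
  by move=> im; case: (h m) => _ _ _ _ /(_ i im) [].
have h5 m i y : (i < m)%N -> N y <= 1 -> normc (ev (B m y - y) (a i)) <= tol m / 4.
  by move=> im y1; case: (h m) => _ _ _ _ /(_ i im) [_]; exact.
have [f [f1 f2 f3]] := witnesses h1 h2 h3 h4 h5 UF Ut.
by exists a, f; split=> // m; case: (h m).
Qed.

End Construction.

(** * The dual space as a triple *)

Section DualType.
Variables (R : realType) (E : lmodType R[i]) (n : E -> R).

Definition dual_pred : {pred E -> R[i]^o} := fun f => `[< Dset n f >].

Lemma dual_submod : submod_closed dual_pred.
Proof.
split.
  by apply/asboolP; split=> [a x y|]; [rewrite mulr0 addr0 | exists 0 => x; rewrite mul0r Normc.normc0].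
move=> a f g /asboolP[lf [c hc]] /asboolP[lg [d hd]]; apply/asboolP; split.
  move=> b x y; change (a * f (b *: x + y) + g (b *: x + y) = b * (a * f x + g x) + (a * f y + g y)).
  by rewrite lf lg; ring.
exists (normc a * c + d) => x; change (normc (a * f x + g x) <= (normc a * c + d) * n x).
apply: le_trans (normcD _ _) _; rewrite normcM mulrDl; apply: lerD (hd x).
by rewrite -mulrA; apply: ler_wpM2l (hc x); exact: normc_ge0.
Qed.

HB.instance Definition _ := GRing.isSubmodClosed.Build R[i] (E -> R[i]^o) dual_pred dual_submod.

(** The triple of the statement acts on all functions on [E] and is constrained on [Dset] only; as a
    submodule type the dual can serve as [D] and [V] in the abstract results. *)
Record dual := Dual { dval : E -> R[i]^o; dvalP : dval \in dual_pred }.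
HB.instance Definition _ := [isSub for dval].
HB.instance Definition _ := [Choice of dual by <:].
HB.instance Definition _ := [SubChoice_isSubLmodule of dual by <:].

End DualType.

Section DualSpace.
Variables (R : realType) (E : lmodType R[i]) (n : E -> R).

Lemma dual_is (f : dual n) : Dset n (dval f).
Proof. exact/asboolP/(dvalP f). Qed.

Definition mk (f : E -> R[i]) (h : Dset n f) : dual n := @Dual R E n f (asboolT h).

Lemma dval_inj (f g : dual n) : (forall e, dval f e = dval g e) -> f = g.
Proof. by move=> h; apply: val_inj; apply/funext => e; exact: h. Qed.

Hypothesis Hn : cbanach n.

Definition nD (f : dual n) : R := fine (dnorm n (dval f)).

Lemma dnorm_le (f : E -> R[i]) (c : R) : Dset n f ->
  (dnorm n f <= c%:E)%E <-> 0 <= c /\ forall e, normc (f e) <= c * n e.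
Proof.
move=> [lf _]; have lf' : lfun f := lf; split.
  move=> h.
  have key e : n e <= 1 -> normc (f e) <= c.
    by move=> e1; rewrite -lee_fin; apply: le_trans h; apply: ereal_sup_ubound; exists e.
  have c0 : 0 <= c by apply: le_trans (normc_ge0 _) (key 0 _); rewrite (N0 Hn).
  split=> // e; have [e0|e0] := eqVneq (n e) 0.
    have -> : e = 0 by apply: (N_eq0 Hn); rewrite e0.
    by rewrite (lfun0 lf') Normc.normc0 mulr_ge0 ?(N_ge0 Hn).
  have ep : 0 < n e by rewrite lt_neqAle eq_sym e0 (N_ge0 Hn).
  have := key ((n e)^-1%:C *: e); rewrite (NZp Hn) ?invr_ge0 ?(N_ge0 Hn) // mulVf // => /(_ (lexx _)).
  by rewrite (lfunZ lf') normcM normcR gtr0_norm ?invr_gt0 // mulrC ler_pdivrMr.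
move=> [c0 h]; apply: ge_ereal_sup => _ [e /= e1 <-]; rewrite lee_fin.
by apply: le_trans (h e) _; rewrite ler_piMr.
Qed.

Lemma dnorm_ge0 (f : E -> R[i]) : (0 <= dnorm n f)%E.
Proof.
apply: le_trans (_ : (normc (f 0))%:E <= _)%E; first by rewrite lee_fin normc_ge0.
by apply: ereal_sup_ubound; exists 0 => //=; rewrite (N0 Hn).
Qed.

Lemma dnormE (f : dual n) : dnorm n (dval f) = (nD f)%:E.
Proof.
rewrite /nD fineK //; have [lf [c hc]] := dual_is f.
have h : (dnorm n (dval f) <= `|c|%:E)%E.
  apply/(dnorm_le _ (dual_is f)); split=> // e; apply: le_trans (hc e) _.
  by apply: ler_wpM2r; [exact: (N_ge0 Hn) | exact: ler_norm].
rewrite ge0_fin_numE ?dnorm_ge0 //; exact: le_lt_trans h (ltry _).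
Qed.

Lemma nD_le (f : dual n) (c : R) : nD f <= c <-> 0 <= c /\ forall e, normc (dval f e) <= c * n e.
Proof. by rewrite -lee_fin -dnormE; exact: (dnorm_le _ (dual_is f)). Qed.

Lemma nD_bound (f : dual n) e : normc (dval f e) <= nD f * n e.
Proof. by have [+ _] := nD_le f (nD f); move=> /(_ (lexx _)) [_]; exact. Qed.

Lemma nD_ge0 (f : dual n) : 0 <= nD f.
Proof. by have [+ _] := nD_le f (nD f); move=> /(_ (lexx _)) []. Qed.

Lemma dvalD (f g : dual n) e : dval (f + g) e = dval f e + dval g e. Proof. by []. Qed.
Lemma dvalB (f g : dual n) e : dval (f - g) e = dval f e - dval g e. Proof. by []. Qed.
Lemma dvalZ a (f : dual n) e : dval (a *: f) e = a * dval f e. Proof. by []. Qed.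
Lemma dval_lfun (f : dual n) : lfun (dval f).
Proof. by case: (dual_is f). Qed.

Lemma dual_rep (g : E -> R[i]) (c : R) : 0 <= c -> lfun g ->
  (forall e, normc (g e) <= c * n e) -> exists f : dual n, nD f <= c /\ forall e, dval f e = g e.
Proof.
move=> c0 lg hg; have Dg : Dset n g by split=> //; exists c.
by exists (mk Dg); split=> //; apply/nD_le.
Qed.

Lemma nat_ultra : exists U : set_system nat, UltraFilter U /\ forall k, U [set m | (k <= m)%N].
Proof.
apply: (ultra_of_base 0%N) => [j k|k]; last by exists k => /=.
by exists (maxn j k) => m /=; rewrite geq_max => /andP[].
Qed.

Lemma nD_scale a (f : dual n) : nD (a *: f) = normc a * nD f.
Proof.
have le b (g : dual n) : nD (b *: g) <= normc b * nD g.
  apply/nD_le; split; first by rewrite mulr_ge0 ?normc_ge0 ?nD_ge0.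
  by move=> e; rewrite dvalZ normcM -mulrA; apply: ler_wpM2l (nD_bound _ _); exact: normc_ge0.
apply/eqP; rewrite eq_le le /=; have [->|a0] := eqVneq a 0.
  by rewrite Normc.normc0 mul0r nD_ge0.
have ap : 0 < normc a by rewrite lt_neqAle normc_ge0 andbT eq_sym; apply: contraNneq a0 => /Normc.eq0_normc ->.
have := le a^-1 (a *: f); rewrite scalerA mulVf // scale1r.
have -> : normc a^-1 = (normc a)^-1.
  by apply: (mulfI (lt0r_neq0 ap)); rewrite -normcM mulfV // Normc.normc1 mulfV // gt_eqF.
by rewrite mulrC ler_pdivlMr // mulrC.
Qed.

Lemma dual_banach : cbanach nD.
Proof.
split.
- exact: nD_ge0.
- move=> f f0; apply: dval_inj => e; apply: normc_le0.
  by apply: le_trans (nD_bound f e) _; rewrite f0 mul0r.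
- move=> f g; apply/nD_le; split; first by rewrite addr_ge0 ?nD_ge0.
  move=> e; rewrite dvalD mulrDl; apply: le_trans (normcD _ _) _.
  by apply: lerD; exact: nD_bound.
- exact: nD_scale.
(* Completeness: the limit is the pointwise ultralimit of the Cauchy sequence, started late enough
   to be bounded. *)
move=> u cau; have [U [UF Ut]] := nat_ultra.
have [M hM] := cau 1 ltr01.
pose c := nD (u M) + 1; have c0 : 0 <= c by rewrite addr_ge0 ?nD_ge0.
pose v m := u (M + m)%N.
have vc e m : normc (dval (v m) e) <= c * n e.
  have -> : dval (v m) e = dval (u M) e + dval (u (M + m)%N - u M) e by rewrite dvalB addrC subrK.
  apply: le_trans (normcD _ _) _; rewrite mulrDl; apply: lerD; first exact: nD_bound.
  apply: le_trans (nD_bound _ _) _; apply: ler_wpM2r; first exact: (N_ge0 Hn).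
  by apply: ltW; apply: hM => //; exact: leq_addr.
have [F hF] := choice (fun e => ucv_ex UF (vc e)).
have lF : lfun F.
  move=> a x y; apply: (ucv_uniq UF (hF _)).
  under eq_fun do rewrite dval_lfun.
  by apply: (ucvD UF) => //; exact: (ucvZ UF).
have [f [_ fF]] := dual_rep c0 lF (fun e => ucv_le UF (vc e) (hF e)).
exists f => e e0; have e2 : 0 < e / 2 by rlra.
have [M' hM'] := cau _ e2; exists M' => p Mp.
apply: le_lt_trans (_ : e / 2 < e); last rlra.
apply/nD_le; split; first exact: ltW.
move=> x; rewrite dvalB fF.
apply: (ucv_le_near UF (Ut M')) (ucvB UF (ucv_cst UF (dval (u p) x)) (hF x)) => m /= Mm.
rewrite -dvalB; apply: le_trans (nD_bound _ _) _; apply: ler_wpM2r; first exact: (N_ge0 Hn).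
by apply: ltW; apply: hM' => //; apply: leq_trans Mm _; exact: leq_addl.
Qed.

Lemma dual_pairing : dual_pair n nD (fun f e => dval f e).
Proof.
split=> //.
- exact: dual_banach.
- exact: dval_lfun.
- exact: nD_bound.
- exact: dual_rep.
- exact: dval_inj.
Qed.

Section Triple.
Variable tp : (E -> R[i]) -> (E -> R[i]) -> (E -> R[i]) -> (E -> R[i]).
Hypothesis JT : JBstar_triple_on_dual n tp.

Definition tpD (a b c : dual n) : dual n :=
  mk (tp_closed JT (dual_is a) (dual_is b) (dual_is c)).

Lemma tpD_linl al a a' b c : tpD (al *: a + a') b c = al *: tpD a b c + tpD a' b c.
Proof.
apply: val_inj; change (tp (fadd (fscale al (dval a)) (dval a')) (dval b) (dval c) =
  fadd (fscale al (tp (dval a) (dval b) (dval c))) (tp (dval a') (dval b) (dval c))).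
by apply: (tp_linear_l JT); exact: dual_is.
Qed.

Lemma tpD_linm al a b b' c : tpD a (al *: b + b') c = conjc al *: tpD a b c + tpD a b' c.
Proof.
apply: val_inj; change (tp (dval a) (fadd (fscale al (dval b)) (dval b')) (dval c) =
  fadd (fscale (conjc al) (tp (dval a) (dval b) (dval c))) (tp (dval a) (dval b') (dval c))).
by apply: (tp_conjlinear_m JT); exact: dual_is.
Qed.

Lemma tpD_sym a b c : tpD a b c = tpD c b a.
Proof. by apply: val_inj; apply: (tp_sym JT); exact: dual_is. Qed.

Lemma tpD_0l b c : tpD 0 b c = 0.
Proof. by have := tpD_linl (-1) 0 0 b c; rewrite scaler0 addr0 scaleN1r addNr. Qed.
Lemma tpD_0m a c : tpD a 0 c = 0.
Proof.
have := tpD_linm (-1) a 0 0 c; rewrite scaler0 addr0.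
have -> : conjc (-1 : R[i]) = -1 by rewrite conjcN; congr (- _); apply: complex_ext => //=; rewrite oppr0.
by rewrite scaleN1r addNr.
Qed.
Lemma tpD_Zl al a b c : tpD (al *: a) b c = al *: tpD a b c.
Proof. by have := tpD_linl al a 0 b c; rewrite tpD_0l !addr0. Qed.
Lemma tpD_Zr al a b c : tpD a b (al *: c) = al *: tpD a b c.
Proof. by rewrite tpD_sym tpD_Zl tpD_sym. Qed.
Lemma tpD_Zm al a b c : tpD a (al *: b) c = conjc al *: tpD a b c.
Proof. by have := tpD_linm al a b 0 c; rewrite tpD_0m !addr0. Qed.

(** Continuity at the origin gives a radius d below which the product has norm less than one; q =
    2/d rescales nonzero vectors to norm d/2, and homogeneity does the rest. *)
Lemma tpD_bounded : exists K : R, 1 <= K /\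
  forall a b c, nD (tpD a b c) <= K * (nD a * nD b * nD c).
Proof.
have [d [d0 hd]] := tp_continuous JT (dual_is 0) (dual_is 0) (dual_is 0) ltr01.
have small (a b c : dual n) : nD a < d -> nD b < d -> nD c < d -> nD (tpD a b c) < 1.
  move=> ha hb hc; have := hd _ _ _ (dual_is a) (dual_is b) (dual_is c).
  have e (f : dual n) : fsub (dval f) (dval (0 : dual n)) = dval f by rewrite -[RHS]/(dval f) -{2}[f]subr0.
  have t0 : tp (dval (0 : dual n)) (dval (0 : dual n)) (dval (0 : dual n)) = dval (0 : dual n).
    exact: (congr1 (@dval R E n) (tpD_0l 0 0)).
  rewrite !e t0 !dnormE !lte_fin.
  have -> : fsub (tp (dval a) (dval b) (dval c)) (dval (0 : dual n)) = dval (tpD a b c) by exact: (e (tpD a b c)).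
  by rewrite dnormE lte_fin; exact.
have NZd := NZp dual_banach; have zero (f : dual n) : nD f = 0 -> f = 0.
  by move=> f0; apply: (N_eq0 dual_banach); rewrite f0.
have [q q0 qE] : exists2 q : R, 0 < q & d * q = 2.
  by exists (2 / d); [rewrite divr_gt0 | rewrite mulrC divfK // gt_eqF].
exists (1 + q ^+ 3); split; first by rewrite lerDl exprn_ge0 // ltW.
move=> a b c.
have rhs0 : 0 <= (1 + q ^+ 3) * (nD a * nD b * nD c).
  by rewrite !mulr_ge0 ?nD_ge0 // addr_ge0 // exprn_ge0 // ltW.
have N0' := N0 dual_banach.
have [/zero a0|a0] := eqVneq (nD a) 0; first by apply: le_trans rhs0; rewrite a0 tpD_0l N0'.
have [/zero b0|b0] := eqVneq (nD b) 0; first by apply: le_trans rhs0; rewrite b0 tpD_0m N0'.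
have [/zero c0|c0] := eqVneq (nD c) 0; first by apply: le_trans rhs0; rewrite c0 tpD_sym tpD_0l N0'.
have ap : 0 < nD a by rewrite lt_neqAle eq_sym a0 nD_ge0.
have bp : 0 < nD b by rewrite lt_neqAle eq_sym b0 nD_ge0.
have cp : 0 < nD c by rewrite lt_neqAle eq_sym c0 nD_ge0.
have sc (f : dual n) : 0 < nD f -> nD ((q * nD f)^-1%:C *: f) < d.
  move=> fp; have qf : 0 < q * nD f by rewrite mulr_gt0.
  rewrite NZd ?invr_ge0 ?(ltW qf) // mulrC ltr_pdivrMr //.
  rewrite mulrA qE.
  rlra.
have := small _ _ _ (sc a ap) (sc b bp) (sc c cp).
rewrite tpD_Zl tpD_Zm tpD_Zr !nD_scale normc_conj !normcR !gtr0_norm ?invr_gt0 ?mulr_gt0 // => h.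
have P0 : 0 < (q * nD a) * ((q * nD b) * (q * nD c)) by rewrite !mulr_gt0.
have : nD (tpD a b c) <= (q * nD a) * ((q * nD b) * (q * nD c)).
  rewrite -[leRHS]mul1r -ler_pdivrMr // ltW //; apply: le_lt_trans h.
  rewrite le_eqVlt; apply/orP; left; apply/eqP; field.
  by rewrite !gt_eqF.
move=> i; apply: le_trans i _.
have -> : q * nD a * (q * nD b * (q * nD c)) = q ^+ 3 * (nD a * nD b * nD c) by ring.
by apply: ler_wpM2r; [rewrite !mulr_ge0 ?nD_ge0 | rlra].
Qed.

(** The functional on [dual n] is transported to a bidual element in the sense of [is_bidual], with
    value 0 off [Dset], and [u] is normalized because [hermitian] speaks of unit vectors. *)
Lemma tpD_herm a u f : supp nD f u -> Im (f (tpD a a u)) = 0.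
Proof.
move=> [lf cf fu].
have [u0|u0] := eqVneq (nD u) 0.
  have -> : u = 0 by apply: (N_eq0 dual_banach); rewrite u0.
  by rewrite tpD_sym tpD_0l (lfun0 lf).
have up : 0 < nD u by rewrite lt_neqAle eq_sym u0 nD_ge0.
pose v := (nD u)^-1%:C *: u.
have v1 : nD v = 1 by rewrite /v (NZp dual_banach) ?invr_ge0 ?(ltW up) // mulVf.
have fv : f v = 1 by rewrite (lfunZ lf) fu -rmorphM mulVf.
pose P (g : E -> R[i]) : R[i] := if pselect (Dset n g) is left h then f (mk h) else 0.
have PE (g : dual n) : P (dval g) = f g.
  rewrite /P; case: pselect => [h|/(_ (dual_is g))//].
  by congr f; apply: dval_inj.
have mkE g (h : Dset n g) : g = dval (mk h) by [].
have bP : is_bidual n P.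
  split.
    move=> b g h Dg Dh; rewrite (mkE g Dg) (mkE h Dh).
    change (P (dval (b *: mk Dg + mk Dh)) = b * P (dval (mk Dg)) + P (dval (mk Dh))).
    by rewrite !PE lf.
  exists 1 => g Dg; rewrite (mkE g Dg) PE dnormE -EFinM lee_fin mul1r; exact: cf.
have nP : bdnorm n P = 1%:E.
  apply/eqP; rewrite eq_le; apply/andP; split.
    apply: ge_ereal_sup => _ [g [Dg /= g1] <-]; rewrite (mkE g Dg) in g1 *.
    by rewrite PE lee_fin; rewrite dnormE lee_fin in g1; exact: le_trans (cf _) g1.
  apply: ereal_sup_ubound; exists (dval v); last by rewrite PE fv Normc.normc1.
  have dv : (dnorm n (dval v) <= 1%:E)%E by rewrite dnormE v1.
  by split; [exact: dual_is | exact: dv].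
have := tp_hermitian JT (dual_is a) (dual_is v) _ bP nP.
rewrite dnormE v1 PE => /(_ erefl fv).
rewrite -[tp _ _ _]/(dval (tpD a a v)) PE -complexIm /v tpD_Zr (lfunZ lf).
move=> /(congr1 (@complex.Re R)) /=; rewrite ImMr => /eqP.
by rewrite mulf_eq0 invr_eq0 (negbTE u0) /= => /eqP.
Qed.

Lemma tpD_jb : exists K : R, jb_axioms nD tpD K.
Proof.
have [K [K1 hK]] := tpD_bounded; exists K; split=> //.
- exact: dual_banach.
- exact: tpD_linl.
- exact: tpD_sym.
- exact: tpD_linm.
- move=> x y a b c; apply: val_inj.
  change (tp (dval x) (dval y) (tp (dval a) (dval b) (dval c)) =
    fadd (fsub (tp (tp (dval x) (dval y) (dval a)) (dval b) (dval c))
      (tp (dval a) (tp (dval y) (dval x) (dval b)) (dval c)))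
      (tp (dval a) (dval b) (tp (dval x) (dval y) (dval c)))).
  by apply: (tp_jordan JT); exact: dual_is.
- exact: tpD_herm.
- move=> a l nl g.
  have /contrapT h : ~ in_spectrum n (tp (dval a) (dval a)) l.
    by move=> /(tp_spectrum JT (dual_is a)).
  have [f [[Df ef] uf]] := h _ (dual_is g).
  exists (mk Df); split; first exact: val_inj.
  move=> f' e'; apply: dval_inj => e /=; rewrite (uf (dval f')) //; split; first exact: dual_is.
  by rewrite -e'.
- move=> a; have := tp_norm JT (dual_is a).
  rewrite -[tp _ _ _]/(dval (tpD a a a)) !dnormE -!EFinM => -[->]; ring.
Qed.

End Triple.

(** * The three inequalities between the measures *)

Section Inequalities.
Variable A : set E.
Variable M : R.
Hypothesis AM : forall a, A a -> n a <= M.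
Let DP := dual_pairing.

Lemma dist_ge0 P : (0 <= dist_to_E n P)%E.
Proof.
apply: le_ereal_inf_tmp => _ [x _ <-].
apply: le_trans (_ : (normc (P (dval (0 : dual n)) - dval (0 : dual n) x))%:E <= _)%E.
  by rewrite lee_fin normc_ge0.
have d0 : (dnorm n (dval (0%R : dual n)) <= 1%:E)%E by rewrite dnormE lee_fin (N0 dual_banach).
by apply: ereal_sup_ubound; exists (dval (0 : dual n)) => //; split; [exact: dual_is | exact: d0].
Qed.

Lemma bidual_lim (I : Type) (U : set_system I) (b : I -> E) (c : R) : UltraFilter U ->
  (forall i, n (b i) <= c) -> exists P, is_bidual n P /\
  forall f, Dset n f -> ucv U (fun i => f (b i)) (P f).
Proof.
move=> UF bc.
have bd (f : dual n) i : normc (dval f (b i)) <= nD f * c.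
  by apply: le_trans (nD_bound f _) _; apply: ler_wpM2l => //; exact: nD_ge0.
have sel (f : E -> R[i]) : exists l, Dset n f -> ucv U (fun i => f (b i)) l.
  have [Df|nf] := pselect (Dset n f); last by exists 0.
  by have [l hl] := ucv_ex UF (bd (mk Df)); exists l.
have [P hP] := choice sel; exists P; split=> //; split.
  move=> a f g Df Dg; have Dfg : Dset n (fadd (fscale a f) g) by exact: (dual_is (a *: mk Df + mk Dg)).
  apply: (ucv_uniq UF (hP _ Dfg)); apply: (ucvD UF); last exact: hP.
  by apply: (ucvZ UF); exact: hP.
exists c => f Df; rewrite -[f]/(dval (mk Df)) dnormE -EFinM lee_fin mulrC.
exact: (ucv_le UF (bd (mk Df)) (hP _ Df)).
Qed.

(** An ultralimit of the sequence is a cluster point that lies in the weak-star closure. Its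
    existence matters: the infimum over an empty cluster set would be infinite. *)
Lemma wck_le_wk : (wck n A <= wk n A)%E.
Proof.
apply: ge_ereal_sup => _ [u uA <-].
have [U [UF Ut]] := nat_ultra.
have [P [bP hP]] := bidual_lim UF (fun m => AM (uA m)).
have near k (fs : nat -> E -> R[i]) (e : R) : (forall i, (i < k)%N -> Dset n (fs i)) -> 0 < e ->
    U [set m | forall i, (i < k)%N -> normc (P (fs i) - fs i (u m)) < e].
  move=> Df e0; apply: ultra_fin => i ik.
  by apply: (ultraS UF) (hP _ (Df i ik) e e0) => m /=; rewrite normc_dist.
have cl : wstar_clust n u P.
  split=> // k fs e m0 Df e0.
  have [m [h1 h2]] := ultra_ex UF (ultraI UF (Ut m0) (near k fs e Df e0)).
  by exists m.
apply: le_trans (_ : dist_to_E n P <= _)%E; first by apply: ereal_inf_lbound; exists P.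
apply: ereal_sup_ubound; exists P => //; split=> // k fs e Df e0.
have [m hm] := ultra_ex UF (near k fs e Df e0); exists (u m); split=> //; exact: uA.
Qed.

Lemma closure_ultra P : wstar_closure n A P -> exists U : set_system E,
  [/\ UltraFilter U, U A & forall f : dual n, ucv U (fun a => dval f a) (P (dval f))].
Proof.
move=> [bP cl].
(* Basic neighbourhoods of [P], indexed by a finite list of functionals and a precision 1/(m + 1),
   traced on [A]; concatenation of lists and maximum of precisions make them directed. *)
pose Q (p : seq (dual n) * nat) : set E := [set a | A a /\
  forall i, (i < size p.1)%N -> normc (P (dval (nth 0 p.1 i)) - dval (nth 0 p.1 i) a) < p.2.+1%:R^-1].
have nQ p : Q p !=set0.
  have [|a [Aa ha]] := cl (size p.1) (fun i => dval (nth 0 p.1 i)) (p.2.+1%:R^-1) (fun i _ => dual_is _).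
    by rewrite invr_gt0 ltr0n.
  by exists a.
have mono j k : (j <= k)%N -> k.+1%:R^-1 <= j.+1%:R^-1 :> R.
  by move=> jk; rewrite lef_pV2 ?posrE ?ltr0n // ler_nat.
have [p q|U [UF UQ]] := ultra_of_base ([::], 0%N) _ nQ.
  exists (p.1 ++ q.1, maxn p.2 q.2) => a [Aa /= ha]; rewrite size_cat in ha; split; split=> // i ip.
    have := ha i (ltn_addr _ ip); rewrite nth_cat ip => h; apply: lt_le_trans h _.
    by apply: mono; exact: leq_maxl.
  have := ha (size p.1 + i)%N; rewrite ltn_add2l ip nth_cat ltnNge leq_addr /= addKn => /(_ isT) h.
  by apply: lt_le_trans h _; apply: mono; exact: leq_maxr.
exists U; split=> //; first by apply: (ultraS UF) (UQ ([::], 0%N)) => a [].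
move=> f e e0; have [m hm] := archi (e^-1).
apply: (ultraS UF) (UQ ([:: f], m)) => a [_ /(_ 0%N isT) /= h].
rewrite normc_dist; apply: lt_le_trans h _.
have m0 : 0 < m%:R :> R by apply: le_lt_trans hm; rewrite invr_ge0 ltW.
rewrite -[leRHS]invrK lef_pV2 ?posrE ?ltr0n ?invr_gt0 //; apply: ltW; apply: lt_le_trans hm _.
by rewrite ler_nat leqnSn.
Qed.

(** Move each [a] to a point of the weakly compact set at distance below r + d. Along an ultrafilter
    on which a tends to P, the moved points converge weakly to some x in that set, and the distance
    bound survives for P - x. *)
Lemma wk_le_deBlasi : (wk n A <= deBlasi n A)%E.
Proof.
apply: ge_ereal_sup => _ [P cP <-]; apply: le_ereal_inf_tmp => _ [C [C0 wC] <-].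
have [U [UF UA PU]] := closure_ultra cP.
apply/lee_addgt0Pr => d d0.
have [->|hfin] := eqVneq (hdist n A C) +oo%E; first by rewrite addye // leey.
have [a0 Aa0] := ultra_ex UF UA.
have hub a : A a -> (dist_pt n a C <= hdist n A C)%E by move=> Aa; apply: ereal_sup_ubound; exists a.
have h0 : (0 <= hdist n A C)%E.
  apply: le_trans (hub a0 Aa0); apply: le_ereal_inf_tmp => _ [b _ <-].
  by rewrite lee_fin (N_ge0 Hn).
have hr : hdist n A C \is a fin_num by rewrite ge0_fin_numE // lt_neqAle hfin leey.
pose r := fine (hdist n A C).
have rE : hdist n A C = r%:E by rewrite /r fineK.
have sel a : exists b, A a -> C b /\ n (a - b) < r + d.
  have [Aa|na] := pselect (A a); last by exists 0.
  have : (dist_pt n a C < (r + d)%:E)%E.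
    by apply: le_lt_trans (hub a Aa) _; rewrite rE lte_fin ltrDl.
  by move=> /ereal_inf_lt [_ [b Cb <-]]; rewrite lte_fin => h; exists b.
have [b hb] := choice sel.
have [|x [Cx cx]] := weakly_compact_lim DP (b := b) wC UF.
  by apply: (ultraS UF) UA => a /hb [].
apply: ge_ereal_inf; exists (bdnorm n (fun f => P f - f x)); first by exists x.
rewrite rE -EFinD; apply: ge_ereal_sup => _ [f [Df /= f1] <-].
have cf := ucvB UF (PU (mk Df)) (cx (mk Df)).
rewrite lee_fin; apply: (ucv_le_near UF UA) cf => a Aa /=.
have [_ hab] := hb a Aa.
have f1' : nD (mk Df) <= 1 by rewrite -lee_fin -dnormE.
rewrite -(lfunB (dval_lfun (mk Df))); apply: le_trans (nD_bound _ _) _.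
apply: le_trans (_ : 1 * n (a - b a) <= _); first by apply: ler_wpM2r => //; exact: (N_ge0 Hn).
by rewrite mul1r ltW.
Qed.

Variables (tp : (E -> R[i]) -> (E -> R[i]) -> (E -> R[i]) -> (E -> R[i])).
Hypothesis JT : JBstar_triple_on_dual n tp.

Lemma zero_compact : weakly_compact n [set 0].
Proof.
apply: (weakly_compact_intro DP) => U UF U0; exists 0; split=> // f e e0.
by apply: (ultraS UF) U0 => x /= ->; rewrite subrr Normc.normc0.
Qed.

Lemma deBlasi_le_wck : (deBlasi n A <= wck n A)%E.
Proof.
(* For empty [A] the excess over any set is the supremum of the empty set, that is minus
   infinity. *)
have [A0|/set0P [a0 Aa0]] := eqVneq A set0.
  apply: ge_ereal_inf; exists (hdist n A [set 0]).
    by exists [set 0] => //; split; [exists 0 | exact: zero_compact].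
  by rewrite /hdist A0 image_set0 ereal_sup0 leNye.
have M0 : 0 <= M by apply: le_trans (N_ge0 Hn a0) (AM Aa0).
have w0 : (0 <= wck n A)%E.
  apply: le_trans (_ : ereal_inf [set dist_to_E n P | P in wstar_clust n (fun=> a0)] <= _)%E.
    by apply: le_ereal_inf_tmp => _ [P _ <-]; exact: dist_ge0.
  by apply: ereal_sup_ubound; exists (fun=> a0).
have bM : (deBlasi n A <= M%:E)%E.
  apply: ge_ereal_inf; exists (hdist n A [set 0]).
    by exists [set 0] => //; split; [exists 0 | exact: zero_compact].
  apply: ge_ereal_sup => _ [a Aa <-]; apply: ge_ereal_inf; exists (n (a - 0))%:E; first by exists 0.
  by rewrite subr0 lee_fin AM.
rewrite leNgt; apply/negP => lt.
have wf : wck n A \is a fin_num by rewrite ge0_fin_numE //; apply: lt_trans lt (le_lt_trans bM (ltry _)).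
have df : deBlasi n A \is a fin_num.
  by rewrite ge0_fin_numE; [exact: le_lt_trans bM (ltry _) | exact: le_trans w0 (ltW lt)].
pose w := fine (wck n A); pose v := fine (deBlasi n A).
have wE : wck n A = w%:E by rewrite /w fineK.
have vE : deBlasi n A = v%:E by rewrite /v fineK.
rewrite wE lee_fin in w0; have lt' : w < v by move: lt; rewrite wE vE lte_fin.
clearbody w v.
(* The levels lam' - 2 eta, lam' and lam are the quarter points between w and v. *)
pose lam := (w + 3 * v) / 4; pose lam' := (w + v) / 2; pose eta := (v - w) / 8.
have far C : C !=set0 -> weakly_compact n C -> exists a, A a /\ forall k, C k -> lam <= n (a - k).
  move=> C0 wC; have : (lam%:E < hdist n A C)%E.
    apply: lt_le_trans (_ : deBlasi n A <= _)%E; first by rewrite vE lte_fin /lam; rlra.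
    by apply: ereal_inf_lbound; exists C.
  move=> /ereal_sup_gt [_ [a Aa <-]] h; exists a; split=> // k Ck.
  rewrite -lee_fin; apply: le_trans (ltW h) _; apply: ereal_inf_lbound; by exists k.
have [K J] := tpD_jb JT.
have M1 : 0 < M + 1 by rlra.
have AM1 a : A a -> n a <= M + 1 by move=> /AM; rlra.
have l0 : 0 < lam' by rewrite /lam'; rlra.
have ll : lam' < lam by rewrite /lam /lam'; rlra.
have eta0 : 0 < eta by rewrite /eta; rlra.
have [a [f [aA f1 f2 f3]]] := construction DP eta0 (next_point DP J AM1 M1 l0 ll far).
pose mu := lam' - 2 * eta.
have wmu : w < mu by rewrite /mu /lam' /eta; rlra.
suff : (mu%:E <= wck n A)%E by rewrite wE lee_fin; rlra.
apply: le_trans (_ : ereal_inf [set dist_to_E n P | P in wstar_clust n a] <= _)%E; last first.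
  by apply: ereal_sup_ubound; exists a.
apply: le_ereal_inf_tmp => _ [P [bP cl] <-]; apply: le_ereal_inf_tmp => _ [x _ <-].
apply/lee_addgt0Pr => e e0; have e2 : 0 < e / 2 by rlra.
(* [f k] nearly vanishes at [x], while P(f_k) is close to f_k(a_m) for some m >= k, of modulus at
   least [mu]; so P - x has norm at least [mu] up to [e]. *)
have [k hk] := f3 x _ e2; have {}hk := hk k (leqnn k).
have [m [km hm]] := cl 1%N (fun=> dval (f k)) (e / 2) k (fun i _ => dual_is (f k)) e2.
have {}hm := hm 0%N isT; have i1 := f2 k m km.
have : ((normc (P (dval (f k)) - dval (f k) x))%:E <= bdnorm n (fun g => (P g - g x)%R))%E.
  have d1 : (dnorm n (dval (f k)) <= 1%:E)%E by rewrite dnormE lee_fin.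
  by apply: ereal_sup_ubound; exists (dval (f k)) => //; split; [exact: dual_is | exact: d1].
move=> i2; apply: le_trans (leeD2r e%:E i2); rewrite -EFinD lee_fin.
have e1 : dval (f k) (a m) = (P (dval (f k)) - dval (f k) x) + dval (f k) x - (P (dval (f k)) - dval (f k) (a m)).
  by rewrite subrK subKr.
have i3 := normcB ((P (dval (f k)) - dval (f k) x) + dval (f k) x) (P (dval (f k)) - dval (f k) (a m)).
have i4 := normcD (P (dval (f k)) - dval (f k) x) (dval (f k) x).
rewrite -e1 in i3; rewrite -/mu in i1; rlra.
Qed.

End Inequalities.

End DualSpace.

Theorem theorem4p1 (R : realType) (E : lmodType R[i]) (n : E -> R)
  (tp : (E -> R[i]) -> (E -> R[i]) -> (E -> R[i]) -> (E -> R[i]))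
  (A : classical_sets.set E) :
  cbanach n -> JBstar_triple_on_dual n tp -> bounded_set n A ->
  deBlasi n A = wk n A /\ wk n A = wck n A.
Proof.
move=> Hn JT [M AM].
have h1 := wck_le_wk Hn AM; have h2 := wk_le_deBlasi Hn A.
have h3 := deBlasi_le_wck Hn AM JT.
split; apply/eqP; rewrite eq_le; apply/andP; split=> //.
- exact: le_trans h3 h1.
- exact: le_trans h2 h3.
Qed.
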